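(* (Fundamental Theorem of Clifford Codes.) Consider a Clifford code with an encoder-respecting form whose input-output adjacency matrix has full rank. Then there exists a decomposition of the code into a product of prime codes, and this decomposition is unique up to a permutation of the input nodes.
   Context: ZX diagrams are built from $Z$ nodes (tensor $|0\rangle^{\otimes b}\langle 0|^{\otimes a}+e^{i\alpha}|1\rangle^{\otimes b}\langle 1|^{\otimes a}$), $X$ nodes (the same with $|\pm\rangle$), Hadamard gates on edges, and edges (contractions), and are considered up to nonzero scalars. The rewrite rules are the standard ones (merging/un-merging, identity removal, Hadamard cancellation, $\pi$-copy, state-copy, color change, bialgebra, Hopf, with colors interchangeable). They are sound and complete for Clifford diagrams: two diagrams are interconvertible iff they represent the same linear map up to nonzero scalar. A Clifford code with $k$ inputs and $n$ outputs is a stabilizer code on $n$ qubits with $n-k$ independent Pauli stabilizer generators; its codespace is their joint $+1$ eigenspace. An encoder is an injective Clifford map from $k$ qubits onto the codespace; encoders differing by a unitary on the inputs are identified. Encoder-respecting form: every node is an input node (one free input edge) or an output node (one free output edge); outputs are numbered $1,\dots,n$; input nodes are connected only to output nodes; output nodes may be connected to each other; local Clifford operations may be present on free output edges. KLS form: an encoder-respecting diagram with all nodes $Z$ nodes such that: (Edge rule) all internal edges carry Hadamards, with exactly one $Z$ node per free edge; (Hadamard rule) an output node with a Hadamard on its free edge shares no edge with a lower-numbered output node or with an input node; (RREF rule) the input-to-output adjacency matrix over $\mathbb{F}_2$ is in reduced row echelon form; (Clifford rule) the outputs in pivot columns are called pivots; there are no local Clifford operations on pivot or input nodes or on their free edges,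 and there are no input-input or pivot-pivot edges. Local Cliffords on outputs are taken from $\{I,Z,S,SZ,H,HZ\}$. Each Clifford code has exactly one KLS form (a known result). A prime code diagram (prime code) is a ZX diagram in KLS form that cannot be expressed as a disconnected graph (connected components without free edges are merely scalars) after any sequence of rewrite rules. A decomposition of a code into a product of primes is a diagram for the code that is a disjoint union (tensor product) of prime code diagrams, each component retaining the relative order of its output labels. *)

(* Defs.v *)
From HB Require Import structures.
From mathcomp Require Import all_boot all_order all_algebra all_fingroup.
From mathcomp Require Import reals trigo complex.

Set Implicit Arguments.
Unset Strict Implicit.
Unset Printing Implicit Defensive.

Import Order.TTheory GRing.Theory Num.Theory.
Local Open Scope ring_scope.

(** * Qubits, Pauli operators, Clifford codes *)

Definition bits (n : nat) := {ffun 'I_n -> bool}.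

Section Qubits.
Variable R : realType.
Local Notation C := (complex R).

Definition state (n : nat) := {ffun bits n -> C}.

(** A kernel [M y x] is the matrix entry <y|M|x>. *)
Definition apply (k n : nat) (M : bits n -> bits k -> C) (psi : state k) :
  state n := [ffun y => \sum_(x : bits k) M y x * psi x].

Definition ix (b : bool) : 'I_2 := if b then 1 else 0.

Definition mx2 (a b c d : C) : 'M[C]_2 :=
  \matrix_(i, j) (if i == 0 then (if j == 0 then a else b)
                            else (if j == 0 then c else d)).

End Qubits.

Inductive pauli1 := PauliI | PauliX | PauliY | PauliZ.

(** The Hermitian Pauli operator (-1)^sign (P_0 ⊗ ... ⊗ P_(n-1)). *)
Record pauli (n : nat) := Pauli {
  pauli_sign : bool;
  pauli_at : {ffun 'I_n -> pauli1}
}.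

Section Codes.
Variable R : realType.
Local Notation C := (complex R).
Local Notation imag := (Complex 0 1 : C).

Definition pauli1_mx (p : pauli1) : 'M[C]_2 :=
  match p with
  | PauliI => mx2 1 0 0 1
  | PauliX => mx2 0 1 1 0
  | PauliY => mx2 0 (- imag) imag 0
  | PauliZ => mx2 1 0 0 (- 1)
  end.

Definition pauli_op (n : nat) (P : pauli n) : state R n -> state R n :=
  apply (fun y x : bits n => (-1) ^+ pauli_sign P *
           \prod_(j < n) pauli1_mx (pauli_at P j) (ix (y j)) (ix (x j))).

Definition pauli_prod (n m : nat) (g : 'I_m -> pauli n) (A : {set 'I_m}) :
    state R n -> state R n :=
  \big[(fun f h => f \o h)/id]_(a in A) pauli_op (g a).

(** [stab_indep]: no product of a nonempty set of generators is a multiple of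
    the identity.  This is independence of the generators together with the
    requirement that -1 is not in the stabilizer group. *)
Record clifford_code (k n : nat) := CliffordCode {
  stab : 'I_(n - k) -> pauli n;
  code_le : (k <= n)%N;
  stab_comm : forall a b psi,
    pauli_op (stab a) (pauli_op (stab b) psi) =
    pauli_op (stab b) (pauli_op (stab a) psi);
  stab_indep : forall A : {set 'I_(n - k)}, A != set0 ->
    forall c : C, ~ (forall psi x, pauli_prod stab A psi x = c * psi x)
}.

Definition codespace (k n : nat) (K : clifford_code k n) (psi : state R n) :=
  forall a, pauli_op (stab K a) psi = psi.

(** Since only the image is prescribed, encoders that differ by an operation on
    the inputs encode the same code. *)
Definition encodes (k n : nat) (M : bits n -> bits k -> C)
    (K : clifford_code k n) : Prop :=
  injective (apply M) /\
  (forall psi : state R n, codespace K psi <-> exists phi, apply M phi = psi).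

End Codes.

(** * ZX diagrams *)

Inductive color := ColZ | ColX.
Definition flip (c : color) := match c with ColZ => ColX | ColX => ColZ end.

(** An end of an edge is a node, an input of the diagram or an output of it;
    the edge [(p, m, q)] joins [p] and [q] and carries [m] Hadamard gates.  A
    free edge is one with an end [inp i] or [out j]. *)
Definition point (V : Type) (k n : nat) := (V + ('I_k + 'I_n))%type.
Definition edge (V : Type) (k n : nat) := (point V k n * nat * point V k n)%type.

Definition nd V k n (v : V) : point V k n := inl v.
Definition inp V k n (i : 'I_k) : point V k n := inr (inl i).
Definition out V k n (j : 'I_n) : point V k n := inr (inr j).
Arguments nd {V k n}.
Arguments inp {V k n}.
Arguments out {V k n}.

Definition map_point V V' k k' n n' (f : V -> V') (g : 'I_k -> 'I_k')
    (h : 'I_n -> 'I_n') (p : point V k n) : point V' k' n' :=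
  match p with
  | inl v => nd (f v)
  | inr (inl i) => inp (g i)
  | inr (inr j) => out (h j)
  end.
Definition map_edge V V' k k' n n' (f : point V k n -> point V' k' n')
    (e : edge V k n) : edge V' k' n' := (f e.1.1, e.1.2, f e.2).

Definition mapn V V' k n (f : V -> V') : point V k n -> point V' k n :=
  map_point f id id.
Definition mape V V' k n (f : V -> V') : edge V k n -> edge V' k n :=
  map_edge (mapn f).

(** One more Hadamard gate at each end [p]. *)
Definition add_had (V : eqType) k n (p : point V k n) (e : edge V k n) :
    edge V k n :=
  (e.1.1, (e.1.2 + (e.1.1 == p) + (e.2 == p))%N, e.2).

Section ZX.
Variable R : realType.
Local Notation C := (complex R).

(** In the diagrams considered below every input and every output of the diagram
    is an end of exactly one edge; the rewrite rules preserve this. *)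
Record zx (k n : nat) := Zx {
  node : finType;
  node_color : node -> color;
  node_phase : node -> R;
  edges : seq (edge node k n)
}.

Definition expi (a : R) : C := Complex (cos a) (sin a).

Definition had : 'M[C]_2 :=
  (Complex (Num.sqrt 2) 0)^-1 *: mx2 1 1 1 (- 1).

(** |0>, |1> for Z, and |+>, |-> for X. *)
Definition ket (c : color) (s : bool) : 'cV[C]_2 :=
  let z := delta_mx (ix s) 0 in
  match c with ColZ => z | ColX => had *m z end.

Section Interp.
Variables (k n : nat) (D : zx k n).

Definition end_vec (s : {ffun node D -> bool}) (y : bits n) (x : bits k)
    (p : point (node D) k n) : 'cV[C]_2 :=
  match p with
  | inl v => ket (node_color v) (s v)
  | inr (inl i) => ket ColZ (x i)
  | inr (inr j) => ket ColZ (y j)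
  end.

Definition edge_amp s y x (e : edge (node D) k n) : C :=
  ((end_vec s y x e.1.1)^T *m (had ^+ e.1.2 *m end_vec s y x e.2)) 0 0.

(** The entry <y|D|x> of the linear map of [D].  The tensor of a node of phase
    [a] is the sum over s in {0,1} of [expi a]^s |s>...|s> in the basis of its
    color; the sum over [s] expands these tensors at all nodes at once.  As [ket]
    and [had] are real, transposing [end_vec] is the same as bending the wire. *)
Definition interp (y : bits n) (x : bits k) : C :=
  \sum_(s : {ffun node D -> bool})
     (\prod_v (if s v then expi (node_phase v) else 1)) *
     (\prod_(e <- edges D) edge_amp s y x e).

(** Two of the connected components have free edges. *)
Definition disconnected : Prop :=
  exists S : point (node D) k n -> bool,
    [/\ forall e, e \in edges D -> S e.1.1 = S e.2,
        exists b, S (inr b) & exists b, ~~ S (inr b)].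

End Interp.

Definition void_bits : bits 0 := [ffun=> false].
Definition scalar (D : zx 0 0) : C := interp D void_bits void_bits.

(** ** Rewrite rules

    Each rule is stated in one direction and for both colors; [rewrites] below is
    the equivalence closure.  The nodes on which a rule acts are added to a set [V]
    of other nodes by [option] or by a sum.  Points and edges lifted from [V] do
    not touch the added nodes. *)

Section Rules.
Variables k n : nat.
Local Notation pt V := (point V k n).
Local Notation ed V := (edge V k n).

(** The legs [(m_i, b_i)], attached to the nodes [v i]. *)
Definition legs (V : Type) (r : nat) (v : 'I_r -> V)
    (b : 'I_r -> nat * pt V) : seq (ed V) :=
  [seq (nd (v i), (b i).1, (b i).2) | i : 'I_r].

Definition lift_legs (V V' : Type) (f : V -> V') (r : nat)
    (b : 'I_r -> nat * pt V) : 'I_r -> nat * pt V' :=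
  fun i => ((b i).1, mapn f (b i).2).

Definition add_scalar (D : zx k n) (D0 : zx 0 0) : zx k n :=
  @Zx k n (node D + node D0)%type
    (fun v => match v with inl u => node_color u | inr u => node_color u end)
    (fun v => match v with inl u => node_phase u | inr u => node_phase u end)
    ([seq mape inl e | e <- edges D] ++
     [seq map_edge (map_point inr (widen_ord (leq0n k)) (widen_ord (leq0n n))) e
        | e <- edges D0]).

Inductive step : zx k n -> zx k n -> Prop :=
(* diagrams as graphs: renaming nodes, listing and orienting the edges *)
| Iso (D D' : zx k n) (f : node D -> node D') :
    bijective f ->
    (forall v, node_color (f v) = node_color v) ->
    (forall v, node_phase (f v) = node_phase v) ->
    perm_eq [seq mape f e | e <- edges D] (edges D') ->
    step D D'
| Turn (V : finType) col ph (p q : pt V) m E :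
    step (@Zx k n V col ph ((p, m, q) :: E)) (@Zx k n V col ph ((q, m, p) :: E))
(* phases are angles modulo 2 pi *)
| Period (V : finType) col (ph ph' : V -> R) E :
    (forall v, exists z : int, ph' v = ph v + z%:~R * (2 * pi)) ->
    step (@Zx k n V col ph E) (@Zx k n V col ph' E)
(* diagrams are considered up to nonzero scalars *)
| Scalar (D : zx k n) (D0 : zx 0 0) :
    scalar D0 <> 0 -> step (add_scalar D D0) D
| Merge (V : finType) (col : option V -> color) (ph : option V -> R)
    (u : V) (m : nat) (E : seq (ed (option V))) :
    col None = col (Some u) ->
    step (@Zx k n (option V) col ph
            (nseq m.+1 (nd None, 0%N, nd (Some u)) ++ E))
         (@Zx k n V (fun v => col (Some v))
            (fun v => if v == u then ph (Some u) + ph None else ph (Some v))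
            [seq mape (odflt u) e | e <- E])
| Identity (V : finType) (col : option V -> color) (ph : option V -> R)
    (p q : pt V) (m m' : nat) (E : seq (ed V)) :
    ph None = 0 ->
    step (@Zx k n (option V) col ph
            ((mapn Some p, m, nd None) :: (nd None, m', mapn Some q) ::
             [seq mape Some e | e <- E]))
         (@Zx k n V (fun v => col (Some v)) (fun v => ph (Some v))
            ((p, (m + m')%N, q) :: E))
| HadCancel (V : finType) col ph (p q : pt V) m E :
    step (@Zx k n V col ph ((p, m.+2, q) :: E))
         (@Zx k n V col ph ((p, m, q) :: E))
| ColorChange (V : finType) (col : V -> color) ph (u : V) E :
    step (@Zx k n V col ph E)
         (@Zx k n V (fun v => if v == u then flip (col v) else col v) ph
            [seq add_had (nd u) e | e <- E])
(* the node [inl None], with legs [(m, p)] and [b i], and [inr tt] of the other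
   color and of phase pi on its leg [(m, p)] *)
| PiCopy (V : finType) (col : option V -> color) (ph : option V -> R)
    (m : nat) (p : pt V) (r : nat) (b : 'I_r -> nat * pt V) (E : seq (ed V)) :
    step (@Zx k n (option V + unit)%type
            (fun v => match v with inl x => col x | inr _ => flip (col None) end)
            (fun v => match v with inl x => ph x | inr _ => pi end)
            ((mapn (inl \o Some) p, m, nd (inr tt)) ::
             (nd (inr tt), 0%N, nd (inl None)) ::
             legs (fun=> inl None) (lift_legs (inl \o Some) b) ++
             [seq mape (inl \o Some) e | e <- E]))
         (@Zx k n (option V + 'I_r)%type
            (fun v => match v with inl x => col x | inr _ => flip (col None) end)
            (fun v => match v with
                      | inl None => - ph None
                      | inl (Some x) => ph (Some x)
                      | inr _ => pi
                      end)
            ((mapn (inl \o Some) p, m, nd (inl None)) ::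
             [seq (nd (inl None), 0%N, nd (inr i)) | i : 'I_r] ++
             legs inr (lift_legs (inl \o Some) b) ++
             [seq mape (inl \o Some) e | e <- E]))
(* the state [inr tt], of the other color and of phase 0 or pi, on a leg of the
   node [inl None], whose other legs are [b i] *)
| StateCopy (V : finType) (col : option V -> color) (ph : option V -> R)
    (a : bool) (r : nat) (b : 'I_r -> nat * pt V) (E : seq (ed V)) :
    step (@Zx k n (option V + unit)%type
            (fun v => match v with inl x => col x | inr _ => flip (col None) end)
            (fun v => match v with inl x => ph x | inr _ => a%:R * pi end)
            ((nd (inr tt), 0%N, nd (inl None)) ::
             legs (fun=> inl None) (lift_legs (inl \o Some) b) ++
             [seq mape (inl \o Some) e | e <- E]))
         (@Zx k n (V + 'I_r)%type
            (fun v => match v with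
                      | inl x => col (Some x)
                      | inr _ => flip (col None)
                      end)
            (fun v => match v with inl x => ph (Some x) | inr _ => a%:R * pi end)
            (legs inr (lift_legs inl b) ++ [seq mape inl e | e <- E]))
(* [inr false], of color [c] with legs [a i], joined to [inr true], of the other
   color with legs [b j], become a complete bipartite graph *)
| Bialgebra (V : finType) (col : V -> color) (ph : V -> R) (c : color)
    (r s : nat) (a : 'I_r -> nat * pt V) (b : 'I_s -> nat * pt V)
    (E : seq (ed V)) :
    step (@Zx k n (V + bool)%type
            (fun v => match v with
                      | inl x => col x
                      | inr false => c
                      | inr true => flip c
                      end)
            (fun v => match v with inl x => ph x | inr _ => 0 end)
            ((nd (inr false), 0%N, nd (inr true)) ::
             legs (fun=> inr false) (lift_legs inl a) ++
             legs (fun=> inr true) (lift_legs inl b) ++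
             [seq mape inl e | e <- E]))
         (@Zx k n (V + ('I_r + 'I_s))%type
            (fun v => match v with
                      | inl x => col x
                      | inr (inl _) => flip c
                      | inr (inr _) => c
                      end)
            (fun v => match v with inl x => ph x | inr _ => 0 end)
            ([seq (nd (inr (inl i)), 0%N, nd (inr (inr j)))
                | i <- enum 'I_r, j <- enum 'I_s] ++
             legs (fun i => inr (inl i)) (lift_legs inl a) ++
             legs (fun j => inr (inr j)) (lift_legs inl b) ++
             [seq mape inl e | e <- E]))
| Hopf (V : finType) (col : V -> color) ph (u v : V) E :
    col v = flip (col u) ->
    step (@Zx k n V col ph ((nd u, 0%N, nd v) :: (nd u, 0%N, nd v) :: E))
         (@Zx k n V col ph E).

Inductive rewrites : zx k n -> zx k n -> Prop :=
| rewrites_refl D : rewrites D D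
| rewrites_step D1 D2 D3 : step D1 D2 -> rewrites D2 D3 -> rewrites D1 D3
| rewrites_back D1 D2 D3 : step D2 D1 -> rewrites D2 D3 -> rewrites D1 D3.

End Rules.
End ZX.

(** * Encoder-respecting diagrams and KLS forms *)

(** H and S generate the one-qubit Clifford operations up to scalars; a word is
    read as an operator product, so that its last letter acts first. *)
Inductive gate := GateH | GateS.

(** The nodes are the [k] input nodes and the [n] output nodes.  Node phases are
    multiples of pi/2, as for every Clifford diagram; [None] is the absence of
    an edge and [Some h] an edge with a Hadamard gate iff [h].  [er_gates j] is
    the local Clifford operation on the free edge of the output node [j]. *)
Record er_diagram (k n : nat) := ErDiagram {
  er_in_color : {ffun 'I_k -> color};
  er_out_color : {ffun 'I_n -> color};
  er_in_phase : {ffun 'I_k -> 'Z_4};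
  er_out_phase : {ffun 'I_n -> 'Z_4};
  er_io : {ffun 'I_k * 'I_n -> option bool};
  er_oo : {ffun 'I_n * 'I_n -> option bool};
  er_gates : {ffun 'I_n -> seq gate}
}.

Definition encoder_respecting (k n : nat) (D : er_diagram k n) : Prop :=
  (forall j j', er_oo D (j, j') = er_oo D (j', j)) /\
  (forall j, er_oo D (j, j) = None).

Definition io_adj (k n : nat) (D : er_diagram k n) : 'M['F_2]_(k, n) :=
  \matrix_(i, j) (isSome (er_io D (i, j)))%:R.

Section ErToZX.
Variable R : realType.

Definition quarter_turns (q : 'Z_4) : R := (q : nat)%:R * (pi / 2).

Definition gate_on_output (k n : nat) (j : 'I_n) (g : gate) (D : zx R k n) :
    zx R k n :=
  match g with
  | GateH =>
      @Zx R k n (node D) (@node_color _ _ _ D) (@node_phase _ _ _ D)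
        [seq add_had (out j) e | e <- edges D]
  | GateS =>
      @Zx R k n (option (node D))
        (oapp (@node_color _ _ _ D) ColZ) (oapp (@node_phase _ _ _ D) (pi / 2))
        ((nd None, 0%N, out j) ::
         [seq map_edge (fun p => if p == out j then nd None else mapn Some p) e
            | e <- edges D])
  end.

Definition er_core (k n : nat) (D : er_diagram k n) : zx R k n :=
  @Zx R k n ('I_k + 'I_n)%type
    (fun v => match v with
              | inl i => er_in_color D i
              | inr j => er_out_color D j
              end)
    (fun v => quarter_turns match v with
                            | inl i => er_in_phase D i
                            | inr j => er_out_phase D j
                            end)
    ([seq (inp i, 0%N, nd (inl i)) | i : 'I_k] ++
     [seq (nd (inr j), 0%N, out j) | j : 'I_n] ++
     pmap (fun ij : 'I_k * 'I_n => omap (fun h : bool => (nd (inl ij.1), h : nat, nd (inr ij.2)))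
                          (er_io D ij))
          (enum {: 'I_k * 'I_n}) ++
     pmap (fun jj : 'I_n * 'I_n => omap (fun h : bool => (nd (inr jj.1), h : nat, nd (inr jj.2)))
                          (er_oo D jj))
          [seq jj : 'I_n * 'I_n <- enum {: 'I_n * 'I_n} | (jj.1 < jj.2)%N]).

Definition er_zx (k n : nat) (D : er_diagram k n) : zx R k n :=
  foldr (fun j D' => foldr (gate_on_output j) D' (er_gates D j))
        (er_core D) (enum 'I_n).

End ErToZX.

(** [A i j] is the leading entry of row [i]. *)
Definition leading (F : fieldType) (k n : nat) (A : 'M[F]_(k, n))
    (i : 'I_k) (j : 'I_n) : Prop :=
  A i j != 0 /\ forall j' : 'I_n, (j' < j)%N -> A i j' = 0.

Definition rref (F : fieldType) (k n : nat) (A : 'M[F]_(k, n)) : Prop :=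
  [/\ forall i i' : 'I_k, (i < i')%N -> row i A = 0 -> row i' A = 0,
      forall (i i' : 'I_k) (j j' : 'I_n),
        (i < i')%N -> leading A i j -> leading A i' j' -> (j < j')%N &
      forall i j, leading A i j ->
        A i j = 1 /\ forall i', i' != i -> A i' j = 0].

Definition pivot (k n : nat) (D : er_diagram k n) (j : 'I_n) : Prop :=
  exists i, leading (io_adj D) i j.

Definition has_H (w : seq gate) : bool :=
  has (fun g => if g is GateH then true else false) w.

(** The local Clifford operations I, S, Z, SZ, H, HZ, with Z-rotations given by
    the phase of the output node. *)
Definition kls_local (q : 'Z_4) (w : seq gate) : Prop :=
  match w with
  | [::] => True
  | [:: GateH] => q = 0 \/ q = 2%:R
  | _ => False
  end.

Record kls (k n : nat) (D : er_diagram k n) : Prop := Kls {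
  kls_er : encoder_respecting D;
  kls_color : (forall i, er_in_color D i = ColZ) /\
              (forall j, er_out_color D j = ColZ);
  kls_edge : (forall ij, er_io D ij <> Some false) /\
             (forall jj, er_oo D jj <> Some false);
  kls_hadamard : forall j, has_H (er_gates D j) ->
    (forall j' : 'I_n, (j' < j)%N -> er_oo D (j', j) = None) /\
    (forall i, er_io D (i, j) = None);
  kls_rref : rref (io_adj D);
  kls_clifford_in : forall i, er_in_phase D i = 0;
  kls_clifford_pivot : forall j, pivot D j ->
    er_out_phase D j = 0 /\ er_gates D j = [::];
  kls_pivot_pivot : forall j j', pivot D j -> pivot D j' ->
    er_oo D (j, j') = None;
  kls_locals : forall j, kls_local (er_out_phase D j) (er_gates D j)
}.

(** * Prime codes and decompositions *)

(** The empty diagram is a scalar; like 1 among the integers, it is not prime. *)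
Definition prime_diagram (R : realType) (k n : nat) (D : er_diagram k n) : Prop :=
  [/\ kls D, (0 < k + n)%N &
      ~ exists D' : zx R k n, rewrites (er_zx R D) D' /\ disconnected D'].

(** A diagram whose inputs and outputs are labelled by inputs and outputs of a
    code with [k] inputs and [n] outputs. *)
Record factor (k n : nat) := Factor {
  factor_k : nat;
  factor_n : nat;
  factor_diagram : er_diagram factor_k factor_n;
  factor_in : {ffun 'I_factor_k -> 'I_k};
  factor_out : {ffun 'I_factor_n -> 'I_n}
}.

Definition permute_inputs (k n : nat) (s : {perm 'I_k}) (F : factor k n) :
    factor k n :=
  Factor (factor_diagram F) [ffun i => s (factor_in F i)] (factor_out F).

Section Decomposition.
Variables (R : realType) (k n r : nat).

Definition disjoint_union (P : 'I_r -> factor k n) : zx R k n :=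
  let D t := er_zx R (factor_diagram (P t)) in
  @Zx R k n {t : 'I_r & node (D t)}
    (fun v => node_color (tagged v))
    (fun v => node_phase (tagged v))
    (flatten [seq [seq map_edge
                         (map_point (fun v => existT (fun t => node (D t)) t v)
                            (factor_in (P t)) (factor_out (P t))) e
                     | e <- edges (D t)]
                | t : 'I_r]).

Record prime_decomposition (K : clifford_code R k n) (P : 'I_r -> factor k n) :
    Prop := PrimeDecomposition {
  factor_prime : forall t, prime_diagram R (factor_diagram (P t));
  factor_ordered : forall t (j j' : 'I_(factor_n (P t))),
    (j < j')%N -> (factor_out (P t) j < factor_out (P t) j')%N;
  factor_in_label : forall i : 'I_k,
    exists! u : {t : 'I_r & 'I_(factor_k (P t))},
      factor_in (P (tag u)) (tagged u) = i;
  factor_out_label : forall j : 'I_n,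
    exists! u : {t : 'I_r & 'I_(factor_n (P t))},
      factor_out (P (tag u)) (tagged u) = j;
  factor_encodes : encodes (interp (disjoint_union P)) K
}.

End Decomposition.

(* Main.v *)
(** A KLS diagram has the amplitudes
      c [y in L] (-1)^(x . syndrome y) quad y,
    where L is an affine subspace parametrised by the outputs without Hadamard
    gate and quad is a quadratic form with values in the powers of i.  Support,
    syndrome kernel and quadratic form can be read off the code, and together
    with the pivots they determine the diagram up to the order of the inputs;
    hence a code has one KLS diagram up to that order.  Rewriting preserves the
    amplitudes up to a scalar, and the amplitudes of a disconnected diagram
    factor along a partition of the free edges; for a KLS diagram such a
    factorization means that no edge crosses the partition.  So a KLS diagram is
    prime exactly when its graph is connected, and the prime decompositions of a
    code are the splittings of its KLS diagram into connected components. *)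

(* The KLS diagram of a code is not reached by rewriting the given encoder; it is read off the
   stabilizer group, whose elements are c Z^b X^a. The Z-type elements, reduced so that each leads
   at its first output, are the equations of the support, and their leads are the Hadamard outputs.
   The X-parts, reduced so that each leads at its last output off those, single out the non-pivots;
   exactly k outputs remain, the pivots. The other edges and phases are then forced: translation by
   an X-part must change the quadratic form by the sign and scalar of its stabilizer. This only puts
   the codespace inside the code of the diagram; equality comes from the injectivity of the encoder,
   both spaces being injective images of C^(2^k).

   Gluing the factors of a decomposition interleaves their inputs, so the glued diagram is row
   reduced but its rows may be out of order, and it need not be KLS. Uniqueness is therefore proved
   for [pivoted] diagrams, where the pivot need not increase with the input. The order is recovered
   inside each factor, where it pins down the labelling of the inputs. *)
Require Import Defs.
From mathcomp Require Import all_boot all_order all_algebra all_fingroup.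
From mathcomp Require Import boolp.
From mathcomp Require Import reals trigo complex ring zify.

Set Implicit Arguments.
Unset Strict Implicit.
Unset Printing Implicit Defensive.

Import Order.TTheory GRing.Theory Num.Theory.
Local Open Scope ring_scope.

(** * Finite sums and kets *)

Section FiniteSums.
Variable C : comNzRingType.

Definition ffun_sum (V W : finType) (s : {ffun V -> bool}) (t : {ffun W -> bool}) :
    {ffun V + W -> bool} :=
  [ffun v => match v with inl a => s a | inr b => t b end].

Definition ffun_option (V : finType) (b : bool) (s : {ffun V -> bool}) :
    {ffun option V -> bool} :=
  [ffun v => if v is Some a then s a else b].

Lemma sum_ffun_sum (V W : finType) (F : {ffun V + W -> bool} -> C) :
  \sum_s F s = \sum_(s : {ffun V -> bool}) \sum_(t : {ffun W -> bool}) F (ffun_sum s t).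
Proof.
rewrite pair_bigA /=; pose h (p : {ffun V -> bool} * {ffun W -> bool}) := ffun_sum p.1 p.2.
rewrite (reindex h) //; exists (fun s : {ffun V + W -> bool} => ([ffun a => s (inl a)], [ffun b => s (inr b)])).
  by move=> [s t] _; congr pair; apply/ffunP => a; rewrite !ffunE.
by move=> s _; apply/ffunP => -[a|b]; rewrite !ffunE.
Qed.

Lemma sum_ffun_option (V : finType) (F : {ffun option V -> bool} -> C) :
  \sum_s F s = \sum_(b : bool) \sum_(s : {ffun V -> bool}) F (ffun_option b s).
Proof.
rewrite pair_bigA /=; pose h (p : bool * {ffun V -> bool}) := ffun_option p.1 p.2.
rewrite (reindex h) //; exists (fun s : {ffun option V -> bool} => (s None, [ffun a => s (Some a)])).
  by move=> [b s] _; congr pair; [rewrite ffunE | apply/ffunP => a; rewrite !ffunE].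
by move=> s _; apply/ffunP => -[a|]; rewrite !ffunE.
Qed.

Lemma sum_ffun_unit (F : {ffun unit -> bool} -> C) :
  \sum_s F s = \sum_(b : bool) F [ffun=> b].
Proof.
rewrite (reindex (fun b : bool => [ffun _ : unit => b])) //; exists (fun s : {ffun unit -> bool} => s tt).
  by move=> b _; rewrite ffunE.
by move=> s _; apply/ffunP => -[]; rewrite ffunE.
Qed.

Lemma sum_ffun_bool (F : {ffun bool -> bool} -> C) :
  \sum_s F s =
  \sum_(a : bool) \sum_(b : bool) F [ffun i : bool => if i then b else a].
Proof.
rewrite pair_bigA /=.
pose h (p : bool * bool) := [ffun i : bool => if i then p.2 else p.1].
rewrite (reindex h) //; exists (fun s : {ffun bool -> bool} => (s false, s true)).
  by move=> [a b] _; congr pair; rewrite ffunE.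
by move=> s _; apply/ffunP => -[]; rewrite !ffunE.
Qed.

Lemma prod_option (V : finType) (F : option V -> C) :
  \prod_v F v = F None * \prod_v F (Some v).
Proof.
rewrite (bigD1 None) //=; congr (_ * _).
rewrite (reindex_omap Some id) /=; last by case.
by apply: eq_bigl => v; rewrite eqxx.
Qed.

Lemma prod_unit (F : unit -> C) : \prod_v F v = F tt.
Proof. by rewrite (bigD1 tt) //= big1 ?mulr1 // => -[]. Qed.

Lemma sum_bool (F : bool -> C) : \sum_b F b = F false + F true.
Proof. by rewrite big_bool addrC. Qed.

Lemma sum_delta (I : finType) (i : I) (F : I -> C) :
  \sum_j (j == i)%:R * F j = F i.
Proof.
rewrite (bigD1 i) //= eqxx mul1r big1 ?addr0 // => j /negPf ->.
by rewrite mul0r.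
Qed.

End FiniteSums.

Section Kets.
Variable R : realType.
Local Notation C := (complex R).
Local Notation imag := (Complex 0 1 : C).

Definition hcoef : C := (Complex (Num.sqrt 2) 0)^-1.

Definition sgn (b : bool) : C := (-1) ^+ b.

Lemma hcoef2 : hcoef * hcoef = 2^-1.
Proof.
rewrite /hcoef complexr0 -invfM -rmorphM -expr2 /= sqr_sqrtr ?ler0n //.
by congr (_^-1); rewrite rmorph_nat.
Qed.

Lemma hcoef_neq0 : hcoef != 0.
Proof.
have : hcoef * hcoef != 0 by rewrite hcoef2 invr_neq0 // pnatr_eq0.
by rewrite mulf_eq0 => /norP[].
Qed.

Lemma hcoef2D : hcoef * hcoef + hcoef * hcoef = 1.
Proof. by rewrite hcoef2 -mulr2n -[LHS]mulr_natl mulfV // pnatr_eq0. Qed.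

Lemma mx2E (a b c d : C) i j : mx2 a b c d i j =
  if i == 0 then (if j == 0 then a else b) else (if j == 0 then c else d).
Proof. by rewrite mxE. Qed.

Lemma ord2 (P : 'I_2 -> Prop) : P 0 -> P 1 -> forall i, P i.
Proof.
move=> P0 P1 [[|[|//]] lti].
  by rewrite (_ : Ordinal lti = 0) //; apply: val_inj.
by rewrite (_ : Ordinal lti = 1) //; apply: val_inj.
Qed.

Lemma had_sqr : had R *m had R = 1%:M.
Proof.
rewrite /had -scalemxAl -scalemxAr scalerA hcoef2.
apply/matrixP; apply: ord2; apply: ord2;
  rewrite !mxE !big_ord_recl big_ord0 !mxE /= ?mulr1 ?mulrNN ?mul1r ?mulr1 ?addr0;
  rewrite ?subrr ?addrN ?mulr0 //.
all: by rewrite -[1 + 1](mulr2n 1) mulVf // pnatr_eq0.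
Qed.

Lemma had_sym : (had R)^T = had R.
Proof. by apply/matrixP; apply: ord2; apply: ord2; rewrite !mxE /=. Qed.

Definition leg (m : nat) (u v : 'cV[C]_2) : C := (u^T *m (had R ^+ m *m v)) 0 0.

Lemma legC m u v : leg m u v = leg m v u.
Proof.
have hadX_sym : (had R ^+ m)^T = had R ^+ m.
  elim: m => [|m IH]; first by rewrite trmx1.
  by rewrite exprS trmx_mul IH had_sym -exprS exprSr.
rewrite /leg -[in LHS](trmxK (u^T *m _)) mxE trmx_mul trmxK trmx_mul hadX_sym.
by rewrite -mulmxA.
Qed.

Lemma legS m u v : leg m.+1 u v = leg m u (had R *m v).
Proof. by rewrite /leg exprSr -mulmxA. Qed.

Lemma legSS m u v : leg m.+2 u v = leg m u v.
Proof. by rewrite !legS mulmxA had_sqr mul1mx. Qed.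

Lemma legDr m u v w : leg m u (v + w) = leg m u v + leg m u w.
Proof. by rewrite /leg !mulmxDr mxE. Qed.

Lemma legZr m u a v : leg m u (a *: v) = a * leg m u v.
Proof. by rewrite /leg -!scalemxAr mxE. Qed.

Lemma legDl m u v w : leg m (v + w) u = leg m v u + leg m w u.
Proof. by rewrite ![leg m _ u]legC legDr. Qed.

Lemma legZl m u a v : leg m (a *: v) u = a * leg m v u.
Proof. by rewrite ![leg m _ u]legC legZr. Qed.

Lemma had_ket c b : had R *m ket R c b = ket R (flip c) b.
Proof. by case: c => //=; rewrite mulmxA had_sqr mul1mx. Qed.

Lemma legS_ket m u c b : leg m.+1 u (ket R c b) = leg m u (ket R (flip c) b).
Proof. by rewrite legS had_ket. Qed.

Lemma flipK : involutive flip. Proof. by case. Qed.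

Lemma ket_flip c b :
  ket R (flip c) b = hcoef *: (ket R c false + sgn b *: ket R c true).
Proof.
(* The Hadamard matrix exchanges the two bases and carries the case of Z to that of X. *)
wlog -> : c / c = ColZ.
  case: c => [-> //|Z].
  rewrite -[LHS]mul1mx -had_sqr -mulmxA had_ket flipK (_ : ColX = flip ColZ) //.
  by rewrite (Z ColZ erefl) -scalemxAr mulmxDr -scalemxAr !had_ket.
apply/matrixP=> i j; rewrite ord1 !mxE /= big_ord_recl big_ord1 !mxE /=.
case: b; move: i; apply: ord2; rewrite /sgn /hcoef /=.
all: by rewrite ?expr1 ?expr0 ?(mulr1, mulr0, addr0, add0r, mul1r, mulN1r, mulrN).
Qed.

Lemma leg_ket c a b : leg 0 (ket R c a) (ket R c b) = (a == b)%:R.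
Proof.
have Z a' b' : leg 0 (ket R ColZ a') (ket R ColZ b') = (a' == b')%:R.
  rewrite /leg expr0 mul1mx mxE big_ord_recl big_ord1 !mxE /=.
  by case: a'; case: b'; rewrite /= ?(mulr1, mulr0, addr0, add0r).
case: c; first exact: Z.
have X : leg 0 (ket R ColX a) (ket R ColX b) = leg 2 (ket R ColZ a) (ket R ColZ b).
  by rewrite [RHS]legS_ket [RHS]legC [RHS]legS_ket [RHS]legC.
by rewrite X legSS Z eq_sym.
Qed.

Lemma leg_flip c a b :
  leg 0 (ket R c a) (ket R (flip c) b) = hcoef * sgn (a && b).
Proof.
rewrite ket_flip legZr legDr legZr !leg_ket /sgn; congr (_ * _).
by case: a; case: b; rewrite /= ?(mulr1, mulr0, addr0, add0r).
Qed.

Lemma leg_had c a b :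
  leg 1 (ket R c a) (ket R c b) = hcoef * sgn (a && b).
Proof. by rewrite legS_ket leg_flip. Qed.

Lemma leg_ket_flip m c b u : leg m (ket R (flip c) b) u =
  hcoef * (leg m (ket R c false) u + sgn b * leg m (ket R c true) u).
Proof. by rewrite ket_flip legZl legDl legZl. Qed.

Lemma ket_resolution c : \sum_b ket R c b *m (ket R c b)^T = 1%:M.
Proof.
have Z : \sum_b ket R ColZ b *m (ket R ColZ b)^T = 1%:M.
  rewrite big_bool; apply/matrixP; apply: ord2; apply: ord2;
    by rewrite !mxE !big_ord1 !mxE /= ?mulr0 ?mul0r ?mulr1 ?addr0 ?add0r.
case: c => //.
under eq_bigr do rewrite -(had_ket ColZ) trmx_mul had_sym mulmxA -[_ *m _ *m _^T]mulmxA.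
by rewrite -mulmx_suml -mulmx_sumr Z mulmx1 had_sqr.
Qed.

(** Inserting the resolution of the identity: a node of phase 0 with two legs is a plain wire. *)
Lemma sum_leg c m m' u v :
  \sum_b leg m u (ket R c b) * leg m' (ket R c b) v = leg (m + m') u v.
Proof.
rewrite /leg exprD.
have -> : had R ^+ m * had R ^+ m' *m v =
    \sum_b had R ^+ m *m ket R c b *m ((ket R c b)^T *m (had R ^+ m' *m v)).
  rewrite -[in LHS](mulr1 (had R ^+ m)) -[1](ket_resolution c) mulr_sumr -!mulmxE !mulmx_suml.
  by apply: eq_bigr => b _; rewrite !mulmxA.
rewrite mulmx_sumr summxE; apply: eq_bigr => b _.
by rewrite [in RHS]mulmxA [RHS]mxE big_ord1.
Qed.

Lemma sgnD a b : sgn (a (+) b) = sgn a * sgn b.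
Proof. exact: signr_addb. Qed.

Lemma sgn2 a : sgn a * sgn a = 1.
Proof. by rewrite -sgnD addbb. Qed.

Lemma sgn_neq0 a : sgn a != 0.
Proof. by rewrite signr_eq0. Qed.

Lemma expi0 : expi (0 : R) = 1.
Proof. by rewrite /expi cos0 sin0. Qed.

Lemma expiD (a b : R) : expi (a + b) = expi a * expi b.
Proof. by rewrite /expi cosD sinD; simpc; congr Complex; rewrite addrC mulrC. Qed.

Lemma expi_pi : expi (pi : R) = -1.
Proof. by rewrite /expi cospi sinpi; apply/eqP; rewrite eq_complex /= oppr0 !eqxx. Qed.

Lemma expi_neq0 (a : R) : expi a != 0.
Proof.
apply/eqP => e0; have := expiD a (- a).
by rewrite subrr expi0 e0 mul0r => /eqP; rewrite oner_eq0.
Qed.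

Lemma expiN (a : R) : expi (- a) = (expi a)^-1.
Proof.
by apply: (mulfI (expi_neq0 a)); rewrite -expiD subrr expi0 divff // expi_neq0.
Qed.

Lemma expi_nat (a : R) n : expi (n%:R * a) = expi a ^+ n.
Proof.
elim: n => [|n IH]; first by rewrite mul0r expi0.
by rewrite -natr1 mulrDl mul1r expiD IH exprSr.
Qed.

Lemma expi_int (z : int) : expi (z%:~R * (2 * pi) : R) = 1.
Proof.
have E n : expi (n%:R * (2 * pi) : R) = 1.
  by rewrite expi_nat expi_nat expi_pi sqrrN expr1n expr1n.
by case: z => n; rewrite ?NegzE ?mulrNz ?mulNr ?expiN -pmulrn E ?invr1.
Qed.

Lemma expi_pihalf : expi (pi / 2 : R) = imag.
Proof. by rewrite /expi cos_pihalf sin_pihalf. Qed.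

End Kets.

(** * Soundness of the rewrite rules *)

Section Amplitudes.
Variables (R : realType) (k n : nat).
Local Notation C := (complex R).

Section Amplitude.
Variables (V : Type) (col : V -> color) (s : V -> bool).
Variables (y : bits n) (x : bits k).

Definition point_vec (p : point V k n) : 'cV[C]_2 :=
  match p with
  | inl v => ket R (col v) (s v)
  | inr (inl i) => ket R ColZ (x i)
  | inr (inr j) => ket R ColZ (y j)
  end.

Definition amp (e : edge V k n) : C := leg e.1.2 (point_vec e.1.1) (point_vec e.2).

End Amplitude.

Definition phase_weight (V : Type) (ph : V -> R) (s : V -> bool) (v : V) : C :=
  if s v then expi (ph v) else 1.

Lemma interpE (D : zx R k n) y x : interp D y x =
  \sum_(s : {ffun node D -> bool})
     (\prod_v phase_weight (@node_phase _ _ _ D) s v) *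
     (\prod_(e <- edges D) amp (@node_color _ _ _ D) s y x e).
Proof. by []. Qed.

Lemma point_vec_mapn (V V' : Type) (f : V -> V') col col' s s' y x p :
  (forall v, col' (f v) = col v) -> (forall v, s' (f v) = s v) ->
  point_vec col' s' y x (mapn f p) = point_vec col s y x p.
Proof. by move=> hcol hs; case: p => [v|[i|j]] //=; rewrite hcol hs. Qed.

Lemma prod_amp_mape (V V' : Type) (f : V -> V') col col' s s' y x (E : seq (edge V k n)) :
  (forall v, col' (f v) = col v) -> (forall v, s' (f v) = s v) ->
  \prod_(e <- [seq mape f e | e <- E]) amp col' s' y x e =
  \prod_(e <- E) amp col s y x e.
Proof.
move=> hcol hs; rewrite big_map; apply: eq_bigr => e _.
by rewrite /amp /= !(point_vec_mapn _ _ _ hcol hs).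
Qed.

Definition leg_amp (V : Type) (col : V -> color) (s : V -> bool) y x
    (c : color) (t : bool) (z : nat * point V k n) : C :=
  leg z.1 (ket R c t) (point_vec col s y x z.2).

Lemma prod_amp_legs (V V' : Type) (r : nat) (v : 'I_r -> V') (f : V -> V')
    (b : 'I_r -> nat * point V k n) col col' s s' y x :
  (forall v, col' (f v) = col v) -> (forall v, s' (f v) = s v) ->
  \prod_(e <- legs v (lift_legs f b)) amp col' s' y x e =
  \prod_i leg_amp col s y x (col' (v i)) (s' (v i)) (b i).
Proof.
move=> hcol hs; rewrite big_map big_enum; apply: eq_bigr => i _.
by rewrite /amp /leg_amp /= (point_vec_mapn _ _ _ hcol hs).
Qed.

Lemma amp_mapn (V V' : Type) (f : V -> V') (w : V') m p col col' s s' y x :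
  (forall v, col' (f v) = col v) -> (forall v, s' (f v) = s v) ->
  amp col' s' y x (mapn f p, m, nd w) = leg_amp col s y x (col' w) (s' w) (m, p).
Proof. by move=> hcol hs; rewrite /amp /leg_amp /= legC (point_vec_mapn _ _ _ hcol hs). Qed.

Definition proportional (D1 D2 : zx R k n) : Prop :=
  exists2 c, c != 0 & forall y x, interp D1 y x = c * interp D2 y x.

Lemma proportional_refl D : proportional D D.
Proof. by exists 1; rewrite ?oner_neq0 // => y x; rewrite mul1r. Qed.

Lemma proportional_sym D1 D2 : proportional D1 D2 -> proportional D2 D1.
Proof.
move=> [c c0 h]; exists c^-1; first by rewrite invr_neq0.
by move=> y x; rewrite h mulKf.
Qed.

Lemma proportional_trans D1 D2 D3 :
  proportional D1 D2 -> proportional D2 D3 -> proportional D1 D3.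
Proof.
move=> [c c0 h] [d d0 h']; exists (c * d); first by rewrite mulf_neq0.
by move=> y x; rewrite h h' mulrA.
Qed.

Lemma proportional_eq D1 D2 :
  (forall y x, interp D1 y x = interp D2 y x) -> proportional D1 D2.
Proof. by move=> h; exists 1; rewrite ?oner_neq0 // => y x; rewrite mul1r. Qed.

Lemma iso_proportional (D D' : zx R k n) (f : node D -> node D') :
  bijective f ->
  (forall v, node_color (f v) = node_color v) ->
  (forall v, node_phase (f v) = node_phase v) ->
  perm_eq [seq mape f e | e <- edges D] (edges D') ->
  proportional D D'.
Proof.
move=> [g fK gK] hcol hph hE; apply: proportional_eq => y x; rewrite !interpE.
rewrite (reindex (fun s : {ffun node D' -> bool} => [ffun v => s (f v)])) /=; last first.
  exists (fun s : {ffun node D -> bool} => [ffun v => s (g v)]) => s _.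
    by apply/ffunP => v; rewrite !ffunE gK.
  by apply/ffunP => v; rewrite !ffunE fK.
apply: eq_bigr => s _; congr (_ * _).
  rewrite [RHS](reindex f) /=; last by exists g => v _; [apply: fK | apply: gK].
  by apply: eq_bigr => v _; rewrite /phase_weight ffunE hph.
rewrite -(perm_big _ hE) /=; apply/esym/prod_amp_mape => // v.
by rewrite ffunE.
Qed.

Lemma turn_proportional (V : finType) col ph (p q : point V k n) m E :
  proportional (@Zx R k n V col ph ((p, m, q) :: E)) (@Zx R k n V col ph ((q, m, p) :: E)).
Proof.
apply: proportional_eq => y x; rewrite !interpE; apply: eq_bigr => s _.
by rewrite !big_cons /amp /= legC.
Qed.

Lemma period_proportional (V : finType) col (ph ph' : V -> R) E :
  (forall v, exists z : int, ph' v = ph v + z%:~R * (2 * pi)) ->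
  proportional (@Zx R k n V col ph E) (@Zx R k n V col ph' E).
Proof.
move=> h; apply: proportional_eq => y x; rewrite !interpE; apply: eq_bigr => s _.
congr (_ * _); apply: eq_bigr => v _; rewrite /phase_weight /=.
by case: (h v) => z ->; rewrite expiD expi_int mulr1.
Qed.

Lemma had_cancel_proportional (V : finType) col ph (p q : point V k n) m E :
  proportional (@Zx R k n V col ph ((p, m.+2, q) :: E)) (@Zx R k n V col ph ((p, m, q) :: E)).
Proof.
apply: proportional_eq => y x; rewrite !interpE; apply: eq_bigr => s _.
by rewrite !big_cons /amp /= legSS.
Qed.

Lemma hopf_proportional (V : finType) col ph (u v : V) E :
  col v = flip (col u) ->
  proportional (@Zx R k n V col ph ((nd u, 0%N, nd v) :: (nd u, 0%N, nd v) :: E))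
    (@Zx R k n V col ph E).
Proof.
(* Both edges contribute [hcoef] and the same sign, together hcoef^2 = 1/2. *)
move=> huv; exists 2^-1; first by rewrite invr_neq0 // pnatr_eq0.
move=> y x; rewrite !interpE big_distrr; apply: eq_bigr => s _.
rewrite !big_cons /amp /= huv leg_flip !mulrA; congr (_ * _).
rewrite -!mulrA [RHS]mulrC; congr (_ * _).
by rewrite (mulrCA (sgn _ _)) sgn2 mulr1 hcoef2.
Qed.

Lemma identity_proportional (V : finType) (col : option V -> color) (ph : option V -> R)
    (p q : point V k n) (m m' : nat) (E : seq (edge V k n)) :
  ph None = 0 ->
  proportional (@Zx R k n (option V) col ph
            ((mapn Some p, m, nd None) :: (nd None, m', mapn Some q) ::
             [seq mape Some e | e <- E]))
         (@Zx R k n V (fun v => col (Some v)) (fun v => ph (Some v))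
            ((p, (m + m')%N, q) :: E)).
Proof.
move=> ph0; apply: proportional_eq => y x; rewrite !interpE sum_ffun_option exchange_big /=.
apply: eq_bigr => s _.
have hE b : \prod_(e <- [seq mape Some e | e <- E]) amp col (ffun_option b s) y x e =
    \prod_(e <- E) amp (fun v => col (Some v)) s y x e.
  by apply: prod_amp_mape => // v; rewrite ffunE.
have hp b z : point_vec col (ffun_option b s) y x (mapn Some z) =
    point_vec (fun v => col (Some v)) s y x z.
  by apply: point_vec_mapn => // v; rewrite ffunE.
have hph b : \prod_v phase_weight ph (ffun_option b s) v =
    \prod_v phase_weight (fun v => ph (Some v)) s v.
  rewrite prod_option [X in X * _]/phase_weight ph0 expi0 if_same mul1r.
  by apply: eq_bigr => v _; rewrite /phase_weight ffunE.
rewrite big_cons /amp /= -(sum_leg (col None)) mulr_suml big_distrr /=.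
apply: eq_bigr => b _; rewrite hph !big_cons hE /amp /= !hp ffunE.
by rewrite !mulrA.
Qed.

Lemma scalar_proportional (D : zx R k n) (D0 : zx R 0 0) :
  Defs.scalar D0 <> 0 -> proportional (add_scalar D D0) D.
Proof.
move=> /eqP D0_neq0; exists (Defs.scalar D0) => // y x.
rewrite /Defs.scalar !interpE mulrC sum_ffun_sum big_distrlr /=.
apply: eq_bigr => s _; apply: eq_bigr => t _.
rewrite big_sumType big_cat /= mulrACA; congr (_ * _ * (_ * _)).
- by apply: eq_bigr => v _; rewrite /phase_weight ffunE.
- by apply: prod_amp_mape => // v; rewrite ffunE.
- by apply: eq_bigr => v _; rewrite /phase_weight ffunE.
have hp (z : point (node D0) 0 0) :
    point_vec (fun v => match v with inl u => node_color u | inr u => node_color u end)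
      (ffun_sum s t) y x (map_point inr (widen_ord (leq0n k)) (widen_ord (leq0n n)) z) =
    end_vec t void_bits void_bits z.
  by case: z => [v|[[]|[]]] //=; rewrite ffunE.
by rewrite big_map; apply: eq_bigr => e _; rewrite /amp /= !hp.
Qed.

Lemma merge_proportional (V : finType) (col : option V -> color) (ph : option V -> R)
    (u : V) (m : nat) (E : seq (edge (option V) k n)) :
  col None = col (Some u) ->
  proportional (@Zx R k n (option V) col ph (nseq m.+1 (nd None, 0%N, nd (Some u)) ++ E))
    (@Zx R k n V (fun v => col (Some v))
       (fun v => if v == u then ph (Some u) + ph None else ph (Some v))
       [seq mape (odflt u) e | e <- E]).
Proof.
move=> hcol; apply: proportional_eq => y x; rewrite !interpE sum_ffun_option exchange_big /=.
apply: eq_bigr => s _.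
pose F b := (\prod_v phase_weight ph (ffun_option b s) v) *
            \prod_(e <- E) amp col (ffun_option b s) y x e.
(* A plain wire between nodes of one color is a Kronecker delta, and so is its power m+1; only the
   term where both nodes carry the same bit survives. *)
rewrite (eq_bigr (fun b => (b == s u)%:R * F b)) => [|b _]; last first.
  rewrite -cat_cons big_cat /= mulrCA; congr (_ * _).
  rewrite -[X in \big[_/_]_(i <- X) _]/(nseq m.+1 _) big_nseq iter_mulr_1.
  by rewrite /amp /= hcol leg_ket !ffunE; case: (b == s u); rewrite ?expr1n ?expr0n.
rewrite sum_delta /F; congr (_ * _).
  rewrite prod_option (bigD1 u) //= [RHS](bigD1 u) //= mulrA; congr (_ * _).
    by rewrite /phase_weight !ffunE eqxx; case: (s u); rewrite ?mulr1 // expiD mulrC.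
  by apply: eq_bigr => v /negPf vu; rewrite /phase_weight ffunE vu.
apply/esym; rewrite big_map; apply: eq_bigr => e _.
have hp z : point_vec (fun v => col (Some v)) s y x (mapn (odflt u) z) =
    point_vec col (ffun_option (s u) s) y x z.
  by case: z => [[v|]|[i|j]] //=; rewrite ffunE // hcol.
by rewrite /amp !hp.
Qed.

Lemma color_change_proportional (V : finType) (col : V -> color) ph (u : V) E :
  proportional (@Zx R k n V col ph E)
    (@Zx R k n V (fun v => if v == u then flip (col v) else col v) ph
       [seq add_had (nd u) e | e <- E]).
Proof.
apply: proportional_eq => y x; rewrite !interpE; apply: eq_bigr => s _; congr (_ * _).
rewrite big_map; apply: eq_bigr => e _; rewrite /amp /=.
have hp (z : point V k n) :
    point_vec (fun v => if v == u then flip (col v) else col v) s y x z =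
    had R ^+ (z == nd u) *m point_vec col s y x z.
  case: z => [v|[i|j]] /=; rewrite ?mul1mx //.
  rewrite (_ : (_ == nd u) = (v == u)) //; case: eqP => // _; first by rewrite expr1 had_ket.
  by rewrite mul1mx.
rewrite !hp; case: (e.2 == nd u); case: (e.1.1 == nd u);
  rewrite ?expr1 ?mul1mx ?addn0 ?addn1 ?legS ?mulmxA ?had_sqr ?mul1mx //.
all: by rewrite -legS [RHS]legC legS mulmxA had_sqr mul1mx legC.
Qed.

Section Copy.
Variables (V : finType) (c : color) (r : nat) (b : 'I_r -> nat * point V k n).
Variables (col : V -> color) (s : V -> bool) (y : bits n) (x : bits k).
Local Notation la := (leg_amp col s y x).

Lemma leg_amp_flip t z :
  la (flip c) t z = hcoef R * (la c false z + sgn R t * la c true z).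
Proof. exact: leg_ket_flip. Qed.

(** A node of phase pi and the other color acts on a wire as a NOT gate in the basis of color
    [c]. *)
Lemma leg_amp_pi t z :
  \sum_(t' : bool) sgn R t' * leg 0 (ket R c t) (ket R (flip c) t') * la (flip c) t' z =
  la c (~~ t) z.
Proof.
rewrite sum_bool !leg_flip !leg_amp_flip; set a0 := la c false z; set a1 := la c true z.
rewrite -[RHS]mul1r -(hcoef2D R); case: t => /=; rewrite -/a0 -/a1 /sgn !expr0 !expr1; ring.
Qed.

(** The state of phase 0 or pi of one color is, up to the factor sqrt 2, a basis vector of the other
    color. *)
Lemma leg_amp_state t z :
  \sum_(t' : bool) sgn R (t && t') * la (flip c) t' z =
  (hcoef R + hcoef R) * la c t z.
Proof.
rewrite sum_bool !leg_amp_flip; set a0 := la c false z; set a1 := la c true z.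
case: t => /=; rewrite -/a0 -/a1 /sgn !expr0 ?expr1; ring.
Qed.

End Copy.

Lemma hcoefD_neq0 : hcoef R + hcoef R != 0.
Proof. by rewrite -mulr2n mulrn_eq0 hcoef_neq0. Qed.

Lemma pi_copy_proportional (V : finType) (col : option V -> color) (ph : option V -> R)
    (m : nat) (p : point V k n) (r : nat) (b : 'I_r -> nat * point V k n)
    (E : seq (edge V k n)) :
  proportional (@Zx R k n (option V + unit)%type
            (fun v => match v with inl x => col x | inr _ => flip (col None) end)
            (fun v => match v with inl x => ph x | inr _ => pi end)
            ((mapn (inl \o Some) p, m, nd (inr tt)) ::
             (nd (inr tt), 0%N, nd (inl None)) ::
             legs (fun=> inl None) (lift_legs (inl \o Some) b) ++
             [seq mape (inl \o Some) e | e <- E]))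
         (@Zx R k n (option V + 'I_r)%type
            (fun v => match v with inl x => col x | inr _ => flip (col None) end)
            (fun v => match v with
                      | inl None => - ph None
                      | inl (Some x) => ph (Some x)
                      | inr _ => pi
                      end)
            ((mapn (inl \o Some) p, m, nd (inl None)) ::
             [seq (nd (inl None), 0%N, nd (inr i)) | i : 'I_r] ++
             legs inr (lift_legs (inl \o Some) b) ++
             [seq mape (inl \o Some) e | e <- E])).
Proof.
set DL := Zx _ _ _; set DR := Zx _ _ _.
set c := col None; set a := ph None; pose cl v := col (Some v).
(* The scalar arises when the bit of the central node is negated: e^(ia(1-t)) = e^(ia) e^(-iat). *)
exists (expi a); first exact: expi_neq0.
move=> y x.
pose W s := (\prod_v phase_weight (fun v => ph (Some v)) s v) * \prod_(e <- E) amp cl s y x e.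
have phase_pi (u : bool) : (if u then expi pi else 1 : C) = sgn R u.
  by case: u; rewrite ?expi_pi.
have -> : interp DL y x = \sum_(t : bool) \sum_(s : {ffun V -> bool})
    W s * ((if t then expi a else 1) * leg_amp cl s y x c (~~ t) (m, p) * \prod_i leg_amp cl s y x c t (b i)).
  rewrite interpE sum_ffun_sum sum_ffun_option; apply: eq_bigr => t _; apply: eq_bigr => s _.
  rewrite sum_ffun_unit -leg_amp_pi mulr_sumr mulr_suml mulr_sumr; apply: eq_bigr => u _.
  have hs v : ffun_sum (ffun_option t s) [ffun _ : unit => u] ((inl \o Some) v) = s v by rewrite ffunE /= ffunE.
  rewrite big_sumType prod_unit prod_option !big_cons big_cat.
  rewrite (prod_amp_legs (col := cl) _ _ _ _ _ hs) // (prod_amp_mape (col := cl) _ _ _ _ hs) //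
    (amp_mapn (col := cl) _ _ _ _ _ _ hs) //.
  rewrite /phase_weight /amp /= !ffunE phase_pi legC /W /phase_weight.
  under eq_bigr => v _ do rewrite !ffunE.
  rewrite -/c -/a.
  set X1 := \prod_v _; set X2 := \prod_i _; set X3 := \prod_(e <- _) _.
  ring.
have -> : interp DR y x = \sum_(t : bool) \sum_(s : {ffun V -> bool})
    W s * ((if t then expi (- a) else 1) * leg_amp cl s y x c t (m, p) * \prod_i leg_amp cl s y x c (~~ t) (b i)).
  rewrite interpE sum_ffun_sum sum_ffun_option; apply: eq_bigr => t _; apply: eq_bigr => s _.
  under eq_bigr do rewrite -leg_amp_pi; rewrite bigA_distr_bigA /= !mulr_sumr; apply: eq_bigr => u _.
  have hs v : ffun_sum (ffun_option t s) u ((inl \o Some) v) = s v by rewrite ffunE /= ffunE.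
  rewrite big_sumType prod_option !big_cons !big_cat.
  rewrite (prod_amp_legs (col := cl) _ _ _ _ _ hs) // (prod_amp_mape (col := cl) _ _ _ _ hs) //
    (amp_mapn (col := cl) _ _ _ _ _ _ hs) //.
  rewrite /phase_weight /amp /= !ffunE /W /phase_weight big_map big_enum /= !big_split /=.
  under eq_bigr => v _ do rewrite !ffunE.
  have hu i : ffun_sum (ffun_option t s) u (inr i) = u i by rewrite ffunE.
  rewrite -/a -/c.
  rewrite [X in _ * X * _](eq_bigr (fun i => sgn R (u i))) => [|i _]; last by rewrite hu phase_pi.
  rewrite [X in _ * (_ * (X * _))](eq_bigr (fun i => leg 0 (ket R c t) (ket R (flip c) (u i))))
    => [|i _]; last by rewrite hu ffunE /= ffunE.
  rewrite [X in _ * (_ * (_ * (X * _)))](eq_bigr (fun i => leg_amp cl s y x (flip c) (u i) (b i)))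
    => [|i _]; last by rewrite hu.
  rewrite -[X in _ * (_ * (_ * (_ * X)))]/(\prod_(e <- E) amp cl s y x e).
  set X1 := \prod_v _; set X3 := \prod_(e <- E) _.
  set X2 := \prod_i sgn _ _; set X4 := \prod_i leg _ _ _; set X5 := \prod_i leg_amp _ _ _ _ _ _ _.
  ring.
(* On the left the negation sits on the leg (m, p), on the right on all the other legs; so the terms
   for the two values of t match crosswise. *)
rewrite !sum_bool /= mulrDr addrC !big_distrr /=.
congr (_ + _); apply: eq_bigr => s _; set X := \prod_i _; first by ring.
by rewrite expiN; field; apply: expi_neq0.
Qed.

Lemma state_copy_proportional (V : finType) (col : option V -> color) (ph : option V -> R)
    (a : bool) (r : nat) (b : 'I_r -> nat * point V k n) (E : seq (edge V k n)) :
  proportional (@Zx R k n (option V + unit)%type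
            (fun v => match v with inl x => col x | inr _ => flip (col None) end)
            (fun v => match v with inl x => ph x | inr _ => a%:R * pi end)
            ((nd (inr tt), 0%N, nd (inl None)) ::
             legs (fun=> inl None) (lift_legs (inl \o Some) b) ++
             [seq mape (inl \o Some) e | e <- E]))
         (@Zx R k n (V + 'I_r)%type
            (fun v => match v with
                      | inl x => col (Some x)
                      | inr _ => flip (col None)
                      end)
            (fun v => match v with inl x => ph (Some x) | inr _ => a%:R * pi end)
            (legs inr (lift_legs inl b) ++ [seq mape inl e | e <- E])).
Proof.
set DL := Zx _ _ _; set DR := Zx _ _ _.
set c := col None; pose cl v := col (Some v).
set h := hcoef R + hcoef R; have h0 : h != 0 by exact: hcoefD_neq0.
pose al : C := if a then expi (ph None) else 1.
have al0 : al != 0 by rewrite /al; case: (a); rewrite ?expi_neq0 ?oner_neq0.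
(* On the left the state forces the bit [a] on the node, which leaves its phase factor [al] and one
   factor h = sqrt 2; on the right each of the r copies gives a factor h. *)
exists (h * al / h ^+ r); first by rewrite !mulf_neq0 // invr_neq0 // expf_neq0.
move=> y x.
pose W s := (\prod_v phase_weight (fun v => ph (Some v)) s v) * \prod_(e <- E) amp cl s y x e.
have phase_pi (u : bool) : (if u then expi (a%:R * pi) else 1 : C) = sgn R (a && u).
  by case: (a); case: u; rewrite /= ?mul1r ?mul0r ?expi0 ?expi_pi.
have -> : interp DL y x = h * al * \sum_(s : {ffun V -> bool}) W s * \prod_i leg_amp cl s y x c a (b i).
  rewrite interpE sum_ffun_sum sum_ffun_option exchange_big /= big_distrr /=; apply: eq_bigr => s _.
  pose F t := h * (if t then expi (ph None) else 1) * (W s * \prod_i leg_amp cl s y x c t (b i)).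
  rewrite -/(F a) -(sum_delta a F); apply: eq_bigr => t _.
  have -> : (t == a)%:R * F t = \sum_(u : bool) W s * ((if t then expi (ph None) else 1) *
      (sgn R (a && u) * leg 0 (ket R c t) (ket R (flip c) u)) * \prod_i leg_amp cl s y x c t (b i)).
    have -> : (t == a)%:R * F t = W s * ((if t then expi (ph None) else 1) *
        (h * (t == a)%:R) * \prod_i leg_amp cl s y x c t (b i)) by rewrite /F; ring.
    have -> : h * (t == a)%:R = \sum_u sgn R (a && u) * leg 0 (ket R c t) (ket R (flip c) u).
      rewrite sum_bool !leg_flip /h; case: (a); case: t => /=; rewrite /sgn ?expr0 ?expr1; ring.
    by rewrite mulr_sumr mulr_suml mulr_sumr.
  rewrite sum_ffun_unit; apply: eq_bigr => u _.
  have hs v : ffun_sum (ffun_option t s) [ffun _ : unit => u] ((inl \o Some) v) = s v by rewrite ffunE /= ffunE.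
  rewrite big_sumType prod_unit prod_option !big_cons big_cat.
  rewrite (prod_amp_legs (col := cl) _ _ _ _ _ hs) // (prod_amp_mape (col := cl) _ _ _ _ hs) //.
  rewrite /phase_weight /amp /= !ffunE phase_pi legC /W /phase_weight.
  under eq_bigr => v _ do rewrite !ffunE.
  rewrite -/c.
  set X1 := \prod_v _; set X2 := \prod_i _; set X3 := \prod_(e <- _) _.
  ring.
have -> : interp DR y x =
    h ^+ r * \sum_(s : {ffun V -> bool}) W s * \prod_i leg_amp cl s y x c a (b i).
  rewrite interpE sum_ffun_sum big_distrr /=; apply: eq_bigr => s _.
  rewrite mulrCA -[X in h ^+ X](card_ord r) -prodr_const -big_split /=.
  under [in RHS]eq_bigr do rewrite -leg_amp_state.
  rewrite bigA_distr_bigA /= !mulr_sumr; apply: eq_bigr => u _.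
  have hs v : ffun_sum s u (inl v) = s v by rewrite ffunE.
  rewrite big_sumType big_cat /=.
  rewrite (prod_amp_legs (col := cl) _ _ _ _ _ hs) // (prod_amp_mape (col := cl) _ _ _ _ hs) //.
  rewrite /phase_weight /W /phase_weight big_split /=.
  under eq_bigr => v _ do rewrite !ffunE.
  have hu i : ffun_sum s u (inr i) = u i by rewrite ffunE.
  rewrite [X in _ * X * _](eq_bigr (fun i => sgn R (a && u i))) => [|i _]; last by rewrite hu phase_pi.
  rewrite [X in _ * (X * _)](eq_bigr (fun i => leg_amp cl s y x (flip c) (u i) (b i)))
    => [|i _]; last by rewrite hu.
  rewrite -/c.
  set X1 := \prod_v _; set X3 := \prod_(e <- E) _.
  set X2 := \prod_i sgn _ _; set X5 := \prod_i leg_amp _ _ _ _ _ _ _.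
  ring.
rewrite mulrA divfK // expf_neq0 //.
Qed.

Lemma prod_sgn_and (I : finType) (t : bool) (u : I -> bool) :
  \prod_j sgn R (t && u j) = sgn R (t && \big[addb/false]_j u j).
Proof.
have -> : t && \big[addb/false]_j u j = \big[addb/false]_j (t && u j).
  by case: t => //=; rewrite big1_eq.
by elim/big_ind2: _ => // a b c d -> ->; rewrite sgnD.
Qed.

Lemma bialgebra_proportional (V : finType) (col : V -> color) (ph : V -> R) (c : color)
    (r q : nat) (a : 'I_r -> nat * point V k n) (b : 'I_q -> nat * point V k n)
    (E : seq (edge V k n)) :
  proportional (@Zx R k n (V + bool)%type
            (fun v => match v with
                      | inl x => col x
                      | inr false => c
                      | inr true => flip c
                      end)
            (fun v => match v with inl x => ph x | inr _ => 0 end)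
            ((nd (inr false), 0%N, nd (inr true)) ::
             legs (fun=> inr false) (lift_legs inl a) ++
             legs (fun=> inr true) (lift_legs inl b) ++
             [seq mape inl e | e <- E]))
         (@Zx R k n (V + ('I_r + 'I_q))%type
            (fun v => match v with
                      | inl x => col x
                      | inr (inl _) => flip c
                      | inr (inr _) => c
                      end)
            (fun v => match v with inl x => ph x | inr _ => 0 end)
            ([seq (nd (inr (inl i)), 0%N, nd (inr (inr j)))
                | i <- enum 'I_r, j <- enum 'I_q] ++
             legs (fun i => inr (inl i)) (lift_legs inl a) ++
             legs (fun j => inr (inr j)) (lift_legs inl b) ++
             [seq mape inl e | e <- E])).
Proof.
set DL := Zx _ _ _; set DR := Zx _ _ _.
set h := hcoef R; have h0 : h != 0 by exact: hcoef_neq0.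
have H0 : h + h != 0 by exact: hcoefD_neq0.
(* On the left there is one h for each of the q legs re-expanded in the basis of color c, and h + h
   from the joining edge and the sum over its end; on the right each of the r nodes has q edges with
   a factor h and a sum that yields h + h. *)
exists ((h + h) * h ^+ q / (h ^+ q * (h + h)) ^+ r).
  by rewrite !mulf_neq0 ?invr_neq0 ?expf_neq0 // mulf_neq0 // expf_neq0.
move=> y x.
pose W s := (\prod_v phase_weight ph s v) * \prod_(e <- E) amp col s y x e.
(* Read in the basis of color c, both diagrams compute the parity of the bits on the legs [b] and
   copy it to the legs [a]. *)
pose par (u : {ffun 'I_q -> bool}) := \big[addb/false]_j u j.
pose B s := \sum_(u : {ffun 'I_q -> bool})
  (\prod_i leg_amp col s y x c (par u) (a i)) * \prod_j leg_amp col s y x c (u j) (b j).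
have phase0 (u : bool) : (if u then expi 0 else 1 : C) = 1 by rewrite expi0 if_same.
have -> : interp DL y x = (h + h) * h ^+ q * \sum_(s : {ffun V -> bool}) W s * B s.
  rewrite interpE sum_ffun_sum big_distrr /=; apply: eq_bigr => s _.
  rewrite sum_ffun_bool mulrCA.
  have -> : (h + h) * h ^+ q * B s = \sum_(t : bool) \sum_(t' : bool)
      h * sgn R (t && t') * (\prod_i leg_amp col s y x c t (a i)) *
      \prod_j leg_amp col s y x (flip c) t' (b j).
    have flipE t' : \prod_j leg_amp col s y x (flip c) t' (b j) =
        h ^+ q * \sum_(u : {ffun 'I_q -> bool})
          sgn R (t' && par u) * \prod_j leg_amp col s y x c (u j) (b j).
      under [in RHS]eq_bigr => u _ do rewrite -prod_sgn_and -big_split.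
      rewrite -(bigA_distr_bigA (fun j u => sgn R (t' && u) * leg_amp col s y x c u (b j))).
      rewrite -[X in h ^+ X](card_ord q) -prodr_const -big_split; apply: eq_bigr => j _.
      by rewrite leg_amp_flip sum_bool /= andbF andbT /sgn expr0 mul1r.
    transitivity (\sum_(t : bool) \sum_(t' : bool) \sum_(u : {ffun 'I_q -> bool})
        h * sgn R (t && t') * (h ^+ q * sgn R (t' && par u)) *
        ((\prod_i leg_amp col s y x c t (a i)) * \prod_j leg_amp col s y x c (u j) (b j)));
      last first.
      apply: eq_bigr => t _; apply: eq_bigr => t' _; rewrite flipE !mulr_sumr.
      apply: eq_bigr => u _; set X1 := \prod_i _; set X2 := \prod_j _; ring.
    under [in RHS]eq_bigr => t _ do rewrite exchange_big.
    rewrite exchange_big /B mulr_sumr; apply: eq_bigr => u _.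
    pose F t := (h + h) * h ^+ q * ((\prod_i leg_amp col s y x c t (a i)) *
      \prod_j leg_amp col s y x c (u j) (b j)).
    rewrite -[LHS]/(F (par u)) -(sum_delta (par u) F); apply: eq_bigr => t _.
    rewrite sum_bool /= /F; set X1 := \prod_i _; set X2 := \prod_j _.
    by case: (t); case: (par u) => /=; rewrite /sgn ?expr0 ?expr1; ring.
  rewrite mulr_sumr; apply: eq_bigr => t _; rewrite mulr_sumr; apply: eq_bigr => t' _.
  set f := [ffun i : bool => _].
  have hs v : ffun_sum s f (inl v) = s v by rewrite ffunE.
  rewrite big_sumType big_cons !big_cat /=.
  rewrite !(prod_amp_legs (col := col) _ _ _ _ _ hs) // (prod_amp_mape (col := col) _ _ _ _ hs) //.
  rewrite [X in _ * X * _]big1 => [|v _]; last by rewrite /phase_weight phase0.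
  rewrite /phase_weight /amp /= !ffunE /W /phase_weight leg_flip.
  under eq_bigr => v _ do rewrite !ffunE.
  rewrite -/h.
  set X1 := \prod_v _; set X2 := \prod_i _; set X3 := \prod_j _; set X4 := \prod_(e <- _) _.
  ring.
have -> : interp DR y x = (h ^+ q * (h + h)) ^+ r * \sum_(s : {ffun V -> bool}) W s * B s.
  rewrite interpE sum_ffun_sum big_distrr /=; apply: eq_bigr => s _.
  rewrite mulrCA /B mulr_sumr mulr_sumr sum_ffun_sum exchange_big; apply: eq_bigr => u _.
  rewrite [X in _ = _ * X]mulrA -[X in (_ * _) ^+ X](card_ord r) -prodr_const -big_split /=.
  have -> : \prod_i (h ^+ q * (h + h) * leg_amp col s y x c (par u) (a i)) =
      \sum_(t : {ffun 'I_r -> bool}) (\prod_i \prod_j (h * sgn R (t i && u j))) *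
        \prod_i leg_amp col s y x (flip c) (t i) (a i).
    under eq_bigr do rewrite -mulrA -leg_amp_state mulr_sumr.
    rewrite bigA_distr_bigA /=; apply: eq_bigr => t _.
    rewrite -big_split; apply: eq_bigr => i _ /=.
    rewrite mulrA big_split prod_sgn_and prodr_const card_ord andbC //.
  rewrite mulr_suml mulr_sumr; apply: eq_bigr => t _.
  have hs v : ffun_sum s (ffun_sum t u) (inl v) = s v by rewrite ffunE.
  rewrite big_sumType !big_cat big_allpairs_dep /=.
  rewrite !(prod_amp_legs (col := col) _ _ _ _ _ hs) // (prod_amp_mape (col := col) _ _ _ _ hs) //.
  rewrite [X in _ * X * _]big1 => [|v _]; last by rewrite /phase_weight phase0.
  rewrite [X in _ * (X * _)](_ : _ = \prod_i \prod_j (h * sgn R (t i && u j))); last first.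
    rewrite big_enum; apply: eq_bigr => i _; rewrite big_enum; apply: eq_bigr => j _.
    by rewrite /amp /= legC leg_flip !ffunE /= ?ffunE andbC.
  rewrite [X in _ * (_ * (X * _))](eq_bigr (fun i => leg_amp col s y x (flip c) (t i) (a i)))
    => [|i _]; last by rewrite ffunE /= ffunE.
  rewrite [X in _ * (_ * (_ * (X * _)))](eq_bigr (fun i => leg_amp col s y x c (u i) (b i)))
    => [|i _]; last by rewrite ffunE /= ffunE.
  rewrite /phase_weight /W /phase_weight.
  under eq_bigr => v _ do rewrite !ffunE.
  set X1 := \prod_v _; set X2 := \prod_i leg_amp _ _ _ _ _ _ _; set X3 := \prod_j leg_amp _ _ _ _ _ _ _.
  set X4 := \prod_(e <- _) _; ring.
by rewrite mulrA divfK // expf_neq0 // mulf_neq0 // expf_neq0.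
Qed.

Lemma step_proportional (D1 D2 : zx R k n) : step D1 D2 -> proportional D1 D2.
Proof.
case; intros; first by eapply iso_proportional; eassumption.
all: first [exact: turn_proportional | exact: period_proportional
  | exact: scalar_proportional | exact: merge_proportional | exact: identity_proportional
  | exact: had_cancel_proportional | exact: color_change_proportional
  | exact: pi_copy_proportional | exact: state_copy_proportional
  | exact: bialgebra_proportional | exact: hopf_proportional].
Qed.

Lemma rewrites_proportional (D1 D2 : zx R k n) : rewrites D1 D2 -> proportional D1 D2.
Proof.
elim=> {D1 D2} [D|D1 D2 D3 /step_proportional h _|D1 D2 D3 /step_proportional h _].
- exact: proportional_refl.
- exact: proportional_trans.
- exact/proportional_trans/proportional_sym.
Qed.

End Amplitudes.

(** * Amplitudes of KLS diagrams *)

Local Arguments ket : simpl never.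

Section Base.
Variables (R : realType) (k n : nat).
Local Notation C := (complex R).
Local Notation imag := (Complex 0 1 : C).
Local Notation sgn := (sgn R).
Local Notation h := (hcoef R).

(** The part of [kls] that mentions neither pivots nor row reduction. It passes to restrictions and
    to gluings that respect the order of the outputs. *)
Record base (D : er_diagram k n) : Prop := Base {
  base_sym : forall j j', er_oo D (j, j') = er_oo D (j', j);
  base_irr : forall j, er_oo D (j, j) = None;
  base_in_color : forall i, er_in_color D i = ColZ;
  base_out_color : forall j, er_out_color D j = ColZ;
  base_io : forall ij, er_io D ij <> Some false;
  base_oo : forall jj, er_oo D jj <> Some false;
  base_had_oo : forall j, has_H (er_gates D j) ->
    forall j' : 'I_n, (j' < j)%N -> er_oo D (j', j) = None;
  base_had_io : forall j, has_H (er_gates D j) -> forall i, er_io D (i, j) = None;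
  base_in_phase : forall i, er_in_phase D i = 0;
  base_locals : forall j, kls_local (er_out_phase D j) (er_gates D j)
}.

Lemma kls_base D : kls D -> base D.
Proof.
case=> [[hsym hirr] [hic hoc] [hio hoo] hH _ hin _ _ hloc]; split=> //.
  by move=> j /hH[].
by move=> j /hH[].
Qed.

Section Diagram.
Variable D : er_diagram k n.

Definition io (i : 'I_k) (j : 'I_n) : bool := isSome (er_io D (i, j)).
Definition oo (j j' : 'I_n) : bool := isSome (er_oo D (j, j')).
Definition hd (j : 'I_n) : bool := has_H (er_gates D j).
Definition q (j : 'I_n) : 'Z_4 := er_out_phase D j.

(** An intermediate stage of the fold in [er_zx], with the Hadamard gates already placed on the
    outputs in [w]. Unlike those of [er_zx], its nodes are by definition the inputs and the
    outputs. *)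
Definition core_with (w : pred 'I_n) : zx R k n :=
  @Zx R k n ('I_k + 'I_n)%type
    (fun v => match v with
              | inl i => er_in_color D i
              | inr j => er_out_color D j
              end)
    (fun v => quarter_turns R match v with
                            | inl i => er_in_phase D i
                            | inr j => er_out_phase D j
                            end)
    ([seq (inp i, 0%N, nd (inl i)) | i : 'I_k] ++
     [seq (nd (inr j), nat_of_bool (w j), out j) | j : 'I_n] ++
     pmap (fun ij : 'I_k * 'I_n => omap (fun h : bool => (nd (inl ij.1), h : nat, nd (inr ij.2)))
                          (er_io D ij))
          (enum {: 'I_k * 'I_n}) ++
     pmap (fun jj : 'I_n * 'I_n => omap (fun h : bool => (nd (inr jj.1), h : nat, nd (inr jj.2)))
                          (er_oo D jj))
          [seq jj : 'I_n * 'I_n <- enum {: 'I_n * 'I_n} | (jj.1 < jj.2)%N]).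

Lemma eq_core_with w w' : w =1 w' -> core_with w = core_with w'.
Proof. by move=> e; congr Zx; congr (_ ++ (_ ++ _)); apply: eq_map => j; rewrite e. Qed.

Lemma gate_core_with w j : ~~ w j ->
  gate_on_output j GateH (core_with w) = core_with (fun j' => (j' == j) || w j').
Proof.
move=> wj; congr Zx; rewrite !map_cat; congr (_ ++ (_ ++ (_ ++ _))).
- by rewrite -map_comp; apply: eq_map => i /=; rewrite /add_had /= !addn0.
- rewrite -map_comp; apply: eq_map => j' /=; rewrite /add_had /= addn0.
  rewrite (_ : (out j' == out j) = (j' == j)) //.
  by case: eqP => [->|]; rewrite ?(negPf wj) // addn0.
- apply: map_id_in => e; rewrite mem_pmap => /mapP[ij _].
  by case: (er_io D ij) => [b|] //= -[->]; rewrite /add_had /= !addn0.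
- apply: map_id_in => e; rewrite mem_pmap => /mapP[ij _].
  by case: (er_oo D ij) => [b|] //= -[->]; rewrite /add_had /= !addn0.
Qed.

Hypothesis bD : base D.

Lemma gatesE j : er_gates D j = if hd j then [:: GateH] else [::].
Proof. by have := base_locals bD j; rewrite /hd; case: (er_gates D j) => [|[] [|? ?]]. Qed.

Lemma q_hd j : hd j -> q j = 0 \/ q j = 2%:R.
Proof. by have := base_locals bD j; rewrite gatesE /q; case: (hd j). Qed.

Lemma er_zxE : er_zx R D = core_with hd.
Proof.
have fold_core s : uniq s ->
    foldr (fun j D' => foldr (gate_on_output j) D' (er_gates D j)) (er_core R D) s =
    core_with (fun j => (j \in s) && hd j).
  elim: s => [_|j s IH /= /andP[js us]]; first by [].
  have f1 (A B : Type) (f : A -> B -> B) z a : foldr f z [:: a] = f a z by [].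
  rewrite [X in foldr _ X _](IH us) gatesE; case: (boolP (hd j)) => hj.
    rewrite f1 gate_core_with ?(negPf js) //; apply: eq_core_with => j'.
    by rewrite inE; case: eqP => // ->; rewrite hj.
  by apply: eq_core_with => j'; rewrite inE; case: eqP => // ->; rewrite (negPf hj) andbF.
rewrite /er_zx fold_core ?enum_uniq //; apply: eq_core_with => j.
by rewrite mem_enum.
Qed.

Definition iq (a : 'Z_4) : C := imag ^+ a.
Definition had_edge (o b b' : bool) : C := if o then h * sgn (b && b') else 1.
Definition out_edge (o b b' : bool) : C := if o then h * sgn (b && b') else (b == b')%:R.

Definition weight (s : 'I_k + 'I_n -> bool) (y : bits n) (x : bits k) : C :=
  (\prod_i (x i == s (inl i))%:R) * (\prod_j iq (q j) ^+ s (inr j)) *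
  (\prod_j out_edge (hd j) (s (inr j)) (y j)) *
  (\prod_i \prod_j had_edge (io i j) (s (inl i)) (s (inr j))) *
  \prod_(j : 'I_n) \prod_(j' : 'I_n | (j < j')%N) had_edge (oo j j') (s (inr j)) (s (inr j')).

Lemma expi_quarter (a : 'Z_4) : expi (quarter_turns R a) = iq a.
Proof. by rewrite /quarter_turns expi_nat expi_pihalf. Qed.

Lemma core_weight (s : 'I_k + 'I_n -> bool) y x :
  (\prod_v phase_weight (@node_phase _ _ _ (core_with hd)) s v) *
  (\prod_(e <- edges (core_with hd)) amp R (@node_color _ _ _ (core_with hd)) s y x e) =
  weight s y x.
Proof.
rewrite big_sumType /= big1 ?mul1r => [|i _]; last first.
  by rewrite /phase_weight base_in_phase // expi_quarter /iq expr0 if_same.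
set col := (X in amp R X); have col_in i : col (inl i) = ColZ by exact: base_in_color.
have col_out j : col (inr j) = ColZ by exact: base_out_color.
rewrite !big_cat /=; clearbody col.
have -> : \prod_(e <- [seq (inp i, 0%N, nd (inl i)) | i : 'I_k]) amp R col s y x e =
    \prod_i (x i == s (inl i))%:R.
  by rewrite big_map big_enum; apply: eq_bigr => i _; rewrite /amp /= col_in leg_ket.
have -> : \prod_(e <- [seq (nd (inr j), nat_of_bool (hd j), out j) | j : 'I_n]) amp R col s y x e =
    \prod_j out_edge (hd j) (s (inr j)) (y j).
  rewrite big_map big_enum; apply: eq_bigr => j _; rewrite /amp /= col_out /out_edge.
  by case: (hd j); rewrite ?leg_had ?leg_ket.
rewrite !big_pmap big_filter.
have edgeE (o : option bool) u v : o <> Some false ->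
    oapp (amp R col s y x) 1 (omap (fun b : bool => (nd u, nat_of_bool b, nd v)) o) =
    had_edge (isSome o) (s u) (s v).
  case: o => [[]|] //= _; rewrite /amp /had_edge /=.
  by case: u v => [i|j] [i'|j']; rewrite ?col_in ?col_out leg_had.
rewrite [X in _ * (_ * (_ * (X * _)))](eq_bigr (fun ij : 'I_k * 'I_n =>
    had_edge (io ij.1 ij.2) (s (inl ij.1)) (s (inr ij.2)))); last first.
  by move=> [i j] _; rewrite edgeE //; apply: base_io.
rewrite [X in _ * (_ * (_ * (_ * X)))](eq_bigr (fun jj : 'I_n * 'I_n =>
    had_edge (oo jj.1 jj.2) (s (inr jj.1)) (s (inr jj.2)))); last first.
  by move=> [i j] _; rewrite edgeE //; apply: base_oo.
rewrite /weight pair_bigA pair_big_dep !big_enum_cond /=.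
rewrite (eq_bigr (fun j => iq (q j) ^+ s (inr j))) => [|j _]; last first.
  by rewrite /phase_weight expi_quarter /q; case: (s _).
by rewrite !mulrA; congr (_ * _ * _ * _); rewrite mulrC.
Qed.

Lemma interp_weight y x :
  interp (er_zx R D) y x = \sum_(s : {ffun 'I_k + 'I_n -> bool}) weight s y x.
Proof. by rewrite er_zxE interpE; apply: eq_bigr => s _; apply: core_weight. Qed.

Definition par (y : bits n) (j : 'I_n) : bool := \big[addb/false]_j' (oo j j' && y j').

(** The outputs without Hadamard are the free coordinates of the support of the code. *)
Definition pt (y : bits n) : bits n :=
  [ffun j => if hd j then par y j (+) (q j != 0) else y j].

Definition syndrome (y : bits n) : bits k := [ffun i => \big[addb/false]_j (io i j && y j)].

Definition character (x : bits k) (z : bits k) : C := \prod_i sgn (x i && z i).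

Definition quad (y : bits n) : C :=
  (\prod_(j | ~~ hd j) iq (q j) ^+ y j) *
  \prod_(j | ~~ hd j) \prod_(j' : 'I_n | (j < j')%N && ~~ hd j') sgn (oo j j' && (y j && y j')).

Definition codeword (y : bits n) (x : bits k) : C :=
  (y == pt y)%:R * character x (syndrome y) * quad y.

Lemma oo_sym j j' : oo j j' = oo j' j. Proof. by rewrite /oo base_sym. Qed.
Lemma oo_irr j : oo j j = false. Proof. by rewrite /oo base_irr. Qed.
Lemma oo_hd (j j' : 'I_n) : hd j -> (j' < j)%N -> oo j j' = false.
Proof. by move=> hj lt; rewrite oo_sym /oo base_had_oo. Qed.
Lemma io_hd i j : hd j -> io i j = false.
Proof. by move=> hj; rewrite /io base_had_io. Qed.
Lemma oo_hd2 j j' : hd j -> hd j' -> oo j j' = false.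
Proof.
move=> hj hj'; have [lt|lt|/val_inj->] := ltngtP j j'; last exact: oo_irr.
  by rewrite oo_sym oo_hd.
by rewrite oo_hd.
Qed.

Lemma prod_natb (I : finType) (P : pred I) : \prod_i (P i)%:R = [forall i, P i]%:R :> C.
Proof.
case: (boolP [forall i, P i]) => [/forallP H|]; first by rewrite big1 // => i _; rewrite H.
by rewrite negb_forall => /existsP[i /negPf Hi]; rewrite (bigD1 i) //= Hi mul0r.
Qed.

Lemma prod_sgn_cond (I : finType) (P : pred I) (t : bool) (u : I -> bool) :
  \prod_(j | P j) sgn (t && u j) = sgn (t && \big[addb/false]_(j | P j) u j).
Proof.
rewrite big_mkcond [in RHS]big_mkcond -prod_sgn_and; apply: eq_bigr => j _.
by case: (P j) => //; rewrite andbF.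
Qed.

(** The node bit of an output without Hadamard gate is forced to equal the output bit. That of a
    Hadamard output j is summed with the sign (-1)^(u (y_j + par + [q != 0])), which gives 2 or 0
    and hence the support condition. These sums are independent, as Hadamard outputs are never
    adjacent to each other. *)
Lemma interp_codeword : exists2 c : C, c != 0 & forall y x,
  interp (er_zx R D) y x = c * codeword y x.
Proof.
pose w o : C := if o then h else 1.
have w0 o : w o != 0 by rewrite /w; case: o; rewrite ?hcoef_neq0 ?oner_neq0.
(* [c1] collects the normalization of all Hadamard edges, [c2] the factors 2 from the sums at the
   Hadamard outputs. *)
pose c1 := (\prod_j w (hd j)) * (\prod_i \prod_j w (io i j)) *
  \prod_(j : 'I_n) \prod_(j' : 'I_n | (j < j')%N) w (oo j j').
pose c2 : C := \prod_j (if hd j then 2 else 1).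
have prod0 (I : finType) (P : pred I) (F : I -> C) :
    (forall i, F i != 0) -> \prod_(i | P i) F i != 0.
  by move=> hF; apply/prodf_neq0.
exists (c1 * c2).
  rewrite /c1 /c2 !mulf_neq0 //; first exact: prod0.
  - by apply: (@prod0) => i; apply: prod0.
  - by apply: (@prod0) => j; apply: prod0.
  by apply: prod0 => j; case: ifP; rewrite ?oner_neq0 ?pnatr_eq0.
move=> y x; rewrite interp_weight sum_ffun_sum.
pose oe o b b' : C := if o then sgn (b && b') else (b == b')%:R.
pose F (z : bits k) (u : bits n) : C := (\prod_j iq (q j) ^+ u j) * (\prod_j oe (hd j) (u j) (y j)) *
  (\prod_i \prod_j sgn (io i j && (z i && u j))) *
  \prod_(j : 'I_n) \prod_(j' : 'I_n | (j < j')%N) sgn (oo j j' && (u j && u j')).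
have weightE z u : weight (ffun_sum z u) y x = (z == x)%:R * (c1 * F z u).
  rewrite /weight (eq_bigr (fun i => (x i == z i)%:R)) => [|i _]; last by rewrite ffunE.
  rewrite prod_natb (_ : [forall i, x i == z i] = (z == x)); last first.
    by apply/eqfunP/eqP => [e|-> //]; apply/ffunP => i; rewrite e.
  have hE o b b' : had_edge o b b' = w o * sgn (o && (b && b')).
    by case: o; rewrite /had_edge /w //= mul1r.
  have oE o b b' : out_edge o b b' = w o * oe o b b'.
    by case: o; rewrite /out_edge /oe /w //= mul1r.
  rewrite -!mulrA; congr (_ * _).
  have hz i : ffun_sum z u (inl i) = z i by rewrite ffunE.
  have hu i : ffun_sum z u (inr i) = u i by rewrite ffunE.
  have -> : \prod_j iq (q j) ^+ ffun_sum z u (inr j) = \prod_j iq (q j) ^+ u j.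
    by apply: eq_bigr => j _; rewrite hu.
  have -> : \prod_j out_edge (hd j) (ffun_sum z u (inr j)) (y j) =
      (\prod_j w (hd j)) * \prod_j oe (hd j) (u j) (y j).
    by rewrite -big_split; apply: eq_bigr => j _; rewrite hu oE.
  have -> : \prod_i \prod_j had_edge (io i j) (ffun_sum z u (inl i)) (ffun_sum z u (inr j)) =
      (\prod_i \prod_j w (io i j)) * \prod_i \prod_j sgn (io i j && (z i && u j)).
    rewrite -big_split; apply: eq_bigr => i _; rewrite -big_split; apply: eq_bigr => j _.
    by rewrite hz hu hE.
  have -> : \prod_(j : 'I_n) \prod_(j' : 'I_n | (j < j')%N)
        had_edge (oo j j') (ffun_sum z u (inr j)) (ffun_sum z u (inr j')) =
      (\prod_(j : 'I_n) \prod_(j' : 'I_n | (j < j')%N) w (oo j j')) *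
      \prod_(j : 'I_n) \prod_(j' : 'I_n | (j < j')%N) sgn (oo j j' && (u j && u j')).
    rewrite -big_split; apply: eq_bigr => i _; rewrite -big_split; apply: eq_bigr => j _.
    by rewrite !hu hE.
  rewrite /c1 /F; set X1 := \prod_j iq _ ^+ _; set X2 := \prod_j w _; set X3 := \prod_j oe _ _ _.
  set X4 := \prod_i \prod_j w _; set X5 := \prod_i \prod_j sgn _.
  set X6 := \prod_j \prod_(j' < n | _) w _; set X7 := \prod_j \prod_(j' < n | _) sgn _.
  ring.
under eq_bigr => z _ do under eq_bigr => u _ do rewrite weightE.
under eq_bigr => z _ do rewrite -mulr_sumr -mulr_sumr.
clearbody c1.
rewrite (sum_delta x (fun z => c1 * \sum_u F z u)) -mulrA; congr (_ * _).
(* All dependence on the summed bits goes into a product over the nodes, so that the sum over [u]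
   becomes a product of sums over one bit. *)
pose g j b : C := if hd j then sgn (b && (y j (+) pt y j)) else (b == y j)%:R.
have FE u : F x u = character x (syndrome y) * quad y * \prod_j g j (u j).
  have [/forallP uy|] := boolP [forall j, ~~ hd j ==> (u j == y j)]; last first.
    rewrite negb_forall => /existsP[j]; rewrite negb_imply => /andP[/negPf hj /negPf uj].
    rewrite /F [\prod_j oe _ _ _](bigD1 j) //= [\prod_j g _ _](bigD1 j) //=.
    by rewrite /oe /g hj uj !(mul0r, mulr0).
  have {}uy j : ~~ hd j -> u j = y j by move=> hj; apply/eqP; have := uy j; rewrite hj.
  have -> : \prod_j g j (u j) = \prod_(j | hd j) sgn (u j && (y j (+) pt y j)).
    rewrite (bigID hd) /= [X in _ * X]big1 ?mulr1; last first.
      by move=> j hj; rewrite /g (negPf hj) uy // eqxx.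
    by apply: eq_bigr => j hj; rewrite /g hj.
  have E1 : (\prod_j iq (q j) ^+ u j) * \prod_j oe (hd j) (u j) (y j) =
      (\prod_(j | ~~ hd j) iq (q j) ^+ y j) *
      \prod_(j | hd j) sgn (u j && (y j (+) (q j != 0))).
    rewrite -big_split (bigID hd) /= mulrC; congr (_ * _); apply: eq_bigr => j hj.
      by rewrite /oe (negPf hj) uy // eqxx mulr1.
    rewrite /oe hj; case: (u j) => //=; rewrite ?mulr1 //.
    rewrite sgnD mulrC; congr (_ * _).
    (* At a Hadamard output the phase is 0 or pi, so i^q is a sign: the affine term of [pt]. *)
    case: (q_hd hj) => ->; first by rewrite /iq expr0.
    by rewrite /iq /= sqr_i.
  have E2 : \prod_i \prod_j sgn (io i j && (x i && u j)) = character x (syndrome y).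
    apply: eq_bigr => i _; rewrite ffunE -prod_sgn_and; apply: eq_bigr => j _.
    have [hj|/uy ->] := boolP (hd j); first by rewrite io_hd // andbF.
    by rewrite andbCA.
  have E3 : \prod_(j : 'I_n) \prod_(j' : 'I_n | (j < j')%N) sgn (oo j j' && (u j && u j')) =
      (\prod_(j | ~~ hd j) \prod_(j' : 'I_n | (j < j')%N && ~~ hd j')
         sgn (oo j j' && (y j && y j'))) *
      \prod_(j | hd j) sgn (u j && par y j).
    rewrite (bigID hd) /= mulrC; congr (_ * _); apply: eq_bigr => j hj.
      rewrite (bigID hd) /= big1 ?mul1r => [|j' /andP[lt hj']]; last by rewrite oo_sym oo_hd.
      by apply: eq_bigr => j' /andP[_ hj']; rewrite !uy.
    rewrite /par -prod_sgn_and [RHS](bigID (fun j' : 'I_n => (j < j')%N)) /=.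
    rewrite [X in _ * X]big1 ?mulr1; last first.
      move=> j'; rewrite -leqNgt leq_eqVlt => /orP[/eqP/val_inj ->|lt].
        by rewrite oo_irr andbF.
      by rewrite oo_hd // andbF.
    apply: eq_bigr => j' lt; have [hj'|/uy ->] := boolP (hd j'); last by rewrite andbCA.
    by rewrite oo_hd2 // andbF.
  have E4 : \prod_(j | hd j) sgn (u j && (y j (+) pt y j)) =
      (\prod_(j | hd j) sgn (u j && (y j (+) (q j != 0)))) * \prod_(j | hd j) sgn (u j && par y j).
    rewrite -big_split; apply: eq_bigr => j hj /=; rewrite -sgnD -andb_addr ffunE hj.
    by rewrite -addbA [(q j != 0) (+) _]addbC.
  rewrite /F E1 E2 E3 E4 /quad.
  set X1 := \prod_(j | ~~ _) iq _ ^+ _; set X2 := \prod_(j | hd j) sgn _.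
  set X3 := \prod_(j | ~~ _) \prod_(j' | _) _; set X4 := \prod_(j | hd j) sgn _; ring.
rewrite (eq_bigr _ (fun u _ => FE u)).
rewrite -mulr_sumr -(bigA_distr_bigA g) /codeword mulrC -[in RHS]mulrA mulrA; congr (_ * _).
have -> : (y == pt y)%:R = \prod_j (y j == pt y j)%:R :> C.
  rewrite prod_natb (_ : [forall j, y j == pt y j] = (y == pt y)) //.
  by apply/eqfunP/eqP => [e|<- //]; apply/ffunP => j; rewrite e.
rewrite /c2 -big_split; apply: eq_bigr => j _ /=; rewrite sum_bool /g.
have [hj|hj] := boolP (hd j).
  by case: (y j) (pt y j) => [] []; rewrite /sgn /= ?expr0 ?expr1 ?subrr ?mulr0 ?mulr1.
by rewrite ffunE (negPf hj) eqxx mulr1; case: (y j); rewrite /= ?addr0 ?add0r.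
Qed.
End Diagram.
End Base.

(** * Prime diagrams are connected *)

Section CodewordAlgebra.
Variables (R : realType) (k n : nat) (D : er_diagram k n).
Hypothesis bD : base D.
Local Notation C := (complex R).
Local Notation sgn := (sgn R).
Local Notation iq := (iq R).
Local Notation character := (character R).
Local Notation quad := (quad R D).
Local Notation codeword := (codeword R D).
Local Notation hd := (hd D).
Local Notation oo := (oo D).
Local Notation io := (io D).
Local Notation q := (q D).

Definition delta m (j : 'I_m) : bits m := [ffun i => i == j].

Lemma bitsD m (u v : bits m) j : (u + v) j = u j (+) v j.
Proof. by rewrite ffunE. Qed.

Lemma bits0 m (j : 'I_m) : (0 : bits m) j = false.
Proof. by rewrite ffunE. Qed.

Lemma bitsDD m (u : bits m) : u + u = 0.
Proof. by apply/ffunP => j; rewrite bitsD bits0 addbb. Qed.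

Lemma pt_free y j : ~~ hd j -> pt D y j = y j.
Proof. by rewrite ffunE => /negPf ->. Qed.

Lemma par_free (u v : bits n) j : (forall j, ~~ hd j -> u j = v j) -> hd j -> par D u j = par D v j.
Proof.
move=> uv hj; apply: eq_bigr => j' _; have [hj'|/uv -> //] := boolP (hd j').
by rewrite oo_hd2.
Qed.

Lemma eq_pt (u v : bits n) : (forall j, ~~ hd j -> u j = v j) -> pt D u = pt D v.
Proof.
move=> uv; apply/ffunP => j; rewrite !ffunE; case: ifP => [hj|/negbT/uv //].
by rewrite (par_free uv).
Qed.

Lemma pt_pt u : pt D (pt D u) = pt D u.
Proof. by apply: eq_pt => j /pt_free. Qed.

Lemma eq_syndrome (u v : bits n) : (forall j, ~~ hd j -> u j = v j) -> syndrome D u = syndrome D v.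
Proof.
move=> uv; apply/ffunP => i; rewrite !ffunE; apply: eq_bigr => j _.
by have [hj|/uv -> //] := boolP (hd j); rewrite io_hd.
Qed.

Lemma syndrome_pt u : syndrome D (pt D u) = syndrome D u.
Proof. by apply: eq_syndrome => j /pt_free. Qed.

Lemma syndromeD u v : syndrome D (u + v) = syndrome D u + syndrome D v.
Proof.
apply/ffunP => i; rewrite bitsD !ffunE -big_split; apply: eq_bigr => j _.
by rewrite bitsD andb_addr.
Qed.

Lemma syndrome0 : syndrome D 0 = 0.
Proof. by apply/ffunP => i; rewrite !ffunE big1 // => j _; rewrite bits0 andbF. Qed.

Lemma syndrome_delta j i : syndrome D (delta j) i = io i j.
Proof.
rewrite ffunE (bigD1 j) //= big1 ?addbF ?ffunE ?eqxx ?andbT // => j' /negPf j'j.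
by rewrite ffunE j'j andbF.
Qed.

Lemma eq_quad (u v : bits n) : (forall j, ~~ hd j -> u j = v j) -> quad u = quad v.
Proof.
move=> uv; rewrite /quad; congr (_ * _); first by apply: eq_bigr => j /uv ->.
by apply: eq_bigr => j /uv ->; apply: eq_bigr => j' /andP[_ /uv ->].
Qed.

Lemma quad_pt u : quad (pt D u) = quad u.
Proof. by apply: eq_quad => j /pt_free. Qed.

Lemma iq_neq0 a : iq a != 0.
Proof. by rewrite -expi_quarter expi_neq0. Qed.

Lemma iq_sqr a : iq a * iq a = sgn (odd a).
Proof. by rewrite /iq -exprMn -expr2 sqr_i /sgn signr_odd. Qed.

Lemma iq_inj : injective iq.
Proof.
have neq1 : (1 == -1 :> R) = false by rewrite -subr_eq0 opprK -mulr2n pnatr_eq0.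
have iqE a : iq a = nth 0 [:: Complex 1 0; Complex 0 1; Complex (-1) 0; Complex 0 (-1)] a.
  case: a => [[|[|[|[|//]]]] lta]; rewrite /iq ?expr0 ?expr1 // /= !exprS expr0; simpc => //.
move=> a b; rewrite !iqE => /eqP.
case: a => [[|[|[|[|//]]]] lta]; case: b => [[|[|[|[|//]]]] ltb] //=;
  rewrite eq_complex /= ?oppr_eq0 ?[0 == - _]eq_sym ?oppr_eq0 ?oner_eq0 ?[0 == 1]eq_sym ?oner_eq0
    ?[-1 == 1]eq_sym ?neq1 ?andbF // => _; exact: val_inj.
Qed.

Lemma quad_neq0 y : quad y != 0.
Proof.
rewrite mulf_neq0 //; apply/prodf_neq0 => j _; first by rewrite expf_neq0 // iq_neq0.
by apply/prodf_neq0 => j' _; apply: sgn_neq0.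
Qed.

Lemma characterD (x z z' : bits k) : character x (z + z') = character x z * character x z'.
Proof. by rewrite -big_split; apply: eq_bigr => i _; rewrite bitsD andb_addr sgnD. Qed.

Lemma character0r (x : bits k) : character x 0 = 1.
Proof. by rewrite /character big1 // => i _; rewrite bits0 andbF. Qed.

Lemma character0l (z : bits k) : character 0 z = 1.
Proof. by rewrite /character big1 // => i _; rewrite bits0. Qed.

Lemma character_delta i (z : bits k) : character (delta i) z = sgn (z i).
Proof.
rewrite /character (bigD1 i) //= ffunE eqxx big1 ?mulr1 // => i' /negPf i'i.
by rewrite ffunE i'i.
Qed.

(** The alternating form of [quad] off the diagonal, completed by the parities of the phases. *)
Definition polar (j j' : 'I_n) : bool := if j == j' then odd (q j) else oo j j'.

(** As addition is modulo 2, i^(q (b + b')) differs from i^(q b) i^(q b') by (-1)^(q b b'), which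
    explains the diagonal of [polar]. Each edge contributes its two mixed terms, and these turn the
    sum over j < j' into one over ordered pairs. *)
Lemma quadD u v : quad (u + v) = quad u * quad v *
  \prod_(j | ~~ hd j) \prod_(j' | ~~ hd j') sgn (polar j j' && (u j && v j')).
Proof.
have iqD a (b b' : bool) : iq a ^+ (b (+) b') = iq a ^+ b * iq a ^+ b' * sgn (odd a && (b && b')).
  case: b; case: b'; rewrite /= ?andbF ?andbT ?expr0 ?expr1 ?mulr1 ?mul1r //.
  by rewrite iq_sqr sgn2.
have -> : \prod_(j | ~~ hd j) \prod_(j' | ~~ hd j') sgn (polar j j' && (u j && v j')) =
    (\prod_(j | ~~ hd j) sgn (odd (q j) && (u j && v j))) *
    \prod_(j | ~~ hd j) \prod_(j' : 'I_n | (j < j')%N && ~~ hd j')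
      (sgn (oo j j' && (u j && v j')) * sgn (oo j j' && (v j && u j'))).
  rewrite [in RHS](eq_bigr _ (fun j _ => big_split _ _ _ _ _)) big_split /=.
  rewrite [X in _ = _ * (_ * X)](exchange_big_dep (fun j => ~~ hd j)) /=; last first.
    by move=> j j' _ /andP[].
  rewrite -!big_split; apply: eq_bigr => j hj /=.
  rewrite (bigD1 j) //= {1}/polar eqxx; congr (_ * _).
  rewrite (bigID (fun j' : 'I_n => (j < j')%N)) /=; congr (_ * _).
    apply: eq_big => [j'|j' /andP[/andP[_ /negPf jj'] _]].
      by rewrite eq_sym; case: ltnP => [lt|_]; rewrite ?andbF ?andbT // (contraTneq _ lt) ?andbT // => ->;
        rewrite ltnn.
    by rewrite /polar eq_sym jj'.
  apply: eq_big => [j'|j' /andP[/andP[_ /negPf jj'] _]]; last first.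
    by rewrite /polar eq_sym jj' (oo_sym bD j') [v j' && _]andbC.
  rewrite -leqNgt leq_eqVlt hj andbT; case: (j' =P j) => [->|/eqP jj'].
    by rewrite ltnn andbF.
  by have /negPf-> : j' != j :> nat by []; rewrite andbT andbC.
rewrite /quad.
under eq_bigr => j _ do rewrite bitsD iqD.
rewrite [X in _ * X = _](eq_bigr (fun j : 'I_n =>
   (\prod_(j' : 'I_n | (j < j')%N && ~~ hd j') sgn (oo j j' && (u j && u j'))) *
   (\prod_(j' : 'I_n | (j < j')%N && ~~ hd j') sgn (oo j j' && (v j && v j'))) *
   \prod_(j' : 'I_n | (j < j')%N && ~~ hd j')
     (sgn (oo j j' && (u j && v j')) * sgn (oo j j' && (v j && u j'))))) => [|j _]; last first.
  rewrite -!big_split; apply: eq_bigr => j' _ /=; rewrite !bitsD -!sgnD; congr (sgn _).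
  by case: (oo j j'); case: (u j); case: (v j); case: (u j'); case: (v j').
rewrite !big_split /=.
set X1 := \prod_(j | _) _ ^+ _; set X2 := \prod_(j | _) _ ^+ _; set X3 := \prod_(j | _) sgn _.
set X4 := \prod_(j | _) \prod_(j' | _) _; set X5 := \prod_(j | _) \prod_(j' | _) _.
set X6 := \prod_(j | _) \prod_(j' | _) _; ring.
Qed.

Lemma delta_eq m (j i : 'I_m) : delta j i = (i == j).
Proof. by rewrite ffunE. Qed.

Lemma quad0 : quad 0 = 1.
Proof.
rewrite /quad !big1 ?mulr1 // => j _; last by rewrite bits0 expr0.
by rewrite big1 // => j' _; rewrite bits0 andbF.
Qed.

Lemma quad_delta j : ~~ hd j -> quad (delta j) = iq (q j).
Proof.
move=> hj; rewrite /quad [X in _ * X]big1 ?mulr1 => [|a _]; last first.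
  rewrite big1 // => b /andP[lt _]; rewrite !delta_eq.
  case: eqP => [e|_]; last by rewrite andbF.
  by case: eqP => [e'|_]; [rewrite e e' ltnn in lt|rewrite !andbF].
rewrite (bigD1 j) //= delta_eq eqxx expr1 big1 ?mulr1 // => a /andP[_ /negPf aj].
by rewrite delta_eq aj expr0.
Qed.

Lemma quadD_delta u j : ~~ hd j -> quad (u + delta j) = quad u * iq (q j) *
  \prod_(j' | ~~ hd j') sgn (polar j' j && u j').
Proof.
move=> hj; rewrite quadD quad_delta //; congr (_ * _); apply: eq_bigr => a _.
rewrite (bigD1 j) //= delta_eq eqxx andbT big1 ?mulr1 // => b /andP[_ /negPf bj].
by rewrite delta_eq bj !andbF.
Qed.

Lemma quad_delta2 j j' : ~~ hd j -> ~~ hd j' -> j != j' ->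
  quad (delta j + delta j') = quad (delta j) * quad (delta j') * sgn (oo j j').
Proof.
move=> hj hj' jj'; rewrite quadD_delta // -quad_delta //; congr (_ * _).
rewrite (bigD1 j) //= delta_eq eqxx andbT /polar (negPf jj') big1 ?mulr1 // => a /andP[_ /negPf aj].
by rewrite delta_eq aj andbF.
Qed.

Lemma codeword_neq0 y x : (codeword y x != 0) = (y == pt D y).
Proof.
rewrite /codeword; case: (y =P pt D y) => _; last by rewrite !mul0r eqxx.
by rewrite mul1r mulf_neq0 ?quad_neq0 //; apply/prodf_neq0 => i _; apply: sgn_neq0.
Qed.

Lemma codeword_pt u x : codeword (pt D u) x = character x (syndrome D u) * quad u.
Proof. by rewrite /codeword pt_pt eqxx mul1r syndrome_pt quad_pt. Qed.

End CodewordAlgebra.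

Definition mix m (S : pred 'I_m) (y y' : bits m) : bits m := [ffun j => if S j then y j else y' j].

(** The matrix [M] is, up to a factor, the tensor product of a matrix acting on
    the bits in [SI] and [SO] and of one acting on the others. *)
Definition rectangular (R : realType) k n (M : bits n -> bits k -> complex R)
    (SI : pred 'I_k) (SO : pred 'I_n) : Prop :=
  forall y y' x x', M y x * M y' x' = M (mix SO y y') (mix SI x x') * M (mix SO y' y) (mix SI x' x).

(** The exchange (s, t) -> (m s t, m t s) is an involution on pairs, along which the double sum is
    reindexed. *)
Lemma prod_sum_swap (C : comNzRingType) (T : finType) (m : T -> T -> T) (f g f' g' : T -> C) :
  (forall s t, m (m s t) (m t s) = s) -> (forall s t, f s * g t = f' (m s t) * g' (m t s)) ->
  (\sum_s f s) * (\sum_t g t) = (\sum_s f' s) * (\sum_t g' t).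
Proof.
move=> mK fg; rewrite !big_distrlr /= !pair_bigA /=.
rewrite [RHS](reindex (fun p : T * T => (m p.1 p.2, m p.2 p.1))) /=.
  by apply: eq_bigr => p _; apply: fg.
by exists (fun p : T * T => (m p.1 p.2, m p.2 p.1)) => -[s t] _ /=; rewrite !mK.
Qed.

(** Two assignments may exchange their bits on [S] without changing the product of their amplitudes,
    because each edge lies wholly on one side. *)
Lemma disconnected_rectangular (R : realType) k n (D : zx R k n) (S : point (node D) k n -> bool) :
  (forall e, e \in edges D -> S e.1.1 = S e.2) ->
  rectangular (interp D) (fun i => S (inp i)) (fun j => S (out j)).
Proof.
move=> HS y y' x x'; rewrite !interpE.
pose m (s t : {ffun node D -> bool}) : {ffun node D -> bool} :=
  [ffun v => if S (nd v) then s v else t v].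
apply: (prod_sum_swap (m := m)) => [s t|s t].
  by apply/ffunP => v; rewrite !ffunE; case: (S _).
rewrite mulrACA [RHS]mulrACA; congr (_ * _).
  rewrite -big_split -[RHS]big_split; apply: eq_bigr => v _ /=.
  by rewrite /phase_weight !ffunE; case: (S _); rewrite // mulrC.
rewrite -big_split -[RHS]big_split big_seq_cond [RHS]big_seq_cond.
apply: eq_bigr => e; rewrite andbT => /HS Se.
have hp a b ya yb xa xb z :
    point_vec R (node_color (z := D)) (m a b) (mix (fun j => S (out j)) ya yb)
      (mix (fun i => S (inp i)) xa xb) z =
    if S z then point_vec R (node_color (z := D)) a ya xa z
    else point_vec R (node_color (z := D)) b yb xb z.
  by case: z => [v|[i|j]] /=; rewrite ffunE; case: (S _).
rewrite /amp /= !hp Se; case: (S _); [done|exact: mulrC].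
Qed.

Section Connected.
Variables (R : realType) (k n : nat) (D : er_diagram k n).
Hypothesis bD : base D.
Local Notation C := (complex R).
Local Notation sgn := (sgn R).
Local Notation hd := (hd D).
Local Notation oo := (oo D).
Local Notation io := (io D).

Definition adj : rel ('I_k + 'I_n) := fun u v =>
  match u, v with
  | inl i, inr j | inr j, inl i => io i j
  | inr j, inr j' => oo j j'
  | inl _, inl _ => false
  end.

Lemma adj_sym : symmetric adj.
Proof. by move=> [i|j] [i'|j'] //=; apply: oo_sym. Qed.

Lemma connect_adj_sym : connect_sym adj.
Proof. exact/sym_connect_sym/adj_sym. Qed.

Lemma mix_compl m (S : pred 'I_m) y y' : mix (predC S) y y' = mix S y' y.
Proof. by apply/ffunP => j; rewrite !ffunE /=; case: (S j). Qed.

Lemma rectangular_compl (M : bits n -> bits k -> C) SI SO :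
  rectangular M SI SO -> rectangular M (predC SI) (predC SO).
Proof. by move=> h y y' x x'; rewrite !mix_compl h mulrC. Qed.

Section Rectangular.
Variables (SI : pred 'I_k) (SO : pred 'I_n).
Hypothesis rect : rectangular (codeword R D) SI SO.
Local Notation K u x := (character R x (syndrome D u) * quad R D u).

(** A rectangular matrix has a support closed under mixing, and the fixed points of [pt] are the
    support. *)
Lemma mix_pt u v : mix SO (pt D u) (pt D v) = pt D (mix SO u v).
Proof.
have : codeword R D (mix SO (pt D u) (pt D v)) (mix SI 0 0) != 0.
  have : codeword R D (pt D u) 0 * codeword R D (pt D v) 0 != 0.
    by rewrite mulf_neq0 // codeword_neq0 // pt_pt.
  by rewrite rect mulf_eq0 => /norP[].
rewrite codeword_neq0 // => /eqP ->; apply: eq_pt => // j hj.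
by rewrite !ffunE (negPf hj).
Qed.

Lemma rectangular_free u v x x' :
  K u x * K v x' = K (mix SO u v) (mix SI x x') * K (mix SO v u) (mix SI x' x).
Proof. by rewrite -!(codeword_pt R bD) -!mix_pt; apply: rect. Qed.

Lemma mix_delta0 m (S : pred 'I_m) j : S j -> mix S (delta j) 0 = delta j.
Proof. by move=> Sj; apply/ffunP => i; rewrite !ffunE; case: eqP => [->|_]; rewrite ?Sj ?if_same. Qed.

Lemma mix_0delta m (S : pred 'I_m) j : S j -> mix S 0 (delta j) = 0.
Proof. by move=> Sj; apply/ffunP => i; rewrite !ffunE; case: eqP => [->|_]; rewrite ?Sj ?if_same. Qed.

Lemma mix_id m (S : pred 'I_m) y : mix S y y = y.
Proof. by apply/ffunP => j; rewrite ffunE if_same. Qed.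

Lemma sgn_true_neq1 : (1 == sgn true) = false.
Proof. by rewrite /sgn expr1 -subr_eq0 opprK -mulr2n pnatr_eq0. Qed.

(** An edge gives the sign -1 when both of its bits are set; mixing with zeros separates the two
    bits and loses the sign. *)
Lemma rectangular_io i j : SO j -> ~~ SI i -> io i j = false.
Proof.
move=> Sj Si; apply/negP => ij.
have := rectangular_free (delta j) 0 (delta i) 0.
have mixC x x' : mix SI x x' = mix (predC SI) x' x.
  by apply/ffunP => a; rewrite !ffunE /=; case: (SI a).
have -> : mix SI (delta i) 0 = 0 by rewrite mixC mix_0delta.
have -> : mix SI 0 (delta i) = delta i by rewrite mixC mix_delta0.
rewrite mix_delta0 // mix_0delta // syndrome0 !character0r !character0l character_delta.
rewrite syndrome_delta ij !mul1r quad0 !mulr1 -[X in _ = X]mul1r => /(mulIf (quad_neq0 _ _ _)).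
by move/eqP; rewrite eq_sym sgn_true_neq1.
Qed.

(** The same test with [delta j + delta j'], whose mixtures with 0 are the two unit vectors. *)
Lemma rectangular_oo_free j j' : ~~ hd j -> ~~ hd j' -> SO j -> ~~ SO j' -> oo j j' = false.
Proof.
move=> hj hj' Sj Sj'; apply/negP => jj'.
have neq : j != j' by apply: contraNneq Sj' => <-.
have := rectangular_free (delta j + delta j') 0 0 0.
have -> : mix SO (delta j + delta j') 0 = delta j.
  apply/ffunP => a; rewrite !ffunE; case: (a =P j) => [->|_]; first by rewrite Sj (negPf neq).
  by case: eqP => [->|_]; rewrite ?(negPf Sj') ?if_same.
have -> : mix SO 0 (delta j + delta j') = delta j'.
  apply/ffunP => a; rewrite !ffunE; case: (a =P j) => [->|_]; first by rewrite Sj (negPf neq).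
  by case: eqP => [->|_]; rewrite ?(negPf Sj') ?if_same.
rewrite mix_id !character0l !mul1r quad0 mulr1 quad_delta2 // -[X in _ = X]mulr1 jj'.
move/(mulfI (mulf_neq0 (quad_neq0 _ _ _) (quad_neq0 _ _ _)))/esym/eqP.
by rewrite sgn_true_neq1.
Qed.

(** An edge at the Hadamard output [t] shows in the support rather than in a sign: toggling bit j
    would toggle the determined bit t, whereas mixing takes bit t from the other word. *)
Lemma rectangular_oo_hd t j : hd t -> SO j -> ~~ SO t -> oo t j = false.
Proof.
move=> ht Sj St; have /ffunP/(_ t) := mix_pt (delta j) 0.
rewrite mix_delta0 // ffunE (negPf St) !ffunE ht => /addIb.
rewrite {1}/par big1 => [|a _]; last by rewrite bits0 andbF.
rewrite /par (bigD1 j) //= delta_eq eqxx andbT big1 ?addbF => [<- //|a /negPf aj].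
by rewrite delta_eq aj andbF.
Qed.

End Rectangular.

Lemma rectangular_no_cross (SI : pred 'I_k) (SO : pred 'I_n) :
  rectangular (codeword R D) SI SO ->
  (forall i j, io i j -> SI i = SO j) /\ (forall j j', oo j j' -> SO j = SO j').
Proof.
move=> rect; have rectC := rectangular_compl rect; split=> [i j ij|].
  case Si: (SI i); case Sj: (SO j) => //.
    have := rectangular_io rectC (i := i) (j := j); rewrite /= Si Sj ij.
    by move=> /(_ erefl erefl).
  have := rectangular_io rect (i := i) (j := j); rewrite Si Sj ij.
  by move=> /(_ erefl erefl).
have free a b : ~~ hd a -> ~~ hd b -> oo a b -> SO a -> ~~ SO b -> False.
  by move=> ha hb ab Sa Sb; rewrite (rectangular_oo_free rect) in ab.
have one a b : hd a -> oo a b -> SO a = SO b.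
  move=> ha ab; case Sa: (SO a); case Sb: (SO b) => //.
    have := rectangular_oo_hd rectC (t := a) (j := b); rewrite /= Sa Sb ab.
    by move=> /(_ ha erefl erefl).
  have := rectangular_oo_hd rect (t := a) (j := b); rewrite Sa Sb ab.
  by move=> /(_ ha erefl erefl).
move=> j j' jj'; have [hj|hj] := boolP (hd j); first exact: one.
have [hj'|hj'] := boolP (hd j'); first by apply/esym/one; rewrite // oo_sym.
case Sj: (SO j); case Sj': (SO j') => //.
  by case: (free j j' hj hj' jj' Sj (negbT Sj')).
by rewrite oo_sym // in jj'; case: (free j' j hj' hj jj' Sj' (negbT Sj)).
Qed.

(** Both sides of [rectangular] have degree two in the matrix, so the scalars produced by rewriting
    cancel. *)
Lemma codeword_rectangular (SI : pred 'I_k) (SO : pred 'I_n) (D' : zx R k n) :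
  rewrites (er_zx R D) D' -> rectangular (interp D') SI SO -> rectangular (codeword R D) SI SO.
Proof.
move=> /rewrites_proportional[c c0 h] rect y y' x x'.
have [d d0 hd] := interp_codeword R bD.
have e0 : c^-1 * d != 0 by rewrite mulf_neq0 // invr_neq0.
have E y1 x1 : interp D' y1 x1 = c^-1 * d * codeword R D y1 x1.
  by rewrite -mulrA -hd h mulKf.
apply: (mulfI e0); apply: (mulfI e0).
have := rect y y' x x'; rewrite !E => e.
transitivity (c^-1 * d * codeword R D y x * (c^-1 * d * codeword R D y' x')); first by ring.
by rewrite e; ring.
Qed.

Lemma connected_prime : (forall u v, connect adj u v) ->
  ~ exists D' : zx R k n, rewrites (er_zx R D) D' /\ disconnected D'.
Proof.
move=> conn [D' [rw [S [HS [b Sb] [b' Sb']]]]].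
have /(codeword_rectangular rw)/rectangular_no_cross[hio hoo] := disconnected_rectangular HS.
pose S' v := match v with inl i => S (inp i) | inr j => S (out j) end.
have S'E (v : 'I_k + 'I_n) : S (inr v) = S' v by case: v.
have cl : closed adj S'.
  by move=> [i|j] [i'|j'] //=; [apply: hio|move=> /hio/esym|apply: hoo].
have := closed_connect cl (conn b b').
by rewrite /in_mem /= -!S'E Sb (negPf Sb').
Qed.

Definition point_node (p : point ('I_k + 'I_n) k n) : 'I_k + 'I_n :=
  match p with inl v => v | inr v => v end.

(** The empty rewriting suffices: the connected component of [u] is a cut of the diagram itself. *)
Lemma prime_connected :
  (~ exists D' : zx R k n, rewrites (er_zx R D) D' /\ disconnected D') ->
  forall u v, connect adj u v.
Proof.
move=> prime u v; apply/negPn/negP => uv; apply: prime; exists (er_zx R D).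
split; first exact: rewrites_refl.
rewrite er_zxE //; exists (fun p => connect adj u (point_node p)); split; last 2 first.
- by exists u; rewrite /= connect0.
- by exists v.
have adj_same a b : adj a b -> connect adj u a = connect adj u b.
  move=> ab; apply/idP/idP => h; apply: (connect_trans h); apply: connect1 => //.
  by rewrite adj_sym.
move=> e; rewrite !mem_cat => /or4P[/mapP[i _ ->]|/mapP[j _ ->]||] //.
  rewrite mem_pmap => /mapP[[i j] _]; case E: (er_io D (i, j)) => [b|] // [->] /=.
  by apply: adj_same; rewrite /= /io E.
rewrite mem_pmap => /mapP[[i j] _]; case E: (er_oo D (i, j)) => [b|] // [->] /=.
by apply: adj_same; rewrite /= /oo E.
Qed.

End Connected.

(** * Uniqueness of the KLS form *)

(** A KLS diagram without zero rows, up to the order of its inputs: [p i] is the pivot of input i,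
    and [p] need not be increasing. *)
Record pivoted k n (D : er_diagram k n) (p : 'I_k -> 'I_n) : Prop := Pivoted {
  pivoted_base : base D;
  pivot_io : forall i i', io D i' (p i) = (i' == i);
  pivot_lead : forall i (j : 'I_n), (j < p i)%N -> io D i j = false;
  pivot_phase : forall i, q D (p i) = 0;
  pivot_oo : forall i i', oo D (p i) (p i') = false
}.

Definition image_of (R : realType) k n (M : bits n -> bits k -> complex R) (psi : state R n) :=
  exists phi, apply M phi = psi.

Section Image.
Variables (R : realType) (k n : nat).
Local Notation C := (complex R).

Lemma applyE (M : bits n -> bits k -> C) phi y : apply M phi y = \sum_x M y x * phi x.
Proof. by rewrite ffunE. Qed.

Definition basis_state (x : bits k) : state R k := [ffun x' => (x' == x)%:R].

Lemma apply_basis (M : bits n -> bits k -> C) x y : apply M (basis_state x) y = M y x.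
Proof.
rewrite applyE (bigD1 x) //= ffunE eqxx mulr1 big1 ?addr0 // => x' /negPf x'x.
by rewrite ffunE x'x mulr0.
Qed.

Lemma image_of_scale (M N : bits n -> bits k -> C) c : c != 0 ->
  (forall y x, M y x = c * N y x) -> forall psi, image_of M psi <-> image_of N psi.
Proof.
move=> c0 MN psi; split=> -[phi <-].
  exists [ffun x => c * phi x]; apply/ffunP => y; rewrite !applyE; apply: eq_bigr => x _.
  by rewrite ffunE MN mulrCA mulrA.
exists [ffun x => c^-1 * phi x]; apply/ffunP => y; rewrite !applyE; apply: eq_bigr => x _.
by rewrite ffunE MN mulrACA divff // mul1r.
Qed.

Lemma apply_codeword (D : er_diagram k n) phi y : apply (codeword R D) phi y =
  (y == pt D y)%:R * quad R D y * \sum_x character R x (syndrome D y) * phi x.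
Proof.
rewrite applyE mulr_sumr; apply: eq_bigr => x _; rewrite /codeword; ring.
Qed.

Lemma apply_codeword_pt (D : er_diagram k n) phi u : base D -> apply (codeword R D) phi (pt D u) =
  quad R D u * \sum_x character R x (syndrome D u) * phi x.
Proof. by move=> bD; rewrite apply_codeword (pt_pt bD) eqxx mul1r quad_pt (syndrome_pt bD). Qed.

Lemma syndrome_sum (D : er_diagram k n) (I : finType) (P : pred I) (F : I -> bits n) :
  syndrome D (\sum_(i | P i) F i) = \sum_(i | P i) syndrome D (F i).
Proof. by apply: (big_morph _ (syndromeD D) (syndrome0 D)). Qed.

Lemma sum_bitsE m (I : finType) (P : pred I) (F : I -> bits m) j :
  (\sum_(i | P i) F i) j = \big[addb/false]_(i | P i) F i j.
Proof.
by apply: (big_morph (fun u : bits m => u j)) => [u v|]; rewrite ?bitsD ?bits0.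
Qed.

Lemma sum_eqb (I : finType) (P : pred I) i : \big[addb/false]_(j | P j) (i == j) = P i.
Proof.
case: (boolP (P i)) => Pi; last first.
  by rewrite big1 // => j Pj; apply: contraNF Pi => /eqP ->.
by rewrite (bigD1 i) //= eqxx big1 // => j /andP[_ /negPf]; rewrite eq_sym.
Qed.

End Image.

Section Pivoted.
Variables (R : realType) (k n : nat) (D : er_diagram k n) (p : 'I_k -> 'I_n).
Hypothesis pD : pivoted D p.
Local Notation C := (complex R).
Let bD : base D := pivoted_base pD.

Lemma pivot_inj : injective p.
Proof.
move=> i i' e; have := pivot_io pD i i; rewrite eqxx e (pivot_io pD) => /eqP //.
Qed.

Lemma pivot_free i : ~~ hd D (p i).
Proof. by apply/negP => h; have := pivot_io pD i i; rewrite (io_hd bD) // eqxx. Qed.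

Definition of_pivots (z : bits k) : bits n := \sum_(i | z i) delta (p i).

Lemma syndrome_of_pivots z : syndrome D (of_pivots z) = z.
Proof.
rewrite syndrome_sum; apply/ffunP => i; rewrite sum_bitsE -[RHS](sum_eqb z i).
by apply: eq_bigr => i' _; rewrite syndrome_delta (pivot_io pD).
Qed.

Lemma of_pivots_pivot z j : of_pivots z j -> exists i, p i = j.
Proof.
case: (pickP (fun i => p i == j)) => [i /eqP <- _|np]; first by exists i.
by rewrite sum_bitsE big1 // => i _; rewrite delta_eq eq_sym.
Qed.

Lemma quad_pivots (w : bits n) : (forall j, w j -> exists i, p i = j) -> quad R D w = 1.
Proof.
move=> wp; rewrite /quad !big1 ?mulr1 // => j _.
  rewrite big1 // => j' _; case wj: (w j); rewrite ?andbF //=.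
  by have [i <-] := wp _ wj; case wj': (w j'); rewrite ?andbF //; have [i' <-] := wp _ wj'; rewrite (pivot_oo pD).
by case wj: (w j); rewrite ?expr0 //; have [i <-] := wp _ wj; rewrite (pivot_phase pD) /iq expr0 expr1n.
Qed.

(** A kernel vector of the input-output matrix whose last nonzero entry is [j]. *)
Definition kernel_vec (j : 'I_n) : bits n := delta j + \sum_(i | io D i j) delta (p i).

Lemma syndrome_kernel_vec j : syndrome D (kernel_vec j) = 0.
Proof.
rewrite syndromeD syndrome_sum; apply/ffunP => i; rewrite bitsD bits0 syndrome_delta sum_bitsE.
rewrite (eq_bigr (fun i' => i == i')) => [|i' _]; first by rewrite sum_eqb addbb.
by rewrite syndrome_delta (pivot_io pD).
Qed.

Lemma kernel_vec_top j : (forall i, p i != j) -> kernel_vec j j.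
Proof.
move=> np; rewrite bitsD delta_eq eqxx sum_bitsE big1 // => i _.
by rewrite delta_eq eq_sym (negPf (np i)).
Qed.

Lemma kernel_vec_gt (j l : 'I_n) : (j < l)%N -> kernel_vec j l = false.
Proof.
move=> jl; rewrite bitsD delta_eq sum_bitsE big1 ?addbF.
  by apply/negbTE; apply: contraL jl => /eqP ->; rewrite ltnn.
move=> i ij; rewrite delta_eq; apply: contraTF ij => /eqP lp.
by rewrite (pivot_lead pD) // -lp.
Qed.

End Pivoted.

Section Unique.
Variables (R : realType) (k n : nat).
Implicit Types (D : er_diagram k n) (p : 'I_k -> 'I_n).
Local Notation C := (complex R).

Definition same_code D D' := forall psi : state R n,
  image_of (codeword R D) psi <-> image_of (codeword R D') psi.

Lemma same_code_sym D D' : same_code D D' -> same_code D' D.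
Proof. by move=> h psi; apply: iff_sym. Qed.

(** The image of the basis state 0 vanishes nowhere on the support of [D], while no word of the
    other code is nonzero off the support of [D']. *)
Lemma same_support D D' y : base D -> base D' -> same_code D D' -> y = pt D y -> y = pt D' y.
Proof.
move=> bD bD' DD' /eqP yD.
have [phi phiE] : image_of (codeword R D') (apply (codeword R D) (basis_state R 0)).
  by apply/DD'; exists (basis_state R 0).
have := congr1 (fun psi : state R n => psi y) phiE; rewrite /= apply_basis apply_codeword.
case: (y =P pt D' y) => // _; rewrite !mul0r => /esym/eqP.
by rewrite (negPf (_ : codeword R D y 0 != 0)) // codeword_neq0.
Qed.

Lemma same_pt D D' u : base D -> base D' -> same_code D D' -> hd D =1 hd D' -> pt D u = pt D' u.
Proof.
move=> bD bD' DD' hh; rewrite (@same_support _ _ (pt D u) bD bD' DD'); last by rewrite (pt_pt bD).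
by apply: eq_pt => // j; rewrite -hh => /pt_free ->.
Qed.

(** By the Hadamard rule, bit t of a point in the support of [D] is a function of the bits above t.
    If [t] were free in [D'], the points generated by 0 and by [delta t] would differ at t and agree
    above it, as no Hadamard output above t is joined to t. *)
Lemma hd_sub D D' t : base D -> base D' -> same_code D D' -> hd D t -> hd D' t.
Proof.
move=> bD bD' /same_code_sym DD' ht; apply/negPn/negP => ht'.
have inD u : pt D' u = pt D (pt D' u) by apply: (same_support bD' bD DD'); rewrite (pt_pt bD').
have gt (j : 'I_n) : (t < j)%N -> pt D' 0 j = pt D' (delta t) j.
  move=> tj; have jt : (j == t) = false by apply: contraTF tj => /eqP ->; rewrite ltnn.
  rewrite !ffunE jt; case: ifP => // hj; congr (_ (+) _); apply: eq_bigr => l _.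
  rewrite bits0 delta_eq; case: eqP => [->|//].
  by rewrite (oo_hd bD' hj tj).
have : pt D' 0 t = pt D' (delta t) t.
  rewrite [pt D' 0]inD [pt D' (delta t)]inD ffunE [RHS]ffunE ht; congr (_ (+) _).
  apply: eq_bigr => j _; have [tj|jt|/val_inj <-] := ltngtP t j; first by rewrite gt.
    by rewrite (oo_hd bD ht jt).
  by rewrite (oo_irr bD).
by rewrite !pt_free // bits0 delta_eq eqxx.
Qed.

Lemma same_hd D D' : base D -> base D' -> same_code D D' -> hd D =1 hd D'.
Proof.
move=> bD bD' DD' t; apply/idP/idP; first exact: hd_sub.
by apply: hd_sub => //; apply: same_code_sym.
Qed.

(** If bit i of the [D'] syndromes differed, an input |0> + |e_i> or |0> - |e_i> would have an image
    that is nonzero over u and zero over v. In the code of [D] the values over u and v have a common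
    Fourier factor, so they vanish together. *)
Lemma same_fibers D D' u v : base D -> base D' -> same_code D D' ->
  syndrome D u = syndrome D v -> syndrome D' u = syndrome D' v.
Proof.
move=> bD bD' DD' uv; have ptE w := same_pt w bD bD' DD' (same_hd bD bD' DD').
apply/ffunP => i; apply/eqP/negPn/negP => neq.
pose phi' : state R k := [ffun x : bits k => (x == 0)%:R + sgn R (syndrome D' u i) * (x == delta i)%:R].
have sumE w : \sum_x character R x (syndrome D' w) * phi' x =
    1 + sgn R (syndrome D' u i) * sgn R (syndrome D' w i).
  under eq_bigr => x _ do rewrite ffunE mulrDr [X in X + _]mulrC mulrCA [X in _ + _ * X]mulrC.
  by rewrite big_split /= -mulr_sumr !sum_delta character0l character_delta.
have [phi phiE] : image_of (codeword R D) (apply (codeword R D') phi').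
  by apply/DD'; exists phi'.
have val w : quad R D w * (\sum_x character R x (syndrome D w) * phi x) =
    quad R D' w * (1 + sgn R (syndrome D' u i) * sgn R (syndrome D' w i)).
  by rewrite -sumE -!apply_codeword_pt // phiE ptE.
have := val u; have := val v; rewrite uv; set S := \sum_x _.
have -> : sgn R (syndrome D' u i) * sgn R (syndrome D' v i) = -1.
  rewrite -sgnD /sgn; case: (syndrome D' u i) (syndrome D' v i) neq => [] [] //=; by rewrite expr1.
rewrite subrr mulr0 => /eqP; rewrite mulf_eq0 (negPf (quad_neq0 _ _ _)) /= => /eqP ->.
rewrite mulr0 sgn2 => /esym/eqP; rewrite mulf_eq0 (negPf (quad_neq0 _ _ _)) /=.
by rewrite -mulr2n pnatr_eq0.
Qed.

(** A position is a non-pivot of [D] exactly when a kernel vector ends there, and the kernels of the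
    two syndromes agree. Row i' of [D'] starts at [p' i'], so it would pair to 1 with a kernel
    vector ending at that position. *)
Lemma pivot_sub D D' p p' i' : pivoted D p -> pivoted D' p' -> same_code D D' ->
  exists i, p i = p' i'.
Proof.
move=> pD pD' DD'; have bD := pivoted_base pD; have bD' := pivoted_base pD'.
case: (pickP (fun i => p i == p' i')) => [i /eqP <-|np]; first by exists i.
have np' i : p i != p' i' by rewrite np.
have : syndrome D' (kernel_vec D p (p' i')) i' = false.
  rewrite (@same_fibers _ _ _ 0 bD bD' DD') ?syndrome0 ?bits0 //.
  exact: syndrome_kernel_vec.
rewrite ffunE (bigD1 (p' i')) //= (pivot_io pD') eqxx (kernel_vec_top _ np') big1 //.
move=> j jp; have [lt|gt|/val_inj e] := ltngtP j (p' i').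
- by rewrite (pivot_lead pD').
- by rewrite (kernel_vec_gt pD) // andbF.
- by rewrite e eqxx in jp.
Qed.

(** The ratio of the two forms depends only on the syndrome, and each syndrome is attained on a
    vector supported on the common pivots, where both forms are 1. *)
Lemma same_quad D D' p p' u : pivoted D p -> pivoted D' p' -> same_code D D' ->
  quad R D u = quad R D' u.
Proof.
move=> pD pD' DD'; have bD := pivoted_base pD; have bD' := pivoted_base pD'.
have ptE w := same_pt w bD bD' DD' (same_hd bD bD' DD').
have [phi phiE] : image_of (codeword R D') (apply (codeword R D) (basis_state R 0)).
  by apply/DD'; exists (basis_state R 0).
have val w : quad R D w = quad R D' w * \sum_x character R x (syndrome D' w) * phi x.
  rewrite -apply_codeword_pt // phiE -ptE apply_basis (codeword_pt R bD).
  by rewrite character0l mul1r.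
pose w := of_pivots p (syndrome D u).
have wp j : w j -> exists i, p i = j by apply: of_pivots_pivot.
have := val w; rewrite (quad_pivots R pD wp) (quad_pivots R pD') => [|j /wp[i <-]]; last first.
  exact: (pivot_sub i pD' pD (same_code_sym DD')).
rewrite mul1r (same_fibers bD bD' DD' (syndrome_of_pivots pD (syndrome D u))).
by move=> e; rewrite val -e mulr1.
Qed.

(** Every datum is read off a test vector: input edges off kernel vectors, data at Hadamard outputs
    off [pt] at 0 and at unit vectors, the other phases and edges off [quad] at unit vectors and at
    sums of two. The permutation [s] matches inputs with equal pivots. *)
Lemma kls_unique D D' p p' : pivoted D p -> pivoted D' p' -> same_code D D' ->
  exists s : {perm 'I_k}, [/\ forall i, p' (s i) = p i,
    forall i j, er_io D' (s i, j) = er_io D (i, j), er_oo D' = er_oo D,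
    er_out_phase D' = er_out_phase D & er_gates D' = er_gates D].
Proof.
move=> pD pD' DD'; have bD := pivoted_base pD; have bD' := pivoted_base pD'.
have hh := same_hd bD bD' DD'; have ptE w := same_pt w bD bD' DD' hh.
have ex i : exists i', p' i' == p i.
  by have [i' <-] := pivot_sub i pD' pD (same_code_sym DD'); exists i'.
have sE i : p' (xchoose (ex i)) = p i by apply/eqP/(xchooseP (ex i)).
have s_inj : injective (fun i => xchoose (ex i)).
  by move=> i i' e; apply: (pivot_inj pD); rewrite -!sE e.
pose s := perm s_inj; have {}sE i : p' (s i) = p i by rewrite permE.
have optE (a b : option bool) : a <> Some false -> b <> Some false -> isSome a = isSome b -> a = b.
  by case: a b => [[]|] [[]|].
have ioE i j : io D' (s i) j = io D i j.
  case: (pickP (fun i => p i == j)) => [i0 /eqP <-|np].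
    by rewrite (pivot_io pD) -sE (pivot_io pD') (inj_eq perm_inj).
  have : syndrome D' (kernel_vec D p j) (s i) = false.
    rewrite (@same_fibers _ _ _ 0 bD bD' DD') ?syndrome0 ?bits0 //.
    exact: syndrome_kernel_vec.
  rewrite syndromeD syndrome_sum bitsD syndrome_delta sum_bitsE.
  rewrite (eq_bigr (fun i' => i == i')) ?sum_eqb => [|i' _]; last first.
    by rewrite syndrome_delta -sE (pivot_io pD') (inj_eq perm_inj).
  by case: (io D' _ _) (io D _ _) => [] [].
have qE j : q D' j = q D j.
  have [hj|hj] := boolP (hd D j); last first.
    by apply: (@iq_inj R); rewrite -!quad_delta -?hh // (same_quad _ pD pD' DD').
  have : (q D' j != 0) = (q D j != 0).
    have := congr1 (fun v : bits n => v j) (ptE 0); rewrite !ffunE -hh hj.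
    by rewrite /par !big1 // => l _; rewrite bits0 andbF.
  have hj' : hd D' j by rewrite -hh.
  by case: (q_hd bD' hj') (q_hd bD hj) => -> [] ->.
have oo_hdE j j' : hd D j -> oo D' j j' = oo D j j'.
  move=> hj; have [hj'|hj'] := boolP (hd D j'); first by rewrite (oo_hd2 bD) // (oo_hd2 bD') -?hh.
  have := congr1 (fun v : bits n => v j) (ptE (delta j')); rewrite !ffunE -hh hj -/(q _ _) qE => /addIb.
  have pard E : par E (delta j') j = oo E j j'.
    rewrite /par (bigD1 j') //= delta_eq eqxx andbT big1 ?addbF // => l /negPf lj'.
    by rewrite delta_eq lj' andbF.
  by rewrite !pard.
have ooE j j' : oo D' j j' = oo D j j'.
  have [hj|hj] := boolP (hd D j); first exact: oo_hdE.
  have [hj'|hj'] := boolP (hd D j'); first by rewrite (oo_sym bD') (oo_sym bD) oo_hdE.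
  have [->|jj'] := eqVneq j j'; first by rewrite (oo_irr bD) (oo_irr bD').
  have := same_quad (delta j + delta j') pD pD' DD'.
  rewrite (quad_delta2 R bD) // (quad_delta2 R bD') -?hh // !(same_quad _ pD pD' DD').
  move/(mulfI (mulf_neq0 (quad_neq0 _ _ _) (quad_neq0 _ _ _))).
  have neq := sgn_true_neq1 R.
  by case: (oo D j j') (oo D' j j') => [] [] // /eqP; rewrite ?neq // eq_sym neq.
exists s; split=> //.
- move=> i j; apply: optE; [exact: base_io|exact: base_io|exact: ioE].
- apply/ffunP => -[j j']; apply: optE; [exact: base_oo|exact: base_oo|exact: ooE].
- by apply/ffunP => j; apply: qE.
- by apply/ffunP => j; rewrite (gatesE bD) (gatesE bD') hh.
Qed.

End Unique.

(** * Existence of the KLS form *)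

Lemma bitsDC n (u v : bits n) : u + v = 0 -> u = v.
Proof. by move=> e; rewrite -[u]addr0 -(bitsDD v) addrA e add0r. Qed.

Lemma sum_in_closed (T : zmodType) (W : pred T) (I : Type) (r : seq I) (P : pred I) (F : I -> T) :
  W 0 -> (forall u v, W u -> W v -> W (u + v)) -> (forall i, P i -> W (F i)) ->
  W (\sum_(i <- r | P i) F i).
Proof. by move=> W0 WD WF; elim/big_ind: _. Qed.

(** * Gaussian elimination over F_2 for a chosen ranking of the coordinates *)

Section Echelon.
Variables (n : nat) (rk : 'I_n -> nat) (W : {set bits n}).
Hypothesis rk_inj : injective rk.
Hypothesis W0 : 0 \in W.
Hypothesis WD : forall u v, u \in W -> v \in W -> u + v \in W.

Definition leads (w : bits n) (t : 'I_n) : bool :=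
  w t && [forall j, (rk t < rk j)%N ==> ~~ w j].

Definition lead_set : {set 'I_n} := [set t | [exists w in W, leads w t]].

Definition reduced (t : 'I_n) (w : bits n) : bool :=
  [&& w \in W, leads w t & [forall t' in lead_set, (t' != t) ==> ~~ w t']].

Definition echelon (t : 'I_n) : bits n := odflt 0 [pick w | reduced t w].

Lemma leads_ex w : w != 0 -> exists t, leads w t.
Proof.
move=> w0; have [t0 wt0] : exists t, w t.
  apply/existsP; apply: contraNT w0; rewrite negb_exists => /forallP w0.
  by apply/eqP/ffunP => j; rewrite bits0; apply/negbTE.
case: (arg_maxnP rk wt0) => t wt max; exists t; rewrite /leads wt /=.
by apply/forallP => j; apply/implyP => lt; apply/negP => /max; rewrite /geq /= leqNgt lt.
Qed.

(** Strong induction on the rank: to any vector led by [t], add the reduced vectors of the lower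
    leads at which it is nonzero. They vanish from rank [rk t] upwards and do not disturb its
    lead. *)
Lemma echelonP t : t \in lead_set -> reduced t (echelon t).
Proof.
have [N] := ubnP (rk t); elim: N t => // N IH t ltN tP.
suff [w rw] : exists w, reduced t w.
  by rewrite /echelon; case: pickP => [//|/(_ w)]; rewrite rw.
have := tP; rewrite inE => /existsP[w /andP[wW lw]].
have lt_rk t' : t' != t -> w t' -> (rk t' < rk t)%N.
  move=> neq wt'; case/andP: lw => _ /forallP /(_ t') /implyP h.
  case: ltngtP => // [/h|/rk_inj e]; first by rewrite wt'.
  by rewrite e eqxx in neq.
pose P t' := [&& t' \in lead_set, t' != t & w t'].
have red t' : P t' -> reduced t' (echelon t').
  by case/and3P=> h1 h2 h3; apply: IH => //; apply: leq_trans (lt_rk _ h2 h3) _.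
exists (w + \sum_(t' | P t') echelon t'); apply/and3P; split.
- apply: WD => //; apply: (@sum_in_closed _ (mem W)) => // t' /red /and3P[] //.
- have zero j : (rk t <= rk j)%N -> (\sum_(t' | P t') echelon t') j = false.
    move=> le; rewrite sum_bitsE big1 // => t' Pt'; have /and3P[_ /andP[_ /forallP/(_ j)/implyP h] _] := red _ Pt'.
    by apply/negbTE/h; apply: leq_trans le; case/and3P: Pt' => _; apply: lt_rk.
  apply/andP; split; first by rewrite bitsD zero // addbF; case/andP: lw.
  apply/forallP => j; apply/implyP => lt; rewrite bitsD zero 1?ltnW // addbF.
  by case/andP: lw => _ /forallP/(_ j)/implyP/(_ lt).
- apply/forall_inP => t' t'P; apply/implyP => neq; rewrite bitsD sum_bitsE.
  rewrite (eq_bigr (fun i => t' == i)) => [|i Pi].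
    by rewrite sum_eqb /P t'P neq /=; case: (w t').
  have /and3P[_ /andP[ii _] /forall_inP/(_ t' t'P)/implyP h] := red _ Pi.
  by case: eqP => [->//|/eqP/h/negbTE].
Qed.

Lemma echelon_in t : t \in lead_set -> echelon t \in W.
Proof. by move=> /echelonP/and3P[]. Qed.

Lemma echelon_lead_set t t' : t \in lead_set -> t' \in lead_set -> echelon t t' = (t' == t).
Proof.
move=> /echelonP/and3P[_ /andP[ett _] /forall_inP h] /h /implyP.
by case: eqP => [->//|_ /(_ isT) /negbTE].
Qed.

Lemma echelon_gt t j : t \in lead_set -> (rk t < rk j)%N -> echelon t j = false.
Proof. by move=> /echelonP/and3P[_ /andP[_ /forallP/(_ j)/implyP h] _] /h /negbTE. Qed.

Lemma lead_set_eq0 w : w \in W -> (forall t, t \in lead_set -> w t = false) -> w = 0.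
Proof.
move=> wW h; apply/eqP/negPn/negP => /leads_ex[t lt].
have tP : t \in lead_set by rewrite inE; apply/existsP; exists w; rewrite wW.
by have := h _ tP; case/andP: lt => ->.
Qed.

End Echelon.

(** * Pauli operators as Weyl operators *)

Section Pauli.
Variables (R : realType) (n : nat).
Local Notation C := (complex R).
Local Notation imag := (Complex 0 1 : C).

Definition dot (b y : bits n) : bool := \big[addb/false]_j (b j && y j).

(** The Weyl operator c Z^b X^a. *)
Definition weyl (c : C) (a b : bits n) (psi : state R n) : state R n :=
  [ffun y => c * sgn R (dot b y) * psi (y + a)].

Definition xpart (P : pauli n) : bits n :=
  [ffun j => if pauli_at P j is (PauliX | PauliY) then true else false].
Definition zpart (P : pauli n) : bits n :=
  [ffun j => if pauli_at P j is (PauliY | PauliZ) then true else false].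

Lemma dotDr b u v : dot b (u + v) = dot b u (+) dot b v.
Proof.
by rewrite /dot -big_split; apply: eq_bigr => j _; rewrite bitsD andb_addr.
Qed.

Lemma dotDl b c v : dot (b + c) v = dot b v (+) dot c v.
Proof.
by rewrite /dot -big_split; apply: eq_bigr => j _; rewrite bitsD andb_addl.
Qed.

Lemma dot0l v : dot 0 v = false.
Proof. by rewrite /dot big1 // => j _; rewrite bits0. Qed.

Lemma weylM c a b c' a' b' psi :
  weyl c a b (weyl c' a' b' psi) = weyl (c * c' * sgn R (dot b' a)) (a + a') (b + b') psi.
Proof.
apply/ffunP => y; rewrite !ffunE -addrA dotDr dotDl !sgnD; ring.
Qed.

Lemma weyl1 psi : weyl 1 0 0 psi = psi.
Proof. by apply/ffunP => y; rewrite ffunE dot0l /sgn expr0 !mul1r addr0. Qed.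

Lemma pauli_op_weyl (P : pauli n) :
  exists c, forall psi : state R n, pauli_op P psi = weyl c (xpart P) (zpart P) psi.
Proof.
(* Y = -i Z X; the other Pauli matrices need no factor. *)
pose w (Q : pauli1) : C := if Q is PauliY then - imag else 1.
pose xq (Q : pauli1) := if Q is (PauliX | PauliY) then true else false.
pose zq (Q : pauli1) := if Q is (PauliY | PauliZ) then true else false.
have entry Q (y x : bool) : pauli1_mx R Q (ix y) (ix x) =
    (x == (y (+) xq Q))%:R * (w Q * sgn R (zq Q && y)).
  case: Q; case: y; case: x; rewrite /= mx2E /= /sgn ?expr0 ?expr1 ?mul0r ?mul1r ?mulr1 //.
  by rewrite mulrN1 opprK.
exists ((-1) ^+ pauli_sign P * \prod_j w (pauli_at P j)) => psi.
apply/ffunP => y; rewrite !ffunE.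
have -> : sgn R (dot (zpart P) y) = \prod_j sgn R (zq (pauli_at P j) && y j).
  rewrite -[LHS](prod_sgn_and R true (fun j => zpart P j && y j)).
  by apply: eq_bigr => j _; rewrite /= ffunE.
rewrite -!mulrA [_ * (_ * psi _)]mulrA -big_split.
rewrite -(sum_delta (y + xpart P) (fun x => (-1) ^+ pauli_sign P *
  ((\prod_j (w (pauli_at P j) * sgn R (zq (pauli_at P j) && y j))) * psi x))).
apply: eq_bigr => x _; rewrite (eq_bigr _ (fun j _ => entry (pauli_at P j) (y j) (x j))).
rewrite big_split prod_natb (_ : [forall j, _] = (x == y + xpart P)).
  by rewrite /= -!mulrA mulrCA.
by apply/eqfunP/eqP => [e|-> j]; [apply/ffunP => j; rewrite bitsD ffunE e|rewrite bitsD ffunE].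
Qed.

End Pauli.

Lemma enum_val_lt n (A : {set 'I_n}) (i j : 'I_#|A|) : (i < j)%N -> (enum_val i < enum_val j)%N.
Proof.
move=> ij; have x0 := enum_val i.
have srt : sorted (fun a b : 'I_n => (a < b)%N) (enum A).
  rewrite /enum_mem -enumT; apply: (sorted_filter (leT := fun a b : 'I_n => (a < b)%N)).
    by move=> a b c; apply: ltn_trans.
  by have := iota_ltn_sorted 0 n; rewrite -val_enum_ord sorted_map.
rewrite !(enum_val_nth x0).
apply: (@sorted_ltn_nth _ (fun a b : 'I_n => (a < b)%N)) => //; rewrite ?inE -?cardE ?ltn_ord //.
by move=> a b c; apply: ltn_trans.
Qed.

(** * The stabilizer group acting on a nonzero codeword *)

Section Existence.
Variables (R : realType) (k n : nat) (K : clifford_code R k n).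
Local Notation C := (complex R).
Local Notation imag := (Complex 0 1 : C).
Variable psi0 : state R n.
Hypothesis psi0K : codespace K psi0.
Hypothesis psi0_neq0 : psi0 != 0.

Definition fixes (c : C) (a b : bits n) : Prop :=
  forall psi, codespace K psi -> weyl c a b psi = psi.

Lemma fixesM c a b c' a' b' : fixes c a b -> fixes c' a' b' ->
  fixes (c * c' * sgn R (dot b' a)) (a + a') (b + b').
Proof. by move=> h h' psi psiK; rewrite -weylM h' // h. Qed.

Lemma psi0_ex : exists y, psi0 y != 0.
Proof.
apply/existsP; apply: contraNT psi0_neq0; rewrite negb_exists => /forallP h.
by apply/eqP/ffunP => y; rewrite ffunE; apply/eqP/negPn/h.
Qed.

(** Scalars can be compared at a position where [psi0] does not vanish. *)
Lemma fixes_unique c c' a b : fixes c a b -> fixes c' a b -> c = c'.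
Proof.
move=> h h'; have [y y0] := psi0_ex.
have := h _ psi0K; have := h' _ psi0K => /ffunP/(_ y) e' /ffunP/(_ y) e.
move: e e'; rewrite !ffunE -!mulrA => e e'.
have X0 : sgn R (dot b y) * psi0 (y + a) != 0.
  by apply: contraNneq y0 => X; rewrite -e X mulr0.
by apply: (mulIf X0); rewrite e e'.
Qed.

Lemma fixes_neq0 c a b : fixes c a b -> c != 0.
Proof.
move=> h; have [y y0] := psi0_ex; have /ffunP/(_ y) := h _ psi0K; rewrite ffunE => e.
by apply: contraNneq y0 => c0; rewrite -e c0 !mul0r.
Qed.

(** The two orders of composition fix the codespace with the same X- and Z-parts, so by
    [fixes_unique] their signs agree. *)
Lemma fixes_commute c a b c' a' b' : fixes c a b -> fixes c' a' b' -> dot b' a = dot b a'.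
Proof.
move=> h h'; have := fixesM h h'; rewrite [c * c']mulrC [a + _]addrC [b + _]addrC.
have := fixesM h' h => e e'; have := fixes_unique e e'.
have cc0 : c' * c != 0 by rewrite mulf_neq0 ?(fixes_neq0 h) ?(fixes_neq0 h').
move/(mulfI cc0); have neq := sgn_true_neq1 R.
by case: (dot b a') (dot b' a) => [] [] // /eqP; rewrite ?neq // eq_sym neq.
Qed.

(** The square of a Weyl operator is a scalar, which must be 1. *)
Lemma fixes_sqr c a b : fixes c a b -> c * c = sgn R (dot b a).
Proof.
move=> h; have := fixesM h h; rewrite !bitsDD => e.
have e1 : fixes 1 0 0 by move=> psi _; apply: weyl1.
have := fixes_unique e e1 => ee; rewrite -[LHS]mulr1 -(sgn2 R (dot b a)) mulrA ee mul1r //.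
Qed.

Definition gen (a : 'I_(n - k)) : bits n * bits n := (xpart (stab K a), zpart (stab K a)).
Definition span (c : bits (n - k)) : bits n * bits n := \sum_(a | c a) gen a.

Lemma fixes_span c : exists z, fixes z (span c).1 (span c).2.
Proof.
rewrite /span; elim/big_ind: _ => [|u v [z hz] [z' hz']|a _].
- by exists 1 => psi _; apply: weyl1.
- by eexists; apply: (fixesM hz hz').
- by have [z hz] := pauli_op_weyl R (stab K a); exists z => psi psiK; rewrite -hz psiK.
Qed.

Lemma spanD c c' : span (c + c') = span c + span c'.
Proof.
rewrite /span !(big_mkcond (fun a => fun_of_fin _ a)) -big_split; apply: eq_bigr => a _ /=.
rewrite bitsD; case: (c a) (c' a) => [] [] /=; rewrite ?addr0 ?add0r //.
by apply/esym/eqP; rewrite xpair_eqE /= !bitsDD !eqxx.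
Qed.

(** A product of generators with trivial X- and Z-part is a multiple of the identity, which
    [stab_indep] excludes for nonempty products. *)
Lemma span_eq0 c : span c = 0 -> c = 0.
Proof.
move=> c0; apply/eqP/negPn/negP => cneq.
pose A := [set a | c a].
have [z hz] : exists z : C, forall psi : state R n, pauli_prod (stab K) A psi = weyl z (span c).1 (span c).2 psi.
  rewrite /pauli_prod /span (eq_bigl (fun a => c a)) => [|a]; last by rewrite inE.
  apply: (big_rec2 (fun f v => exists z : C, forall psi : state R n, f psi = weyl z v.1 v.2 psi)).
    by exists 1 => psi; rewrite weyl1.
  move=> a f v _ [z hz].
  have [z' hz'] := pauli_op_weyl R (stab K a).
  by eexists => psi /=; rewrite hz hz' weylM.
have A0 : A != set0.
  have [a ca] : exists a, c a.
    apply/existsP; apply: contraNT cneq; rewrite negb_exists => /forallP h.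
    by apply/eqP/ffunP => a; rewrite bits0; apply/negbTE.
  by apply/set0Pn; exists a; rewrite inE.
apply: (@stab_indep _ _ _ K A A0 z) => psi y.
by rewrite hz c0 /= ffunE dot0l /sgn expr0 mulr1 addr0.
Qed.

(** The stabilizer group without its scalars, which are recovered by [fixes_unique]. *)
Definition group_set : {set bits n * bits n} := [set span c | c in {: bits (n - k)}].

Lemma group_fixes v : v \in group_set -> exists z, fixes z v.1 v.2.
Proof. by case/imsetP => c _ ->; apply: fixes_span. Qed.

Lemma group_setD u v : u \in group_set -> v \in group_set -> u + v \in group_set.
Proof. by case/imsetP=> c _ -> /imsetP[c' _ ->]; rewrite -spanD; apply: imset_f. Qed.

Lemma group_set0 : 0 \in group_set.
Proof.
have -> : 0 = span 0 by rewrite /span big1 // => a; rewrite bits0.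
exact: imset_f.
Qed.

Lemma card_group_set : #|group_set| = (2 ^ (n - k))%N.
Proof.
rewrite card_imset ?card_ffun ?card_bool ?card_ord // => c c' e.
by apply: bitsDC; apply: span_eq0; rewrite spanD e; apply/eqP; rewrite xpair_eqE /= !bitsDD !eqxx.
Qed.

Lemma group_dot u v : u \in group_set -> v \in group_set -> dot v.2 u.1 = dot u.2 v.1.
Proof. by move=> /group_fixes[c h] /group_fixes[c' h']; apply: fixes_commute h h'. Qed.

(** * Hadamard outputs, free non-pivots and pivots from the stabilizer group *)

Definition zset : {set bits n} := [set b | (0, b) \in group_set].
Definition xset : {set bits n} := [set v.1 | v in group_set].

Lemma zset0 : 0 \in zset. Proof. by rewrite inE; exact: group_set0. Qed.
Lemma pairD (a b c d : bits n) : (a, b) + (c, d) = (a + c, b + d).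
Proof. by []. Qed.

Lemma zsetD u v : u \in zset -> v \in zset -> u + v \in zset.
Proof. by rewrite !inE => h h'; have := group_setD h h'; rewrite pairD addr0. Qed.

Lemma xset0 : 0 \in xset.
Proof. by apply/imsetP; exists 0 => //; apply: group_set0. Qed.
Lemma xsetD u v : u \in xset -> v \in xset -> u + v \in xset.
Proof.
case/imsetP=> a ha -> /imsetP[b hb ->]; apply/imsetP; exists (a + b) => //.
exact: group_setD.
Qed.

(** The ranking is reversed so that a Z-type element leads at its first position; its other
    positions, the future neighbours of a Hadamard output, then come later, as the Hadamard rule
    asks. *)
Definition rkz (j : 'I_n) : nat := (n - j)%N.
Lemma rkz_inj : injective rkz.
Proof. move=> i j /eqP; rewrite /rkz => e; apply: val_inj => /=; have := ltn_ord i; have := ltn_ord j; lia. Qed.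

Definition tset : {set 'I_n} := lead_set rkz zset.
Definition zrow := echelon rkz zset.

(** Positions in [tset] rank below all others. An X-part thus leads at its last position outside
    [tset], and the pivots it involves come earlier, which makes each pivot the first entry of its
    row. *)
Definition rkx (j : 'I_n) : nat := if j \in tset then j : nat else (n + j)%N.
Lemma rkx_inj : injective rkx.
Proof.
move=> i j; rewrite /rkx => e; apply: val_inj => /=; have := ltn_ord i; have := ltn_ord j.
move: e; do 2!case: ifP => _; lia.
Qed.

Definition nset : {set 'I_n} := lead_set rkx xset.
Definition xrow := echelon rkx xset.

Lemma zrow_in t : t \in tset -> zrow t \in zset.
Proof. exact: echelon_in rkz_inj zset0 zsetD _. Qed.
Lemma zrow_t t t' : t \in tset -> t' \in tset -> zrow t t' = (t' == t).
Proof. exact: echelon_lead_set rkz_inj zset0 zsetD _ _. Qed.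
Lemma zrow_lt t (j : 'I_n) : t \in tset -> (j < t)%N -> zrow t j = false.
Proof.
move=> tT lt; apply: (echelon_gt rkz_inj zset0 zsetD tT).
by rewrite /rkz; have := ltn_ord t; lia.
Qed.
Lemma zset_eq0 b : b \in zset -> (forall t, t \in tset -> b t = false) -> b = 0.
Proof. exact: lead_set_eq0. Qed.

Lemma xset_orth a b : a \in xset -> b \in zset -> dot b a = false.
Proof.
case/imsetP=> u uG ->; rewrite inE => bG; have := group_dot uG bG => /= ->.
by rewrite /dot big1 // => j _; rewrite bits0 andbF.
Qed.

(** An X-part supported on [tset] would anticommute with some [zrow]. *)
Lemma xset_free_eq0 a : a \in xset -> (forall j, j \notin tset -> a j = false) -> a = 0.
Proof.
move=> aX a0; apply/ffunP => t; rewrite bits0; have [tT|/a0 //] := boolP (t \in tset).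
have := xset_orth aX (zrow_in tT); rewrite /dot (bigD1 t) //= zrow_t // eqxx /= big1 ?addbF //.
move=> j jt; have [jT|/a0 ->] := boolP (j \in tset); last by rewrite andbF.
by rewrite zrow_t // (negPf jt).
Qed.

(** With the ranking [rkx], a lead inside [tset] would mean that the X-part is supported on
    [tset]. *)
Lemma nset_free j : j \in nset -> j \notin tset.
Proof.
rewrite inE => /existsP[w /andP[wX /andP[wj /forallP h]]]; apply/negP => jT.
have := xset_free_eq0 wX => w0; have := congr1 (fun w : bits n => w j) (w0 _); rewrite bits0 wj.
move=> H; suff: true = false by []; apply: H => l lT.
have /implyP := h l; rewrite /rkx jT (negPf lT) => /(_ _)/negbTE; apply.
by have := ltn_ord j; lia.
Qed.

Lemma xrow_in j : j \in nset -> xrow j \in xset.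
Proof. exact: echelon_in rkx_inj xset0 xsetD _. Qed.
Lemma xrow_n j j' : j \in nset -> j' \in nset -> xrow j j' = (j' == j).
Proof. exact: echelon_lead_set rkx_inj xset0 xsetD _ _. Qed.
Lemma xrow_gt j (l : 'I_n) : j \in nset -> l \notin tset -> (j < l)%N -> xrow j l = false.
Proof.
move=> jN lT lt; apply: (echelon_gt rkx_inj xset0 xsetD jN).
by rewrite /rkx (negPf lT) (negPf (nset_free jN)); lia.
Qed.
Lemma xset_eq0 a : a \in xset -> (forall j, j \in nset -> a j = false) -> a = 0.
Proof. exact: lead_set_eq0. Qed.

(** A Z-part that accompanies [xrow j] in the group, normalized to vanish on [tset] by adding Z-type
    elements. The default is not met for j in [nset]. *)
Definition xrow_z (j : 'I_n) : bits n :=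
  odflt 0 [pick b | ((xrow j, b) \in group_set) && [forall t in tset, ~~ b t]].

Lemma xrow_zP j : j \in nset ->
  (xrow j, xrow_z j) \in group_set /\ forall t, t \in tset -> xrow_z j t = false.
Proof.
move=> jN; suff [b bG b0] : exists2 b, (xrow j, b) \in group_set & forall t, t \in tset -> b t = false.
  rewrite /xrow_z; case: pickP => [c /andP[cG /forall_inP c0]|/(_ b)].
    by split=> // t /c0/negbTE.
  by rewrite bG => /forall_inP[] t /b0 ->.
have /imsetP[[a b] abG /= ->] := xrow_in jN.
exists (b + \sum_(t in tset | b t) zrow t).
  have h : (0, \sum_(t in tset | b t) zrow t) \in group_set.
    suff : \sum_(t in tset | b t) zrow t \in zset by rewrite inE.
    apply: (@sum_in_closed _ (mem zset)) => [||t /andP[tT _]]; first exact: zset0.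
      exact: zsetD.
    exact: zrow_in.
  by have := group_setD abG h; rewrite pairD addr0.
move=> t tT; rewrite bitsD sum_bitsE (eq_bigr (fun i => t == i)) => [|i /andP[iT _]].
  by rewrite sum_eqb tT /= addbb.
by rewrite zrow_t.
Qed.

(** A group element is determined by its Z-part on [tset] and its X-part on [nset], and these can be
    prescribed freely; compare with the order 2^(n-k) of the group. *)
Lemma card_tset_nset : (#|tset| + #|nset|)%N = (n - k)%N.
Proof.
apply/eqP; rewrite -(eqn_exp2l (m := 2)) // expnD -card_group_set -!card_powerset -cardsX.
pose f (v : bits n * bits n) := ([set t in tset | v.2 t], [set j in nset | v.1 j]).
have mem_sep (A : {set 'I_n}) (g : bits n) l : l \in A -> (l \in [set t in A | g t]) = g l.
  by move=> lA; rewrite inE lA.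
rewrite -(card_in_imset (f := f)); last first.
  move=> u v uG vG [/setP e2 /setP e1].
  have uv := group_setD uG vG.
  have d1 : u.1 + v.1 = 0.
    apply: xset_eq0 => [|j jN]; first by apply/imsetP; exists (u + v).
    by have := e1 j; rewrite !mem_sep // bitsD => ->; rewrite addbb.
  have d2 : u.2 + v.2 = 0.
    apply: zset_eq0 => [|t tT]; first by rewrite inE -d1.
    by have := e2 t; rewrite !mem_sep // bitsD => ->; rewrite addbb.
  by case: (u) (v) d1 d2 => [a b] [c d] /= /bitsDC -> /bitsDC ->.
apply/eqP/eq_card => -[P Q]; rewrite inE /= !powersetE; apply/idP/imsetP; last first.
  case=> v _ [-> ->]; apply/andP; split; apply/subsetP => j; rewrite inE; by case/andP.
case/andP => PT QN.
(* As each [xrow_z j] vanishes on [tset], the two prescriptions do not interfere. *)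
exists (\sum_(j in Q) (xrow j, xrow_z j) + \sum_(t in P) (0, zrow t)).
  apply: group_setD; apply: (@sum_in_closed _ (mem group_set));
    do ?[exact: group_set0|exact: group_setD].
    by move=> j /(subsetP QN) /xrow_zP[].
  by move=> t /(subsetP PT) /zrow_in; rewrite inE.
have -> : \sum_(j in Q) (xrow j, xrow_z j) + \sum_(t in P) (0, zrow t) =
    (\sum_(j in Q) xrow j, \sum_(j in Q) xrow_z j + \sum_(t in P) zrow t).
  have pair_sum (I : finType) (A : pred I) (F G : I -> bits n) :
      \sum_(i | A i) (F i, G i) = (\sum_(i | A i) F i, \sum_(i | A i) G i).
    by elim/big_rec3: _ => // i a b _ _ ->; rewrite pairD.
  by rewrite !pair_sum pairD big1_eq addr0.
congr pair; apply/setP => j; rewrite inE /=.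
  have [jT|jT] := boolP (j \in tset); last by apply: contraNF jT; apply: (subsetP PT).
  rewrite bitsD !sum_bitsE big1 ?addFb => [|l /(subsetP QN)/xrow_zP[_ ->] //].
  rewrite (eq_bigr (fun i => j == i)) => [|i /(subsetP PT) iT]; last by rewrite zrow_t.
  by rewrite sum_eqb.
have [jN|jN] := boolP (j \in nset); last by apply: contraNF jN; apply: (subsetP QN).
rewrite sum_bitsE (eq_bigr (fun i => j == i)) => [|i /(subsetP QN) iN]; last by rewrite xrow_n.
by rewrite sum_eqb.
Qed.

Definition pset : {set 'I_n} := ~: (tset :|: nset).

Lemma card_pset : #|pset| = k.
Proof.
have := cardsC (tset :|: nset); rewrite cardsU (_ : tset :&: nset = set0); last first.
  by apply/setP => j; rewrite in_setI in_set0; apply/negbTE/andP => -[jT /nset_free]; rewrite jT.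
rewrite cards0 subn0 card_tset_nset card_ord -/pset; have := code_le K; lia.
Qed.

Definition piv (i : 'I_k) : 'I_n := enum_val (cast_ord (esym card_pset) i).

Lemma piv_lt (i i' : 'I_k) : (i < i')%N -> (piv i < piv i')%N.
Proof. by move=> ii'; apply: enum_val_lt. Qed.

Lemma piv_inj : injective piv.
Proof. by move=> i i' /enum_val_inj/cast_ord_inj. Qed.

Lemma piv_in i : piv i \in pset. Proof. exact: enum_valP. Qed.
Lemma piv_t i : (piv i \in tset) = false.
Proof. by have := piv_in i; rewrite in_setC in_setU negb_or => /andP[/negbTE]. Qed.
Lemma piv_n i : (piv i \in nset) = false.
Proof. by have := piv_in i; rewrite in_setC in_setU negb_or => /andP[_ /negbTE]. Qed.

Lemma piv_surj l : l \notin tset -> l \notin nset -> exists i, l = piv i.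
Proof.
move=> lT lN; have lP : l \in pset by rewrite in_setC in_setU negb_or lT.
exists (cast_ord card_pset (enum_rank_in lP l)).
by rewrite /piv cast_ordK enum_rankK_in.
Qed.

Lemma sum_split (F : 'I_n -> bool) : (forall t, t \in tset -> F t = false) ->
  \big[addb/false]_l F l = \big[addb/false]_(l in nset) F l (+) \big[addb/false]_i F (piv i).
Proof.
move=> FT; rewrite (bigID (mem tset)) /= big1 ?addFb; last exact: FT.
rewrite (bigID (mem nset)) /=; congr (_ (+) _).
  by apply: eq_bigl => l; rewrite andbC; case: (boolP (l \in nset)) => // /nset_free ->.
rewrite (eq_bigl (mem pset)) => [|l]; last by rewrite /= /pset in_setC in_setU negb_or.
by rewrite big_enum_val (reindex (cast_ord (esym card_pset))) //=; exists (cast_ord card_pset) => i _;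
  rewrite ?cast_ordK ?cast_ordKV.
Qed.

(** On [nset] the reduced row [xrow j] is the unit vector at j, so beyond j only the pivots
    contribute. *)
Lemma sum_xrow (f : 'I_n -> bool) j : j \in nset -> (forall t, t \in tset -> f t = false) ->
  \big[addb/false]_l (f l && xrow j l) =
  f j (+) \big[addb/false]_i (f (piv i) && xrow j (piv i)).
Proof.
move=> jN fT; rewrite sum_split => [|t /fT ->//]; congr (_ (+) _).
rewrite (bigD1 j) //= xrow_n // eqxx andbT big1 ?addbF // => l /andP[lN lj].
by rewrite xrow_n // (negPf lj) andbF.
Qed.

Lemma dot_xrow l j : l \in nset -> j \in nset -> dot (xrow_z l) (xrow j) =
  xrow_z l j (+) \big[addb/false]_i (xrow_z l (piv i) && xrow j (piv i)).
Proof. by move=> lN jN; apply: sum_xrow => // t; apply: (xrow_zP lN).2. Qed.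

Lemma dot_xrow_sym l j : l \in nset -> j \in nset ->
  dot (xrow_z l) (xrow j) = dot (xrow_z j) (xrow l).
Proof.
by move=> /xrow_zP[lG _] /xrow_zP[jG _]; have := group_dot jG lG.
Qed.

(** A square root of 1 or -1 is a power of i, and the parity of the exponent tells which. *)
Lemma iq_ex (z : C) b : z * z = sgn R b -> exists2 a : 'Z_4, iq R a = z & odd a = b.
Proof.
move=> zz; suff [a az] : exists a : 'Z_4, iq R a = z.
  exists a => //; have := iq_sqr R a; rewrite az zz; have neq := sgn_true_neq1 R.
  by case: b {zz} (odd a) => [] [] // /eqP; rewrite ?neq // eq_sym neq.
case: b zz => zz.
  have : (z * imag) ^+ 2 == 1 by rewrite exprMn sqr_i expr2 zz /sgn mulrNN mulr1.
  have i4 : imag ^+ 4 = 1 by rewrite (exprM _ 2 2) sqr_i sqrrN expr1n.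
  have zE : z = z * imag * imag ^+ 3 by rewrite -mulrA -exprS i4 mulr1.
  rewrite sqrf_eq1 => /orP[]/eqP e.
    by exists (inord 3); rewrite /iq inordK // zE e mul1r.
  exists 1; rewrite zE e mulN1r (exprD imag 2 1) sqr_i mulN1r opprK //.
have : z ^+ 2 == 1 by rewrite expr2 zz.
rewrite sqrf_eq1 => /orP[]/eqP ->; first by exists 0; rewrite /iq expr0.
by exists 2%:R; rewrite /iq /= sqr_i.
Qed.

(** The part of [dot (xrow_z j) (xrow l)] that comes from the pivots. *)
Definition cross (j l : 'I_n) : bool :=
  \big[addb/false]_i (xrow_z j (piv i) && xrow l (piv i)).

Lemma zsign_ex : exists zs : 'I_n -> bool,
  forall t, t \in tset -> fixes (sgn R (zs t)) 0 (zrow t).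
Proof.
apply: (fin_all_exists (P := fun t b => t \in tset -> fixes (sgn R b) 0 (zrow t))) => t.
have [tT|tT] := boolP (t \in tset); last by exists false.
have := zrow_in tT; rewrite inE => /group_fixes[c hc].
have := fixes_sqr hc; rewrite /dot big1 => [|j _]; last by rewrite bits0 andbF.
rewrite [sgn R false]expr0 -expr2 => /eqP; rewrite sqrf_eq1 => /orP[]/eqP ce.
  by exists false => _; rewrite /sgn expr0 -ce.
by exists true => _; rewrite /sgn expr1 -ce.
Qed.

(** The phase is chosen so that the quadratic form of the diagram takes the value 1/c at [xrow j]
    ([quad_xrow]), where c is the scalar of the stabilizer. Its parity is dictated by c^2. *)
Lemma xphase_ex : exists qs : 'I_n -> 'Z_4, forall j, j \in nset ->
  [/\ exists2 c, fixes c (xrow j) (xrow_z j) & c * iq R (qs j) * sgn R (cross j j) = 1 &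
      odd (qs j) = dot (xrow_z j) (xrow j)].
Proof.
apply: (fin_all_exists (P := fun j (a : 'Z_4) => j \in nset ->
  [/\ exists2 c, fixes c (xrow j) (xrow_z j) & c * iq R a * sgn R (cross j j) = 1 &
      odd a = dot (xrow_z j) (xrow j)])) => j.
have [jN|jN] := boolP (j \in nset); last by exists 0.
have [/group_fixes[c hc] _] := xrow_zP jN.
have cc := fixes_sqr hc; have c0 := fixes_neq0 hc.
have [a aE odda] : exists2 a : 'Z_4, iq R a = c^-1 * sgn R (cross j j) & odd a = dot (xrow_z j) (xrow j).
  apply: iq_ex; rewrite mulrACA sgn2 mulr1 -invfM cc.
  by rewrite -[LHS]mulr1 -(sgn2 R (dot (xrow_z j) (xrow j))) mulKf // sgn_neq0.
exists a => _; split=> //; exists c => //.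
by rewrite aE mulrA divff // mul1r sgn2.
Qed.

(** * The diagram of the code and its amplitudes *)

Section Diagram.
Variables (zs : 'I_n -> bool) (qs : 'I_n -> 'Z_4).
Hypothesis zsP : forall t, t \in tset -> fixes (sgn R (zs t)) 0 (zrow t).
Hypothesis qsP : forall j, j \in nset ->
  [/\ exists2 c, fixes c (xrow j) (xrow_z j) & c * iq R (qs j) * sgn R (cross j j) = 1 &
      odd (qs j) = dot (xrow_z j) (xrow j)].

(** The identity on the pivot columns; the columns in [nset] are then forced by the requirement that
    each [xrow j] have syndrome 0. *)
Definition code_io (i : 'I_k) (j : 'I_n) : bool :=
  if j \in tset then false else if j \in nset then xrow j (piv i) else j == piv i.

(** The solution of [polar_xrow] for the edges: row l of the polar form, paired with [xrow j], must
    give bit l of [xrow_z j]. Since pivots are not joined to each other, an edge between a pivot and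
    a non-pivot is that bit itself; between two non-pivots the pivots contribute the correction
    [cross l j]. *)
Definition code_oo_free (l j : 'I_n) : bool :=
  if j \in nset then xrow_z j l (+) (if l \in nset then cross l j else false)
  else if l \in nset then xrow_z l j else false.

Definition code_oo (l j : 'I_n) : bool :=
  (l != j) && (if l \in tset then zrow l j else if j \in tset then zrow j l else code_oo_free l j).

Definition code_diagram : er_diagram k n := ErDiagram
  [ffun=> ColZ] [ffun=> ColZ] [ffun=> 0]
  [ffun j => if j \in tset then (if zs j then 2%:R else 0) else if j \in nset then qs j else 0]
  [ffun ij => if code_io ij.1 ij.2 then Some true else None]
  [ffun jj => if code_oo jj.1 jj.2 then Some true else None]
  [ffun j => if j \in tset then [:: GateH] else [::]].
Local Notation D := code_diagram.

Lemma code_hd j : hd D j = (j \in tset).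
Proof. by rewrite /hd ffunE; case: (j \in tset). Qed.
Lemma code_ioE i j : io D i j = code_io i j.
Proof. by rewrite /io ffunE /=; case: code_io. Qed.
Lemma code_ooE i j : oo D i j = code_oo i j.
Proof. by rewrite /oo ffunE /=; case: code_oo. Qed.
Lemma code_q j : q D j =
  if j \in tset then (if zs j then 2%:R else 0) else if j \in nset then qs j else 0.
Proof. by rewrite /q ffunE. Qed.

(** For two positions in [nset] this is the commutation of the stabilizers of [xrow l] and
    [xrow j]. *)
Lemma code_oo_sym l j : code_oo l j = code_oo j l.
Proof.
rewrite /code_oo eq_sym; case: (l =P j) => [->//|/eqP lj] /=.
case: ifP => lT; case: ifP => jT //; first by rewrite !zrow_t // eq_sym.
rewrite /code_oo_free; case: ifP => jN; case: ifP => lN; rewrite ?addbF //.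
by have := dot_xrow_sym lN jN; rewrite !dot_xrow // -/(cross l j) -/(cross j l);
  case: (xrow_z l j) (xrow_z j l) (cross l j) (cross j l) => [] [] [] [].
Qed.

Lemma code_base : base D.
Proof.
split=> [j j'|j|i|j|ij|jj|j|j|i|j].
- by rewrite !ffunE /= code_oo_sym.
- by rewrite ffunE /= /code_oo eqxx.
- by rewrite ffunE.
- by rewrite ffunE.
- by rewrite ffunE; case: code_io.
- by rewrite ffunE; case: code_oo.
- rewrite -/(hd D j) code_hd => jT j' lt; rewrite ffunE /= /code_oo.
  case: (j' =P j) => [//|/eqP j'j] /=; rewrite jT [zrow j j']zrow_lt //.
  by case: (boolP (j' \in tset)) => // j'T; rewrite zrow_t // eq_sym (negPf j'j).
- by rewrite -/(hd D j) code_hd => jT i; rewrite ffunE /= /code_io jT.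
- by rewrite ffunE.
- by rewrite !ffunE; case: ifP => //= _; case: (zs j); [right|left].
Qed.

Lemma code_pivoted : pivoted D piv.
Proof.
split=> [|i i'|i j lt|i|i i'].
- exact: code_base.
- by rewrite code_ioE /code_io piv_t piv_n (inj_eq piv_inj) eq_sym.
- rewrite code_ioE /code_io; case: ifP => // jT; case: ifP => [jN|_].
    by rewrite xrow_gt // piv_t.
  by apply/negbTE; apply: contraL lt => /eqP ->; rewrite ltnn.
- by rewrite code_q piv_t piv_n.
- by rewrite code_ooE /code_oo /code_oo_free !piv_t !piv_n andbF.
Qed.

Local Notation bD := code_base.
Local Notation pD := code_pivoted.

Lemma code_par_t t y : t \in tset -> dot (zrow t) y = y t (+) par D y t.
Proof.
move=> tT; rewrite /dot (bigD1 t) //= zrow_t // eqxx /=; congr (_ (+) _).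
rewrite /par [RHS](bigD1 t) //= (oo_irr bD) addFb; apply: eq_bigr => j jt.
by rewrite code_ooE /code_oo eq_sym jt tT.
Qed.

(** As [zrow t] is 1 at t and its other entries are the edges at t, solving the equation for y_t
    gives the clause of [pt] at t. *)
Lemma code_supportP y : reflect (forall t, t \in tset -> dot (zrow t) y = zs t) (y == pt D y).
Proof.
have qE t : t \in tset -> (q D t != 0) = zs t by move=> tT; rewrite code_q tT; case: (zs t).
apply: (iffP eqP) => [e t tT|h].
  by rewrite code_par_t // e ffunE -e code_hd tT qE // [in LHS]addbC addbA addbb.
apply/ffunP => t; rewrite ffunE code_hd; case: ifP => // tT.
by rewrite qE // -h // code_par_t // addbC -addbA addbb addbF.
Qed.

(** A Z-type stabilizer multiplies the amplitude at y by a sign, which must be 1 wherever a codeword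
    is nonzero. *)
Lemma code_psi_support psi y : codespace K psi -> psi y != 0 -> y == pt D y.
Proof.
move=> psiK y0; apply/code_supportP => t tT.
have /ffunP/(_ y) := zsP tT psiK; rewrite ffunE addr0 -[RHS]mul1r => /(mulIf y0).
rewrite -sgnD; have neq := sgn_true_neq1 R.
by case: (zs t) (dot _ _) => [] [] //= /eqP; rewrite eq_sym neq.
Qed.

Lemma code_support_xrow y j : j \in nset -> y == pt D y -> y + xrow j == pt D (y + xrow j).
Proof.
move=> jN /code_supportP h; apply/code_supportP => t tT.
by rewrite dotDr h // (xset_orth (xrow_in jN) (zrow_in tT)) addbF.
Qed.

Lemma syndrome_xrow j : j \in nset -> syndrome D (xrow j) = 0.
Proof.
move=> jN; apply/ffunP => i; rewrite ffunE bits0 sum_xrow // => [|t tT]; last by rewrite code_ioE /code_io tT.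
rewrite code_ioE /code_io (negPf (nset_free jN)) jN.
rewrite (eq_bigr (fun i' => (i == i') && xrow j (piv i'))) => [|i' _]; last by rewrite (pivot_io pD).
rewrite (bigD1 i) //= eqxx big1 ?addbF ?addbb // => i' /negPf; rewrite eq_sym => -> //.
Qed.

(** The equation that [code_oo_free] and the parity of [qs] were chosen to solve; the two
    occurrences of [cross l j] cancel. *)
Lemma polar_xrow l j : l \notin tset -> j \in nset ->
  \big[addb/false]_(m | ~~ hd D m) (polar D l m && xrow j m) = xrow_z j l.
Proof.
move=> lT jN.
have -> : \big[addb/false]_(m | ~~ hd D m) (polar D l m && xrow j m) =
    \big[addb/false]_m ((if m \in tset then false else polar D l m) && xrow j m).
  by rewrite big_mkcond; apply: eq_bigr => m _; rewrite code_hd; case: (m \in tset).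
rewrite sum_xrow // => [|t ->//]; rewrite (negPf (nset_free jN)).
under eq_bigr do rewrite piv_t.
have jT := negPf (nset_free jN).
have [lN|lN] := boolP (l \in nset); last first.
  have [i ->] := piv_surj lT lN; rewrite big1 ?addbF => [|i' _].
    rewrite /polar; case: eqP => [e|_]; first by have := piv_n i; rewrite e jN.
    by rewrite code_ooE /code_oo /code_oo_free piv_t jT jN piv_n addbF;
      case: eqP => // e; have := piv_n i; rewrite e jN.
  rewrite /polar (inj_eq piv_inj); case: eqP => [->|_]; first by rewrite (pivot_phase pD).
  by rewrite (pivot_oo pD).
have lp i : (l == piv i) = false by apply/eqP => e; have := piv_n i; rewrite -e lN.
rewrite (eq_bigr (fun i => xrow_z l (piv i) && xrow j (piv i))) => [|i _]; last first.
  by rewrite /polar lp code_ooE /code_oo /code_oo_free lp (negPf lT) piv_t piv_n lN.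
rewrite -/(cross l j) /polar; case: eqP => [->|/eqP lj].
  by rewrite code_q jT jN (qsP jN).2 dot_xrow // -addbA addbb addbF.
by rewrite code_ooE /code_oo lj (negPf lT) jT /code_oo_free jN lN -addbA addbb addbF.
Qed.

(** By [polar_xrow], the sign from polarization is exactly that of the Z-part of the stabilizer. *)
Lemma quad_add_xrow y j : j \in nset -> quad R D (y + xrow j) =
  quad R D y * quad R D (xrow j) * sgn R (dot (xrow_z j) y).
Proof.
move=> jN; rewrite (quadD R bD); congr (_ * _).
rewrite -[sgn R _](prod_sgn_and R true (fun l => xrow_z j l && y l)) big_mkcond.
apply: eq_bigr => l _; rewrite code_hd; case: ifP => [/negbTE|/negbFE] lT; last first.
  by have [_ ->] := xrow_zP jN.
under eq_bigr do rewrite andbCA.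
rewrite prod_sgn_cond polar_xrow ?lT // andTb andbC //.
Qed.

(** Outside [tset], the vector [xrow j] is [delta j] plus a vector of pivots. On the latter the form
    is 1, and the edges between j and the pivots make up [cross j j]. *)
Lemma quad_xrow j : j \in nset -> quad R D (xrow j) = iq R (qs j) * sgn R (cross j j).
Proof.
move=> jN; have jT := nset_free jN.
pose w : bits n := [ffun l => (l \in pset) && xrow j l].
have -> : quad R D (xrow j) = quad R D (w + delta j).
  apply: eq_quad => l; rewrite code_hd => lT; rewrite bitsD ffunE delta_eq.
  have [lN|lN] := boolP (l \in nset).
    by rewrite xrow_n // (_ : (l \in pset) = false) // /pset in_setC in_setU lN orbT.
  rewrite /pset in_setC in_setU negb_or lT lN /=.
  by case: eqP => [e|]; rewrite ?addbF //; rewrite e jN in lN.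
have wp l : w l -> exists i, piv i = l.
  rewrite ffunE => /andP[+ _]; rewrite /pset in_setC in_setU negb_or => /andP[lT lN].
  by have [i ->] := piv_surj lT lN; exists i.
rewrite (quadD_delta R bD) ?code_hd // (quad_pivots R pD wp) mul1r code_q (negPf jT) jN.
congr (_ * _).
have -> : \prod_(l | ~~ hd D l) sgn R (polar D l j && w l) =
    sgn R (\big[addb/false]_l ((l \notin tset) && (polar D l j && w l))).
  rewrite -[RHS](prod_sgn_and R true (fun l => (l \notin tset) && (polar D l j && w l))) big_mkcond.
  by apply: eq_bigr => l _; rewrite code_hd; case: (l \in tset).
rewrite sum_split => [|t ->//]; rewrite big1 ?addFb => [|l lN]; last first.
  by rewrite ffunE /pset in_setC in_setU lN orbT /= !andbF.
congr (sgn R _); apply: eq_bigr => i _; rewrite ffunE piv_in piv_t /=; congr (_ && _).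
have jp : (piv i == j) = false by apply/eqP => e; have := piv_n i; rewrite e jN.
by rewrite /polar jp code_ooE /code_oo jp piv_t (negPf jT) /code_oo_free jN piv_n addbF.
Qed.

Definition rep (z : bits k) : bits n := pt D (of_pivots piv z).

(** The stabilizer of [xrow j] relates the values of a codeword at y and at y + [xrow j] by the same
    factor as [quad], and keeps the syndrome. The bits of y in [nset] are cleared one at a time. *)
Lemma codespace_rep psi y : codespace K psi -> y == pt D y ->
  psi y = quad R D y * psi (rep (syndrome D y)).
Proof.
move=> psiK; have [m] := ubnP #|[set j in nset | y j]|; elim: m y => // m IH y ltm ypt.
have [j /andP[jN yj]|no] := pickP (fun j => (j \in nset) && y j).
  have [[c hc cE] _] := qsP jN.
  have /ffunP/(_ y) := hc _ psiK; rewrite ffunE => <-.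
  rewrite IH.
  - rewrite (quad_add_xrow _ jN) (quad_xrow jN) (syndromeD D) (syndrome_xrow jN) addr0.
    set s := sgn R (dot _ _); set X := psi _.
    have -> : c * s * (quad R D y * (iq R (qs j) * sgn R (cross j j)) * s * X) =
      (c * iq R (qs j) * sgn R (cross j j)) * (s * s) * (quad R D y * X) by ring.
    by rewrite cE sgn2 !mul1r.
  - apply: (leq_trans _ (ltnSE ltm)); apply/proper_card/properP; split.
      apply/subsetP => l; rewrite [in X in X -> _]inE [in X in _ -> X]inE => /andP[lN].
      rewrite bitsD xrow_n // lN; case: eqP => [->|_]; rewrite ?addbF // yj //.
    exists j; rewrite [in X in is_true X]inE ?jN //.
    by rewrite andTb bitsD yj xrow_n // eqxx.
  - exact: code_support_xrow.
have y0 j : j \in nset -> y j = false by move=> jN; have := no j; rewrite jN.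
(* With no bit left in [nset], the free bits of y are its pivot bits, and these are its syndrome. *)
have ofE j : j \notin tset -> y j = of_pivots piv (syndrome D y) j.
  move=> jT; have [jN|jN] := boolP (j \in nset).
    rewrite y0 //; apply/esym/negbTE/negP => /of_pivots_pivot[i e].
    by have := piv_n i; rewrite e jN.
  have [i ->] := piv_surj jT jN.
  rewrite sum_bitsE (eq_bigr (fun i' => i == i')) => [|i' _]; last first.
    by rewrite delta_eq (inj_eq piv_inj).
  rewrite sum_eqb ffunE sum_split => [|t tT]; last by rewrite code_ioE /code_io tT.
  rewrite big1 ?addFb => [|l /y0 ->]; last by rewrite andbF.
  rewrite (bigD1 i) //= (pivot_io pD) eqxx big1 ?addbF // => i' /negPf.
  by rewrite (pivot_io pD) eq_sym => ->.
have yE : y = rep (syndrome D y).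
  by rewrite {1}(eqP ypt); apply: (eq_pt bD) => j; rewrite code_hd; apply: ofE.
rewrite -yE (_ : quad R D y = 1) ?mul1r //.
rewrite -[RHS](quad_pivots R pD (@of_pivots_pivot _ _ piv (syndrome D y))).
by apply: eq_quad => j; rewrite code_hd; apply: ofE.
Qed.

End Diagram.

End Existence.

(** * Encoders of a code *)

Lemma kernel0_surjective (F : fieldType) (I : finType) (T : I -> I -> F) :
  (forall phi : {ffun I -> F}, (forall i, \sum_j T i j * phi j = 0) -> phi = 0) ->
  forall psi : {ffun I -> F}, exists phi : {ffun I -> F}, forall i, \sum_j T i j * phi j = psi i.
Proof.
(* The transpose of [T], as row vectors are multiplied on the right. *)
move=> inj psi; pose A : 'M[F]_#|I| := \matrix_(a, b) T (enum_val b) (enum_val a).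
pose fn (v : 'rV[F]_#|I|) : {ffun I -> F} := [ffun i => v 0 (enum_rank i)].
have mulE v i : \sum_j T i j * fn v j = (v *m A) 0 (enum_rank i).
  rewrite mxE (reindex (@enum_rank I)) /=; last first.
    by exists (@enum_val I predT) => j _; rewrite ?enum_rankK ?enum_valK.
  by apply: eq_bigr => j _; rewrite !mxE ffunE !enum_rankK mulrC.
have uA : A \in unitmx.
  rewrite -row_free_unit; apply: inj_row_free => v vA.
  have fv : fn v = 0 by apply: inj => i; rewrite mulE vA mxE.
  apply/rowP => a; have := congr1 (fun f : {ffun I -> F} => f (enum_val a)) fv.
  by rewrite !ffunE enum_valK mxE.
exists (fn ((\row_a psi (enum_val a)) *m invmx A)) => i.
by rewrite mulE mulmxKV // mxE enum_rankK.
Qed.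

Section Fourier.
Variables (R : realType) (k : nat).
Local Notation C := (complex R).
Local Notation character := (character R).

Lemma characterC (x z : bits k) : character x z = character z x.
Proof. by apply: eq_bigr => i _; rewrite andbC. Qed.

Lemma sum_character (z : bits k) : \sum_x character x z = (z == 0)%:R * 2 ^+ k.
Proof.
rewrite -(bigA_distr_bigA (fun i b => sgn R (b && z i))).
have -> : \prod_i \sum_b sgn R (b && z i) = \prod_i ((z i == false)%:R * 2).
  apply: eq_bigr => i _; rewrite sum_bool /=; case: (z i); rewrite /sgn ?expr0 ?expr1 /=.
    by rewrite subrr mul0r.
  by rewrite mul1r.
rewrite big_split /= prodr_const card_ord prod_natb; congr (_%:R * _).
by apply: congr1; apply/eqfunP/eqP => [e|-> i]; [apply/ffunP => i; rewrite bits0 e|rewrite bits0].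
Qed.

Lemma fourier_inversion (h : bits k -> C) z :
  \sum_x character x z * ((2 ^+ k)^-1 * \sum_z' character x z' * h z') = h z.
Proof.
under eq_bigr do rewrite mulrCA mulr_sumr.
rewrite -mulr_sumr exchange_big /=.
have -> : \sum_z' \sum_x character x z * (character x z' * h z') = 2 ^+ k * h z.
  rewrite -(sum_delta z (fun z' => 2 ^+ k * h z')); apply: eq_bigr => z' _.
  under eq_bigr do rewrite mulrA -characterD.
  rewrite -mulr_suml sum_character mulrA; congr (_%:R * _ * _).
  by apply: congr1; apply/eqP/eqP => [/bitsDC ->|->]; rewrite ?bitsDD.
by rewrite mulKf // expf_neq0 // pnatr_eq0.
Qed.

End Fourier.

Section PivotedCode.
Variables (R : realType) (k n : nat) (D : er_diagram k n) (p : 'I_k -> 'I_n).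
Hypothesis pD : pivoted D p.
Local Notation C := (complex R).
Let bD : base D := pivoted_base pD.

(** Every syndrome z occurs in the support, at the point above [of_pivots p z], and the output there
    is a nonzero multiple of the Fourier coefficient of the input at z. *)
Lemma codeword_inj : injective (apply (codeword R D)).
Proof.
move=> phi phi' e.
have h z : \sum_x character R x z * phi x = \sum_x character R x z * phi' x.
  have := congr1 (fun psi : state R n => psi (pt D (of_pivots p z))) e.
  rewrite !apply_codeword_pt // (syndrome_of_pivots pD).
  by move/(mulfI (quad_neq0 _ _ _)).
apply/ffunP => x; rewrite -(fourier_inversion phi x) -(fourier_inversion phi' x).
apply: eq_bigr => z _; congr (_ * (_ * _)).
rewrite (eq_bigr (fun x => character R x z * phi x)) => [|z' _]; last by rewrite characterC.
rewrite [RHS](eq_bigr (fun x => character R x z * phi' x)) => [|z' _]; last by rewrite characterC.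
exact: h.
Qed.

Lemma encodes_scale (K : clifford_code R k n) (M N : bits n -> bits k -> C) c : c != 0 ->
  (forall y x, M y x = c * N y x) -> encodes N K -> encodes M K.
Proof.
move=> c0 MN [inj cod]; split=> [phi phi' e|psi].
  apply: inj; apply/ffunP => y; apply: (mulfI c0); have := congr1 (fun psi : state R n => psi y) e.
  rewrite !applyE !mulr_sumr => e'; do 2![rewrite (eq_bigr _ (fun x _ => mulrA _ _ _))].
  by under eq_bigr do rewrite -MN; under [RHS]eq_bigr do rewrite -MN.
exact: iff_trans (cod psi) (iff_sym (image_of_scale c0 MN psi)).
Qed.

End PivotedCode.

(** The codespace embeds into the code of [code_diagram], of the same dimension. *)
Lemma exists_pivoted (R : realType) k n (K : clifford_code R k n) (M : bits n -> bits k -> complex R) :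
  encodes M K -> exists (D : er_diagram k n) (p : 'I_k -> 'I_n),
    [/\ pivoted D p, forall i i' : 'I_k, (i < i')%N -> (p i < p i')%N & encodes (codeword R D) K].
Proof.
move=> [Minj Mcod]; pose psi0 := apply M (basis_state R 0).
have psi0K : codespace K psi0 by apply/Mcod; exists (basis_state R 0).
have psi0_neq0 : psi0 != 0.
  apply/eqP => e; have e0 : apply M 0 = 0.
    by apply/ffunP => y; rewrite applyE big1 ?ffunE // => x _; rewrite ffunE mulr0.
  have := Minj _ _ (etrans e (esym e0)) => /ffunP/(_ 0) /eqP; rewrite !ffunE eqxx.
  by rewrite oner_eq0.
have [zs zsP] := zsign_ex psi0K psi0_neq0.
have [qs qsP] := xphase_ex psi0K psi0_neq0.
pose D := code_diagram psi0K psi0_neq0 zs qs; pose p := piv psi0K psi0_neq0.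
have pD : pivoted D p by apply: code_pivoted.
have bD := pivoted_base pD.
(* The inverse Fourier transform of the values at the representatives of the syndromes. *)
pose lift (psi : state R n) : state R k :=
  [ffun x => (2 ^+ k)^-1 * \sum_z character R x z * psi (pt D (of_pivots p z))].
have liftE psi : codespace K psi -> apply (codeword R D) (lift psi) = psi.
  move=> psiK; apply/ffunP => y; rewrite apply_codeword.
  case: (y =P pt D y) => [e|ne]; last first.
    rewrite !mul0r; apply/esym/eqP/negPn/negP => y0; apply: ne; apply/eqP.
    exact: (code_psi_support _ _ _ zsP psiK y0).
  have /(codespace_rep qsP psiK) -> : y == pt D y by apply/eqP.
  rewrite mul1r; congr (_ * _).
  rewrite -[RHS](fourier_inversion (fun z => psi (pt D (of_pivots p z)))).
  by apply: eq_bigr => x _; rewrite ffunE characterC.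
exists D, p; split=> // [i i'|]; first exact: piv_lt.
split=> [|psi]; first exact: codeword_inj pD.
split=> [psiK|[phi <-]]; first by exists (lift psi); apply: liftE.
(* For the other inclusion: the encoder followed by [lift] is an injective endomorphism of the input
   states, hence surjective, so each [phi] is the lift of a codeword. *)
pose T (x' x : bits k) := lift (apply M (basis_state R x)) x'.
have TE (phi' : state R k) x' : \sum_x T x' x * phi' x = lift (apply M phi') x'.
  rewrite /T !ffunE; under eq_bigr do rewrite ffunE -mulrA.
  rewrite -mulr_sumr; congr (_ * _); under eq_bigr do rewrite mulr_suml.
  rewrite exchange_big; apply: eq_bigr => z _ /=; under eq_bigr do rewrite -mulrA apply_basis.
  by rewrite -mulr_sumr applyE.
have Tinj (phi0 : state R k) : (forall x', \sum_x T x' x * phi0 x = 0) -> phi0 = 0.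
  move=> h; apply: Minj; rewrite -(liftE (apply M phi0)); last by apply/Mcod; exists phi0.
  have -> : lift (apply M phi0) = 0 by apply/ffunP => x; rewrite -TE h ffunE.
  by apply/ffunP => y; rewrite !applyE !big1 // => x _; rewrite ffunE mulr0.
have [phi' phi'E] := kernel0_surjective Tinj phi.
have -> : phi = lift (apply M phi') by apply/ffunP => x; rewrite -phi'E TE.
by rewrite liftE; apply/Mcod; exists phi'.
Qed.

(** * Pivots and the row-reduced adjacency matrix *)

Section KLS.
Variables (k n : nat) (D : er_diagram k n).

Lemma io_adjE i j : io_adj D i j = (io D i j)%:R.
Proof. by rewrite mxE. Qed.

Lemma io_adj_neq0 i j : (io_adj D i j != 0) = io D i j.
Proof. by rewrite io_adjE; case: (io D i j). Qed.

Lemma io_adj_eq0 i j : io D i j = false -> io_adj D i j = 0.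
Proof. by rewrite io_adjE => ->. Qed.

Lemma pivoted_kls p : pivoted D p -> (forall i i' : 'I_k, (i < i')%N -> (p i < p i')%N) -> kls D.
Proof.
move=> pD p_mono; have bD := pivoted_base pD.
have leadP i j : leading (io_adj D) i j -> j = p i.
  rewrite /leading io_adj_neq0 => -[ij lj]; have [lt|gt|/val_inj //] := ltngtP j (p i).
    by rewrite (pivot_lead pD) in ij.
  by have /eqP := lj _ gt; rewrite -[_ == 0]negbK io_adj_neq0 (pivot_io pD) eqxx.
have p_lead i : io_adj D i (p i) = 1 by rewrite io_adjE (pivot_io pD) eqxx.
split.
- by split; [exact: base_sym|exact: base_irr].
- by split; [exact: base_in_color|exact: base_out_color].
- by split; [exact: base_io|exact: base_oo].
- by move=> j hj; split; [exact: base_had_oo|exact: base_had_io].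
- split=> [i i' _ /rowP/(_ (p i))|i i' j j' ii' /leadP -> /leadP ->|i j /leadP ->].
  + by rewrite mxE p_lead mxE => /eqP; rewrite oner_eq0.
  + exact: p_mono.
  + split=> // i' /negPf i'i; apply: io_adj_eq0; by rewrite (pivot_io pD) i'i.
- exact: base_in_phase.
- move=> j [i /leadP ->]; split; first exact: (pivot_phase pD).
  by rewrite (gatesE bD) (negPf (pivot_free pD i)).
- move=> j j' [i /leadP ->] [i' /leadP ->]; have := pivot_oo pD i i'.
  by rewrite /oo; case: (er_oo D _).
- exact: base_locals.
Qed.

(** Row echelon form admits zero rows, which have no pivot; the second hypothesis rules them out. *)
Lemma kls_pivoted : kls D -> (forall i, exists j, io D i j) ->
  exists2 p, pivoted D p & forall i i' : 'I_k, (i < i')%N -> (p i < p i')%N.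
Proof.
move=> kD rows.
have [p pP] : exists p : 'I_k -> 'I_n, forall i, leading (io_adj D) i (p i).
  apply: (fin_all_exists (P := fun i j => leading (io_adj D) i j)) => i.
  have [j0 ij0] := rows i; case: (arg_minnP val ij0) => j ij min; exists j.
  split=> [|j' lt]; first by rewrite io_adj_neq0.
  apply: io_adj_eq0; apply/negbTE/negP => /min; rewrite leqNgt; move: lt => /= -> //.
have [_ r2 r3] := kls_rref kD.
exists p => [|i i' lt]; last exact: (r2 _ _ _ _ lt (pP i) (pP i')).
split.
- exact: kls_base.
- move=> i i'; have [e h] := r3 _ _ (pP i); rewrite -io_adj_neq0.
  by case: (i' =P i) => [->|/eqP /h ->]; rewrite ?e ?oner_eq0 ?eqxx.
- move=> i j lt; have [_ h] := pP i; apply/negbTE; by rewrite -io_adj_neq0 h // eqxx.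
- by move=> i; apply: (kls_clifford_pivot kD (j := p i) _).1; exists i.
- by move=> i i'; rewrite /oo (kls_pivot_pivot kD) //; [exists i|exists i'].
Qed.

End KLS.

(** * Restriction to some of the inputs and outputs *)

Section Restrict.
Variables (k n k' n' : nat) (D : er_diagram k n) (f : 'I_k' -> 'I_k) (g : 'I_n' -> 'I_n).

Definition restrict : er_diagram k' n' := ErDiagram
  [ffun i => er_in_color D (f i)] [ffun j => er_out_color D (g j)]
  [ffun i => er_in_phase D (f i)] [ffun j => er_out_phase D (g j)]
  [ffun ij => er_io D (f ij.1, g ij.2)] [ffun jj => er_oo D (g jj.1, g jj.2)]
  [ffun j => er_gates D (g j)].

Hypothesis g_mono : forall j j' : 'I_n', (j < j')%N -> (g j < g j')%N.

Lemma mono_ltn j j' : (g j < g j')%N = (j < j')%N.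
Proof.
have [/g_mono//|/g_mono lt|/val_inj->] := ltngtP j j'; last by rewrite ltnn.
by apply/negbTE; rewrite -leqNgt ltnW.
Qed.

Lemma restrict_base : base D -> base restrict.
Proof.
move=> bD; split=> [j j'|j|i|j|ij|jj|j|j|i|j]; rewrite ?ffunE /=.
- exact: base_sym.
- exact: base_irr.
- exact: base_in_color.
- exact: base_out_color.
- exact: base_io.
- exact: base_oo.
- by move=> hj j' lt; rewrite ffunE; apply: (base_had_oo bD) => //; apply: g_mono.
- by move=> hj i; rewrite ffunE; apply: (base_had_io bD).
- exact: base_in_phase.
- exact: base_locals.
Qed.

Lemma restrict_pivoted p p' : pivoted D p -> injective f -> (forall i, p (f i) = g (p' i)) ->
  pivoted restrict p'.
Proof.
move=> pD f_inj pp; split=> [|i i'|i j lt|i|i i'].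
- exact/restrict_base/(pivoted_base pD).
- by rewrite /io ffunE /= -pp -/(io D _ _) (pivot_io pD) (inj_eq f_inj).
- by rewrite /io ffunE /= -/(io D _ _) (pivot_lead pD) // pp mono_ltn.
- by rewrite /q ffunE -pp; apply: (pivot_phase pD).
- by rewrite /oo ffunE /= -!pp; apply: (pivot_oo pD).
Qed.

End Restrict.

(** * Disjoint unions *)

Section DisjointUnion.
Variables (R : realType) (k n r : nat) (P : 'I_r -> factor k n).
Local Notation C := (complex R).

Definition pull m m' (f : 'I_m -> 'I_m') (y : bits m') : bits m := [ffun j => y (f j)].

Section Union.
Variable D : forall t, zx R (factor_k (P t)) (factor_n (P t)).

(** [disjoint_union] for arbitrary diagrams, so that [er_zx] can be replaced by [core_with], whose
    nodes are the inputs and outputs. *)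
Definition union_zx : zx R k n :=
  @Zx R k n {t : 'I_r & node (D t)}
    (fun v => node_color (tagged v))
    (fun v => node_phase (tagged v))
    (flatten [seq [seq map_edge
                         (map_point (fun v => existT (fun t => node (D t)) t v)
                            (factor_in (P t)) (factor_out (P t))) e
                     | e <- edges (D t)]
                | t : 'I_r]).

Lemma interp_union y x : interp union_zx y x =
  \sum_(s : {ffun {t : 'I_r & node (D t)} -> bool}) \prod_t
    ((\prod_v phase_weight (@node_phase _ _ _ (D t))
        (fun v => s (existT (fun t => node (D t)) t v)) v) *
     \prod_(e <- edges (D t)) amp R (@node_color _ _ _ (D t))
        (fun v => s (existT (fun t => node (D t)) t v))
        (pull (factor_out (P t)) y) (pull (factor_in (P t)) x) e).
Proof.
rewrite interpE; apply: eq_bigr => s _; rewrite big_split; congr (_ * _) => /=.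
  by rewrite sig_big_dep; apply: eq_bigr => -[t v] _.
rewrite big_flatten big_map big_enum; apply: eq_bigr => t _.
rewrite big_map; apply: eq_bigr => e _; rewrite /amp /=.
have hp p : point_vec R (fun v : {t & node (D t)} => node_color (tagged v)) s y x
    (map_point (fun v => existT (fun t => node (D t)) t v) (factor_in (P t)) (factor_out (P t)) p) =
  point_vec R (@node_color _ _ _ (D t)) (fun v => s (existT (fun t => node (D t)) t v))
    (pull (factor_out (P t)) y) (pull (factor_in (P t)) x) p.
  by case: p => [v|[i|j]] //=; rewrite ffunE.
by rewrite !hp.
Qed.

End Union.

Lemma disjoint_unionE :
  disjoint_union R P = union_zx (fun t => er_zx R (factor_diagram (P t))).
Proof. by []. Qed.

Definition fin (u : {t : 'I_r & 'I_(factor_k (P t))}) : 'I_k := factor_in (P (tag u)) (tagged u).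
Definition fout (u : {t : 'I_r & 'I_(factor_n (P t))}) : 'I_n := factor_out (P (tag u)) (tagged u).

(** The common interface of splitting and gluing: [D] copies the edges, phases and gates of the
    factors along their labels and has no edge between two factors. *)
Record assembled (D : er_diagram k n) : Prop := Assembled {
  asm_in : bijective fin;
  asm_out : bijective fout;
  asm_ord : forall t (j j' : 'I_(factor_n (P t))),
    (j < j')%N -> (factor_out (P t) j < factor_out (P t) j')%N;
  asm_base : forall t, base (factor_diagram (P t));
  asm_io : forall t i j, er_io D (factor_in (P t) i, factor_out (P t) j) =
    er_io (factor_diagram (P t)) (i, j);
  asm_io0 : forall t t' i j, t != t' ->
    er_io D (factor_in (P t) i, factor_out (P t') j) = None;
  asm_oo : forall t j j', er_oo D (factor_out (P t) j, factor_out (P t) j') =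
    er_oo (factor_diagram (P t)) (j, j');
  asm_oo0 : forall t t' j j', t != t' ->
    er_oo D (factor_out (P t) j, factor_out (P t') j') = None;
  asm_phase : forall t j, er_out_phase D (factor_out (P t) j) = er_out_phase (factor_diagram (P t)) j;
  asm_gates : forall t j, er_gates D (factor_out (P t) j) = er_gates (factor_diagram (P t)) j
}.

Definition label_type := {t : 'I_r & ('I_(factor_k (P t)) + 'I_(factor_n (P t)))%type}.
Definition label (v : label_type) : 'I_k + 'I_n :=
  match v with
  | existT t (inl i) => inl (factor_in (P t) i)
  | existT t (inr j) => inr (factor_out (P t) j)
  end.

Section Assembled.
Variable D : er_diagram k n.
Hypothesis aD : assembled D.
Hypothesis bD : base D.

Lemma big_in (F : 'I_k -> C) : \prod_i F i = \prod_t \prod_i F (factor_in (P t) i).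
Proof.
rewrite sig_big_dep (reindex fin) /=; last exact/onW_bij/(asm_in aD).
by apply: eq_bigl.
Qed.

Lemma big_out (A : pred 'I_n) (F : 'I_n -> C) :
  \prod_(j | A j) F j = \prod_t \prod_(j | A (factor_out (P t) j)) F (factor_out (P t) j).
Proof.
by rewrite sig_big_dep (reindex fout) /=; last exact/onW_bij/(asm_out aD).
Qed.

Lemma label_bij : bijective label.
Proof.
have [gi giK iK] := asm_in aD; have [go goK oK] := asm_out aD.
pose g (v : 'I_k + 'I_n) : label_type := match v with
  | inl i => existT (fun t => ('I_(factor_k (P t)) + 'I_(factor_n (P t)))%type) (tag (gi i)) (inl (tagged (gi i)))
  | inr j => existT (fun t => ('I_(factor_k (P t)) + 'I_(factor_n (P t)))%type) (tag (go j)) (inr (tagged (go j)))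
  end.
exists g => [[t [i|j]]|[i|j]] /=.
- by have := giK (existT _ t i); rewrite /fin /= => ->.
- by have := goK (existT _ t j); rewrite /fout /= => ->.
- by congr inl; apply: iK.
- by congr inr; apply: oK.
Qed.

Lemma weight_assembled (s : 'I_k + 'I_n -> bool) y x : weight R D s y x =
  \prod_t weight R (factor_diagram (P t)) (fun v => s (label (existT _ t v)))
            (pull (factor_out (P t)) y) (pull (factor_in (P t)) x).
Proof.
rewrite /weight !big_split /=; congr (_ * _ * _ * _ * _).
- by rewrite big_in; do 2!apply: eq_bigr => ? _; rewrite ffunE.
- by rewrite big_out; do 2!apply: eq_bigr => ? _; rewrite /q (asm_phase aD).
- by rewrite big_out; do 2!apply: eq_bigr => ? _; rewrite /hd (asm_gates aD) ffunE.
- rewrite big_in; apply: eq_bigr => t _; apply: eq_bigr => i _; rewrite big_out (bigD1 t) //=.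
  rewrite [X in _ * X]big1 ?mulr1 => [|t' neq].
    by apply: eq_bigr => j _; rewrite /io (asm_io aD).
  by rewrite big1 // => j _; rewrite /io (asm_io0 aD) // eq_sym.
rewrite (big_out predT); apply: eq_bigr => t _; apply: eq_bigr => j _; rewrite big_out (bigD1 t) //=.
rewrite [X in _ * X]big1 ?mulr1 => [|t' neq]; last first.
  by rewrite big1 // => j' _; rewrite /oo (asm_oo0 aD) // eq_sym.
apply: eq_big => [j'|j' _]; first by rewrite (mono_ltn (asm_ord aD (t := t))).
by rewrite /oo (asm_oo aD).
Qed.

Lemma interp_assembled y x : interp (disjoint_union R P) y x = interp (er_zx R D) y x.
Proof.
rewrite disjoint_unionE.
(* The node type of the union depends on the diagrams, so the whole family is rewritten at once. *)
have -> : (fun t => er_zx R (factor_diagram (P t))) =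
    (fun t => core_with R (factor_diagram (P t)) (hd (factor_diagram (P t)))).
  by apply: functional_extensionality_dep => t; apply/er_zxE/(asm_base aD).
rewrite interp_union (interp_weight R bD).
rewrite (reindex (fun s : {ffun 'I_k + 'I_n -> bool} => [ffun v : label_type => s (label v)])) /=.
  apply: eq_bigr => s _; rewrite weight_assembled; apply: eq_bigr => t _.
  rewrite (core_weight R (asm_base aD t)).
  by congr weight; apply: funext => v; rewrite ffunE.
have [g gK Kg] := label_bij.
exists (fun s : {ffun label_type -> bool} => [ffun v => s (g v)]) => s _; apply/ffunP => v;
  by rewrite !ffunE ?gK ?Kg.
Qed.

Lemma adj_label t u v :
  adj D (label (existT _ t u)) (label (existT _ t v)) = adj (factor_diagram (P t)) u v.
Proof.
by case: u v => [i|j] [i'|j'] //=; rewrite /io /oo ?(asm_io aD) ?(asm_oo aD).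
Qed.

Lemma adj_label_neq t t' u v : t != t' ->
  adj D (label (existT _ t u)) (label (existT _ t' v)) = false.
Proof.
move=> neq; have neq' : t' != t by rewrite eq_sym.
by case: u v => [i|j] [i'|j'] //=; rewrite /io /oo ?(asm_io0 aD) ?(asm_oo0 aD).
Qed.

Lemma connect_label (a b : label_type) :
  connect (adj D) (label a) (label b) -> tag a = tag b.
Proof.
have [g gK Kg] := label_bij => ab.
have cl : closed (adj D) [pred v | tag (g v) == tag a].
  move=> u v; rewrite !inE -[u]Kg -[v]Kg !gK; case: (g u) (g v) => [t u'] [t' v'].
  by have [e|neq] := eqVneq t t'; [move=> _; congr (_ == _)|rewrite adj_label_neq].
by have := closed_connect cl ab; rewrite !inE !gK eqxx => /esym/eqP ->.
Qed.

Lemma connected_label : (forall t u v, connect (adj (factor_diagram (P t))) u v) ->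
  forall a b : label_type, tag a = tag b -> connect (adj D) (label a) (label b).
Proof.
move=> conn [t u] [t' v] /= tt'; case: _ / tt' in v *.
have /connectP[s su ->] := conn t u v.
elim: s u su => [|w s IH] u //= /andP[uw ws].
by apply: connect_trans (IH _ ws); apply: connect1; rewrite adj_label.
Qed.

End Assembled.

End DisjointUnion.

(** * Connected components *)

Lemma unique_preimage_bij (A B : finType) (f : A -> B) :
  (forall b, exists! a, f a = b) -> bijective f.
Proof.
move=> h; have ex b : exists a, f a == b by have [a [<- _]] := h b; exists a.
have fK b : f (xchoose (ex b)) = b by apply/eqP/(xchooseP (ex b)).
exists (fun b => xchoose (ex b)) => // a.
by have [a' [_ u]] := h (f a); rewrite -[RHS](u a erefl) (u _ (fK _)).
Qed.

Lemma fiber_label m r (c : 'I_m -> 'I_r) i :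
  exists! u : {t : 'I_r & 'I_#|[set i | c i == t]|}, enum_val (tagged u) = i.
Proof.
have ii : i \in [set i' | c i' == c i] by rewrite inE.
exists (existT (fun t => 'I_#|[set i | c i == t]|) (c i) (enum_rank_in ii i)).
split=> [|[t a] /= ea]; first by rewrite /= enum_rankK_in.
have := enum_valP a; rewrite inE ea => /eqP e; subst t.
by congr existT; apply: enum_val_inj; rewrite enum_rankK_in.
Qed.

Local Arguments label : simpl never.

(** A path that starts in a factor never leaves it, for lack of edges to the others. *)
Lemma connect_assembled k n r (P : 'I_r -> factor k n) (D : er_diagram k n) t u v :
  assembled P D -> connect (adj D) (label (existT _ t u)) (label (existT _ t v)) ->
  connect (@adj (factor_k (P t)) (factor_n (P t)) (factor_diagram (P t))) u v.
Proof.
move=> aD /connectP[s su ev]; have [g gK Kg] := label_bij aD.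
elim: s u su ev => [u _ /= e|w s IH u /= /andP[uw ws] e].
  have := can_inj gK e => /eqP; rewrite eq_Tagged => /eqP /= ->; exact: connect0.
move: uw ws e; rewrite -[w]Kg; case: (g w) => t' w'.
have [e|neq] := eqVneq t t'; last by rewrite adj_label_neq.
case: _ / e in w' *; rewrite adj_label // => uw ws e.
exact: connect_trans (connect1 uw) (IH _ ws e).
Qed.

Section Split.
Variables (R : realType) (k n : nat) (D : er_diagram k n) (p : 'I_k -> 'I_n).
Hypothesis pD : pivoted D p.
Hypothesis p_mono : forall i i' : 'I_k, (i < i')%N -> (p i < p i')%N.
Let bD : base D := pivoted_base pD.

(** One canonical node in each connected component; these index the factors. *)
Definition root_set : {set 'I_k + 'I_n} := [set v | fingraph.root (adj D) v == v].

Lemma root_in v : fingraph.root (adj D) v \in root_set.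
Proof. by rewrite inE (root_root (connect_adj_sym bD)). Qed.

Definition class (v : 'I_k + 'I_n) : 'I_#|root_set| :=
  enum_rank_in (root_in v) (fingraph.root (adj D) v).

Lemma class_eq u v : (class u == class v) = connect (adj D) u v.
Proof.
rewrite -(root_connect (connect_adj_sym bD)); apply/eqP/eqP => [e|e].
  have := congr1 enum_val e; rewrite !enum_rankK_in ?root_in //.
by apply: enum_val_inj; rewrite !enum_rankK_in ?root_in.
Qed.

Lemma class_surj t : exists v, class v = t.
Proof.
exists (enum_val t); apply: enum_val_inj; rewrite enum_rankK_in ?root_in //.
by have := enum_valP t; rewrite inE => /eqP.
Qed.

Definition in_class t : {set 'I_k} := [set i | class (inl i) == t].
Definition out_class t : {set 'I_n} := [set j | class (inr j) == t].

Definition component (t : 'I_#|root_set|) : factor k n :=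
  @Factor k n #|in_class t| #|out_class t|
    (restrict D (fun i : 'I_#|in_class t| => enum_val i) (fun j : 'I_#|out_class t| => enum_val j))
    [ffun i => enum_val i] [ffun j => enum_val j].

Lemma component_mono t (j j' : 'I_#|out_class t|) : (j < j')%N -> (enum_val j < enum_val j')%N.
Proof. exact: enum_val_lt. Qed.

Lemma component_base t : base (factor_diagram (component t)).
Proof. exact/restrict_base/bD/component_mono. Qed.

Lemma in_classP t (i : 'I_#|in_class t|) : class (inl (enum_val i)) = t.
Proof. by have := enum_valP i; rewrite inE => /eqP. Qed.
Lemma out_classP t (j : 'I_#|out_class t|) : class (inr (enum_val j)) = t.
Proof. by have := enum_valP j; rewrite inE => /eqP. Qed.

Lemma class_adj u v : adj D u v -> class u = class v.
Proof. by move=> uv; apply/eqP; rewrite class_eq connect1. Qed.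

Lemma fin_component i :
  exists! u : {t & 'I_(factor_k (component t))}, factor_in (component (tag u)) (tagged u) = i.
Proof.
have [u [ui uu]] := fiber_label (fun i => class (inl i)) i.
exists u; split=> [|v]; first by rewrite ffunE.
by rewrite ffunE; apply: uu.
Qed.

Lemma fout_component j :
  exists! u : {t & 'I_(factor_n (component t))}, factor_out (component (tag u)) (tagged u) = j.
Proof.
have [u [ui uu]] := fiber_label (fun j => class (inr j)) j.
exists u; split=> [|v]; first by rewrite ffunE.
by rewrite ffunE; apply: uu.
Qed.

Lemma component_assembled : assembled component D.
Proof.
split=> [||t j j'|t|t i j|t t' i j neq|t j j'|t t' j j' neq|t j|t j].
- exact/unique_preimage_bij/fin_component.
- exact/unique_preimage_bij/fout_component.
- by rewrite !ffunE; apply: component_mono.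
- exact: component_base.
- by rewrite !ffunE.
- rewrite !ffunE; case E: (er_io D _) => [b|] //; case/negP: neq; apply/eqP.
  by rewrite -(in_classP i) -(out_classP j); apply: class_adj; rewrite /= /io E.
- by rewrite !ffunE.
- rewrite !ffunE; case E: (er_oo D _) => [b|] //; case/negP: neq; apply/eqP.
  by rewrite -(out_classP j) -(out_classP j'); apply: class_adj; rewrite /= /oo E.
- by rewrite !ffunE.
- by rewrite !ffunE.
Qed.

Lemma component_kls t : kls (factor_diagram (component t)).
Proof.
(* An input is adjacent to its pivot, so both lie in the same component. *)
have [p' pp'] : exists p' : 'I_#|in_class t| -> 'I_#|out_class t|,
    forall i, p (enum_val i) = enum_val (p' i).
  apply: (fin_all_exists (P := fun (i : 'I_#|in_class t|) (j : 'I_#|out_class t|) =>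
    p (enum_val i) = enum_val j)) => i.
  have pi : p (enum_val i) \in out_class t.
    rewrite inE -[X in _ == X](in_classP i); apply/eqP/esym/class_adj.
    by rewrite /= (pivot_io pD).
  by exists (enum_rank_in pi (p (enum_val i))); rewrite enum_rankK_in.
apply: (@pivoted_kls _ _ _ p').
  by apply: (restrict_pivoted (@component_mono t) pD) => //; apply: enum_val_inj.
move=> i i' lt; rewrite -(mono_ltn (@component_mono t)) -!pp'; apply: p_mono.
exact: enum_val_lt.
Qed.

Lemma label_component t v : class (label (existT _ t v : label_type component)) = t.
Proof. by case: v => [i|j]; rewrite /label /= ffunE ?in_classP ?out_classP. Qed.

Lemma component_connected t u v : connect (adj (factor_diagram (component t))) u v.
Proof.
apply: (connect_assembled component_assembled); rewrite -class_eq.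
by rewrite !label_component.
Qed.

Lemma component_prime t : prime_diagram R (factor_diagram (component t)).
Proof.
split; first exact: component_kls.
  have [[i|j] vt] := class_surj t.
    by rewrite addn_gt0 card_gt0; apply/orP; left; apply/set0Pn; exists i; rewrite inE vt.
  by rewrite addn_gt0 !card_gt0; apply/orP; right; apply/set0Pn; exists j; rewrite inE vt.
by apply: (connected_prime (component_base t)) => u v; apply: component_connected.
Qed.

Lemma exists_decomposition (K : clifford_code R k n) : encodes (codeword R D) K ->
  prime_decomposition K component.
Proof.
move=> enc; split.
- exact: component_prime.
- exact: (asm_ord component_assembled).
- exact: fin_component.
- exact: fout_component.
have [c c0 h] := interp_codeword R bD.
apply: (encodes_scale c0) enc => y x.
by rewrite (interp_assembled R component_assembled bD).
Qed.

End Split.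

(** * Uniqueness of the decomposition *)

Section Merge.
Variables (k n r : nat) (P : 'I_r -> factor k n).
Hypothesis P_in : bijective (@fin k n r P).
Hypothesis P_out : bijective (@fout k n r P).
Hypothesis P_ord : forall t (j j' : 'I_(factor_n (P t))),
  (j < j')%N -> (factor_out (P t) j < factor_out (P t) j')%N.
Hypothesis P_base : forall t, base (factor_diagram (P t)).

(** The inverse of the splitting. Each entry is found by searching for its label; the default [None]
    is the absence of an edge between factors. Colors and input phases are constant, as KLS factors
    require. *)
Definition merge : er_diagram k n := ErDiagram
  [ffun=> ColZ] [ffun=> ColZ] [ffun=> 0]
  [ffun j => if [pick v | fout (P := P) v == j] is Some v
             then er_out_phase (factor_diagram (P (tag v))) (tagged v) else 0]
  [ffun ij => if [pick w : {t : 'I_r & ('I_(factor_k (P t)) * 'I_(factor_n (P t)))%type} |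
                   (factor_in (P (tag w)) (tagged w).1, factor_out (P (tag w)) (tagged w).2) == ij]
              is Some w then er_io (factor_diagram (P (tag w))) (tagged w) else None]
  [ffun jj => if [pick w : {t : 'I_r & ('I_(factor_n (P t)) * 'I_(factor_n (P t)))%type} |
                   (factor_out (P (tag w)) (tagged w).1, factor_out (P (tag w)) (tagged w).2) == jj]
              is Some w then er_oo (factor_diagram (P (tag w))) (tagged w) else None]
  [ffun j => if [pick v | fout (P := P) v == j] is Some v
             then er_gates (factor_diagram (P (tag v))) (tagged v) else [::]].

Lemma factor_in_inj t t' i i' : factor_in (P t) i = factor_in (P t') i' ->
  existT (fun t => 'I_(factor_k (P t))) t i = existT (fun t => 'I_(factor_k (P t))) t' i'.
Proof. by move=> e; apply: (bij_inj P_in). Qed.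

Lemma factor_out_inj t t' j j' : factor_out (P t) j = factor_out (P t') j' ->
  existT (fun t => 'I_(factor_n (P t))) t j = existT (fun t => 'I_(factor_n (P t))) t' j'.
Proof. by move=> e; apply: (bij_inj P_out). Qed.

Lemma tag_in_inj t t' i i' : factor_in (P t) i = factor_in (P t') i' -> t = t'.
Proof. by move/factor_in_inj/(congr1 (@tag _ _)). Qed.
Lemma tag_out_inj t t' j j' : factor_out (P t) j = factor_out (P t') j' -> t = t'.
Proof. by move/factor_out_inj/(congr1 (@tag _ _)). Qed.
Lemma tagged_in_inj t i i' : factor_in (P t) i = factor_in (P t) i' -> i = i'.
Proof. by move/factor_in_inj/eqP; rewrite eq_Tagged => /eqP. Qed.
Lemma tagged_out_inj t j j' : factor_out (P t) j = factor_out (P t) j' -> j = j'.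
Proof. by move/factor_out_inj/eqP; rewrite eq_Tagged => /eqP. Qed.

Lemma pick_out (T : Type) (F : {t & 'I_(factor_n (P t))} -> T) d t j :
  (if [pick v | fout (P := P) v == factor_out (P t) j] is Some v then F v else d) = F (existT _ t j).
Proof.
case: pickP => [v /eqP e|/(_ (existT _ t j))]; last by rewrite /fout /= eqxx.
by congr F; apply: (bij_inj P_out).
Qed.

Lemma merge_io t i j :
  er_io merge (factor_in (P t) i, factor_out (P t) j) = er_io (factor_diagram (P t)) (i, j).
Proof.
rewrite ffunE; case: pickP => [[t' [i' j']] /= /eqP [e1 e2]|/(_ (existT _ t (i, j)))]; last first.
  by rewrite /= eqxx.
have e := tag_in_inj e1; subst t'.
by rewrite (tagged_in_inj e1) (tagged_out_inj e2).
Qed.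

Lemma merge_io_neq t t' i j : t != t' -> er_io merge (factor_in (P t) i, factor_out (P t') j) = None.
Proof.
move=> neq; rewrite ffunE; case: pickP => // -[t0 [i' j']] /= /eqP [/tag_in_inj e1 /tag_out_inj e2].
by rewrite -e1 -e2 eqxx in neq.
Qed.

Lemma merge_oo t j j' :
  er_oo merge (factor_out (P t) j, factor_out (P t) j') = er_oo (factor_diagram (P t)) (j, j').
Proof.
rewrite ffunE; case: pickP => [[t' [i' i2']] /= /eqP [e1 e2]|/(_ (existT _ t (j, j')))]; last first.
  by rewrite /= eqxx.
have e := tag_out_inj e1; subst t'.
by rewrite (tagged_out_inj e1) (tagged_out_inj e2).
Qed.

Lemma merge_oo_neq t t' j j' : t != t' ->
  er_oo merge (factor_out (P t) j, factor_out (P t') j') = None.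
Proof.
move=> neq; rewrite ffunE; case: pickP => // -[t0 [i i']] /= /eqP [/tag_out_inj e1 /tag_out_inj e2].
by rewrite -e1 -e2 eqxx in neq.
Qed.

Lemma merge_phase t j : er_out_phase merge (factor_out (P t) j) = er_out_phase (factor_diagram (P t)) j.
Proof. by rewrite ffunE pick_out. Qed.

Lemma merge_gates t j : er_gates merge (factor_out (P t) j) = er_gates (factor_diagram (P t)) j.
Proof. by rewrite ffunE pick_out. Qed.

Lemma merge_assembled : assembled P merge.
Proof.
split=> //; [exact: merge_io|exact: merge_io_neq|exact: merge_oo|exact: merge_oo_neq|
  exact: merge_phase|exact: merge_gates].
Qed.

Lemma in_ind (Q : 'I_k -> Prop) : (forall t i, Q (factor_in (P t) i)) -> forall i, Q i.
Proof. by move=> h i; have [g _ gK] := P_in; rewrite -(gK i); apply: h. Qed.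
Lemma out_ind (Q : 'I_n -> Prop) : (forall t j, Q (factor_out (P t) j)) -> forall j, Q j.
Proof. by move=> h j; have [g _ gK] := P_out; rewrite -(gK j); apply: h. Qed.

Lemma merge_base : base merge.
Proof.
split.
- apply: out_ind => t j; apply: out_ind => t' j'.
  have [e|neq] := eqVneq t t'; last by rewrite !merge_oo_neq // eq_sym.
  by subst t'; rewrite !merge_oo (base_sym (P_base t)).
- by apply: out_ind => t j; rewrite merge_oo (base_irr (P_base t)).
- by move=> i; rewrite ffunE.
- by move=> j; rewrite ffunE.
- move=> [i j]; move: i j; apply: in_ind => t i; apply: out_ind => t' j.
  have [e|neq] := eqVneq t t'; last by rewrite merge_io_neq.
  by subst t'; rewrite merge_io; apply: (base_io (P_base t)).
- move=> [i j]; move: i j; apply: out_ind => t i; apply: out_ind => t' j.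
  have [e|neq] := eqVneq t t'; last by rewrite merge_oo_neq.
  by subst t'; rewrite merge_oo; apply: (base_oo (P_base t)).
- apply: out_ind => t j; rewrite merge_gates => hj; apply: out_ind => t' j' lt.
  have [e|neq] := eqVneq t' t; last by rewrite merge_oo_neq.
  by subst t'; rewrite merge_oo (base_had_oo (P_base t)) // -(mono_ltn (P_ord (t := t))).
- apply: out_ind => t j; rewrite merge_gates => hj; apply: in_ind => t' i.
  have [e|neq] := eqVneq t' t; last by rewrite merge_io_neq.
  by subst t'; rewrite merge_io (base_had_io (P_base t)).
- by move=> i; rewrite ffunE.
- by apply: out_ind => t j; rewrite merge_phase merge_gates; apply: base_locals.
Qed.

Lemma merge_pivoted (pt : forall t, 'I_(factor_k (P t)) -> 'I_(factor_n (P t))) :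
  (forall t, pivoted (factor_diagram (P t)) (@pt t)) ->
  exists2 p, pivoted merge p & forall t i, p (factor_in (P t) i) = factor_out (P t) (pt t i).
Proof.
move=> ptP; have [g gK Kg] := P_in.
pose p i := factor_out (P (tag (g i))) (pt (tag (g i)) (tagged (g i))).
have pE t i : p (factor_in (P t) i) = factor_out (P t) (pt t i).
  by rewrite /p (gK (existT _ t i)).
exists p => //; split.
- exact: merge_base.
- apply: in_ind => t i; apply: in_ind => t' i'; rewrite pE /io.
  have [e|neq] := eqVneq t' t.
    subst t'; rewrite merge_io -/(io _ _ _) (pivot_io (ptP t)).
    by apply/eqP/eqP => [->|/tagged_in_inj].
  by rewrite merge_io_neq //; apply/esym/negbTE; apply: contra neq => /eqP/tag_in_inj ->.
- apply: in_ind => t i; apply: out_ind => t' j; rewrite pE /io => lt.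
  have [e|neq] := eqVneq t t'; last by rewrite merge_io_neq.
  by subst t'; rewrite merge_io -/(io _ _ _) (pivot_lead (ptP t)) // -(mono_ltn (P_ord (t := t))).
- by apply: in_ind => t i; rewrite pE /q merge_phase; apply: (pivot_phase (ptP t)).
- apply: in_ind => t i; apply: in_ind => t' i'; rewrite !pE /oo.
  have [e|neq] := eqVneq t t'; last by rewrite merge_oo_neq.
  by subst t'; rewrite merge_oo; apply: (pivot_oo (ptP t)).
Qed.

End Merge.

Lemma decomposition_merge (R : realType) k n (K : clifford_code R k n) r (P : 'I_r -> factor k n) :
  prime_decomposition K P -> exists (D : er_diagram k n) (p : 'I_k -> 'I_n),
  [/\ pivoted D p, assembled P D, encodes (codeword R D) K,
      forall t u v, connect (adj (factor_diagram (P t))) u v &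
      forall t (i i' : 'I_(factor_k (P t))), (i < i')%N ->
        (p (factor_in (P t) i) < p (factor_in (P t) i'))%N].
Proof.
move=> [P_prime P_ord P_in P_out P_enc].
have P_kls t : kls (factor_diagram (P t)) by case: (P_prime t).
have P_base t : base (factor_diagram (P t)) by exact: kls_base.
have in_bij : bijective (fin (P := P)) by apply: unique_preimage_bij.
have out_bij : bijective (fout (P := P)) by apply: unique_preimage_bij.
pose D := merge P; have aD : assembled P D by apply: merge_assembled.
have bD : base D by apply: merge_base.
have enc : encodes (codeword R D) K.
  have [c c0 h] := interp_codeword R bD.
  apply: (@encodes_scale _ _ _ _ _ (interp (disjoint_union R P)) c^-1); rewrite ?invr_neq0 // => y x.
  by rewrite (interp_assembled R aD bD) h mulKf.
(* An input without edges could be flipped without changing the output, against the injectivity of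
   the encoder. *)
have rows i : exists j, io D i j.
  case: (boolP [exists j, io D i j]) => [/existsP //|]; rewrite negb_exists => /forallP h.
  have e : basis_state R (delta i) = basis_state R 0.
    apply: enc.1; apply/ffunP => y; rewrite !apply_basis /codeword; congr (_ * _ * _).
    rewrite character_delta character0l ffunE big1 // => j _; by rewrite (negPf (h j)).
  have := congr1 (fun s : state R k => s 0) e; rewrite !ffunE eqxx.
  case: eqP => [/(congr1 (fun b : bits k => b i))|_] /eqP; last by rewrite eq_sym oner_eq0.
  by rewrite bits0 delta_eq eqxx.
have [pt ptP] : exists pt : forall t, 'I_(factor_k (P t)) -> 'I_(factor_n (P t)),
    forall t, pivoted (factor_diagram (P t)) (@pt t) /\
      forall i i' : 'I_(factor_k (P t)), (i < i')%N -> (pt t i < pt t i')%N.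
  apply: (fin_all_exists (P := fun t (q : 'I_(factor_k (P t)) -> 'I_(factor_n (P t))) =>
    pivoted (factor_diagram (P t)) q /\ forall i i' : 'I_(factor_k (P t)), (i < i')%N -> (q i < q i')%N)).
  move=> t; have [] := kls_pivoted (P_kls t); last by move=> q; exists q.
  move=> i; have [j] := rows (factor_in (P t) i); move: j; apply: (out_ind out_bij) => t' j.
  rewrite /io; have [e|neq] := eqVneq t t'; last by rewrite (asm_io0 aD).
  by subst t'; rewrite (asm_io aD) => ij; exists j.
have [p pD pE] := merge_pivoted in_bij out_bij P_ord P_base (fun t => (ptP t).1).
exists D, p; split=> // [t|t i i' lt]; last by rewrite !pE; apply/P_ord/(ptP t).2.
by have [_ _ np] := P_prime t; apply: (@prime_connected R _ _ _ (P_base t)).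
Qed.

(** Both list the same set in increasing order of [key], so the lists agree; the dependent pair
    carries along the equality of lengths. *)
Lemma increasing_image_eq (X : eqType) (key : X -> nat) a b (f : {ffun 'I_a -> X}) (g : {ffun 'I_b -> X}) :
  (forall i j : 'I_a, (i < j)%N -> (key (f i) < key (f j))%N) ->
  (forall i j : 'I_b, (i < j)%N -> (key (g i) < key (g j))%N) ->
  (forall i, exists j, g j = f i) -> (forall j, exists i, f i = g j) ->
  existT (fun m => {ffun 'I_m -> X}) a f = existT (fun m => {ffun 'I_m -> X}) b g.
Proof.
move=> fI gI fg gf; pose lt (x y : X) := (key x < key y)%N.
have srt m (h : {ffun 'I_m -> X}) : (forall i j : 'I_m, (i < j)%N -> (key (h i) < key (h j))%N) ->
    sorted lt [seq h i | i <- enum 'I_m].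
  move=> hI; rewrite sorted_map; apply: (@sub_sorted _ (fun i j : 'I_m => (i < j)%N)) => [i j|].
    exact: hI.
  by have := iota_ltn_sorted 0 m; rewrite -val_enum_ord sorted_map.
have e : [seq f i | i <- enum 'I_a] = [seq g i | i <- enum 'I_b].
  apply: (@irr_sorted_eq _ lt) (srt _ _ fI) (srt _ _ gI) _.
  - by move=> x y z; apply: ltn_trans.
  - by move=> x; apply: ltnn.
  move=> x; apply/mapP/mapP => [[i _ ->]|[j _ ->]].
    by have [j <-] := fg i; exists j; rewrite ?mem_enum.
  by have [i <-] := gf j; exists i; rewrite ?mem_enum.
have ab : a = b by have := congr1 size e; rewrite 2!size_map -2!cardE 2!card_ord.
subst b; congr existT; apply/ffunP => i.
by move/eq_in_map: e => /(_ i); rewrite mem_enum => ->.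
Qed.

(** A factor as a function of its label maps inside one ambient diagram. The maps are bundled with
    their sizes so that equality of factors reduces to equality of bundles, without casts. *)
Definition part k n (D : er_diagram k n) (u : {m & {ffun 'I_m -> 'I_k}}) (v : {m & {ffun 'I_m -> 'I_n}}) :
  factor k n := Factor (restrict D (tagged u) (tagged v)) (tagged u) (tagged v).

Lemma connect_homo (T T' : finType) (e : rel T) (e' : rel T') (f : T -> T') :
  (forall u v, e u v -> e' (f u) (f v)) -> forall u v, connect e u v -> connect e' (f u) (f v).
Proof.
move=> h u v /connectP[s su ->]; elim: s u su => [|w s IH] u //= /andP[uw ws].
exact: connect_trans (connect1 (h _ _ uw)) (IH _ ws).
Qed.

Lemma assembled_part k n r (P : 'I_r -> factor k n) (D D' : er_diagram k n) (s : 'I_k -> 'I_k) t :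
  assembled P D -> base D' ->
  (forall i j, er_io D' (s i, j) = er_io D (i, j)) -> er_oo D' = er_oo D ->
  er_out_phase D' = er_out_phase D -> er_gates D' = er_gates D ->
  Factor (factor_diagram (P t)) [ffun i => s (factor_in (P t) i)] (factor_out (P t)) =
  part D' (existT _ _ [ffun i => s (factor_in (P t) i)]) (existT _ _ (factor_out (P t))).
Proof.
move=> aD bD' hio hoo hph hga; rewrite /part /=; congr Factor; have bP := asm_base aD t.
have ext k' n' (A B : er_diagram k' n') : er_in_color A = er_in_color B ->
    er_out_color A = er_out_color B -> er_in_phase A = er_in_phase B ->
    er_out_phase A = er_out_phase B -> er_io A = er_io B -> er_oo A = er_oo B ->
    er_gates A = er_gates B -> A = B.
  by case: A => a1 a2 a3 a4 a5 a6 a7; case: B => b1 b2 b3 b4 b5 b6 b7 /= -> -> -> -> -> -> ->.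
apply: ext; apply/ffunP => z; rewrite !ffunE.
- by rewrite (base_in_color bP) (base_in_color bD').
- by rewrite (base_out_color bP) (base_out_color bD').
- by rewrite (base_in_phase bP) (base_in_phase bD').
- by rewrite hph (asm_phase aD).
- by case: z => i j; rewrite /= hio (asm_io aD).
- by case: z => i j; rewrite /= hoo (asm_oo aD).
- by rewrite hga (asm_gates aD).
Qed.

Lemma decomposition_unique (R : realType) k n (K : clifford_code R k n) r r'
    (P : 'I_r -> factor k n) (P' : 'I_r' -> factor k n) :
  prime_decomposition K P -> prime_decomposition K P' ->
  exists (s : {perm 'I_k}) (tau : 'I_r -> 'I_r'),
    bijective tau /\ forall t : 'I_r, P' (tau t) = permute_inputs s (P t).
Proof.
move=> dP dP'.
have [D [p [pD aD encD connP p_mono]]] := decomposition_merge dP.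
have [D' [p' [pD' aD' encD' connP' p'_mono]]] := decomposition_merge dP'.
have bD := pivoted_base pD; have bD' := pivoted_base pD'.
have DD' : same_code R D D'.
  by move=> psi; apply: iff_trans (iff_sym (encD.2 psi)) (encD'.2 psi).
have [s [sp sio soo sph sga]] := kls_unique pD pD' DD'.
have [g gK Kg] := label_bij aD; have [g' g'K Kg'] := label_bij aD'.
pose sg (v : 'I_k + 'I_n) : 'I_k + 'I_n := match v with inl i => inl (s i) | inr j => inr j end.
pose sgi (v : 'I_k + 'I_n) : 'I_k + 'I_n := match v with inl i => inl ((s^-1)%g i) | inr j => inr j end.
have sgK : cancel sg sgi by case=> [i|j] //=; rewrite permK.
have sgiK : cancel sgi sg by case=> [i|j] //=; rewrite permKV.
have adjE u v : adj D' (sg u) (sg v) = adj D u v.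
  by case: u v => [i|j] [i'|j'] //=; rewrite /io /oo ?sio ?soo.
have conn1 u v : connect (adj D) u v -> connect (adj D') (sg u) (sg v).
  by apply: connect_homo => a b; rewrite adjE.
have conn2 u v : connect (adj D') u v -> connect (adj D) (sgi u) (sgi v).
  by apply: connect_homo => a b; rewrite -adjE !sgiK.
(* Factors are connected and not joined to each other, so the partition into factors is determined
   by the glued diagram. *)
have same_tag u v : connect (adj D) u v <-> tag (g u) = tag (g v).
  rewrite -[in connect _ _ _](Kg u) -[in connect _ _ _](Kg v).
  by split; [exact: (connect_label aD)|exact: (connected_label aD)].
have same_tag' u v : connect (adj D') u v <-> tag (g' u) = tag (g' v).
  rewrite -[in connect _ _ _](Kg' u) -[in connect _ _ _](Kg' v).
  by split; [exact: (connect_label aD')|exact: (connected_label aD')].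
have node_ex q (Q : 'I_q -> factor k n) : prime_decomposition K Q ->
    forall t, exists v : 'I_(factor_k (Q t)) + 'I_(factor_n (Q t)), true.
  move=> dQ t; have [_ + _] := factor_prime dQ t; rewrite addn_gt0 => /orP[] gt0.
    by exists (inl (Ordinal gt0)).
  by exists (inr (Ordinal gt0)).
have [nd ndP] := fin_all_exists (node_ex _ _ dP).
have [nd' nd'P] := fin_all_exists (node_ex _ _ dP').
(* The factor of [P'] that contains the image of a chosen node of factor t; primes are nonempty, so
   a node can be chosen. *)
pose tau t := tag (g' (sg (label (existT _ t (nd t))))).
pose tau' t := tag (g (sgi (label (existT _ t (nd' t))))).
have tauE v : tag (g' (sg v)) = tau (tag (g v)).
  by apply/same_tag'/conn1/same_tag; rewrite gK.
have tau_inj : injective tau.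
  move=> t1 t2 /same_tag'/conn2; rewrite !sgK => /same_tag; by rewrite !gK.
have tauK' t : tau (tau' t) = t by rewrite -tauE sgiK g'K.
exists s, tau; split; first by exists tau' => t //; apply: tau_inj; rewrite tauK'.
move=> t; pose t' := tau t.
have labelE v : (tag (g v) == t) = (tag (g' (sg v)) == t') by rewrite tauE (inj_eq tau_inj).
have in_tag i : tag (g (inl i)) = t -> exists a, factor_in (P t) a = i.
  have := Kg (inl i); case: (g (inl i)) => t0 [a|a] //= [<-] e; by subst t0; exists a.
have out_tag j : tag (g (inr j)) = t -> exists a, factor_out (P t) a = j.
  have := Kg (inr j); case: (g (inr j)) => t0 [a|a] //= [<-] e; by subst t0; exists a.
have in_tag' i : tag (g' (inl i)) = t' -> exists a, factor_in (P' t') a = i.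
  have := Kg' (inl i); case: (g' (inl i)) => t0 [a|a] //= [<-] e; by subst t0; exists a.
have out_tag' j : tag (g' (inr j)) = t' -> exists a, factor_out (P' t') a = j.
  have := Kg' (inr j); case: (g' (inr j)) => t0 [a|a] //= [<-] e; by subst t0; exists a.
have -> : permute_inputs s (P t) =
    part D' (existT _ _ [ffun i => s (factor_in (P t) i)]) (existT _ _ (factor_out (P t))).
  exact: (assembled_part t aD bD').
have -> : P' t' = part D' (existT _ _ (factor_in (P' t'))) (existT _ _ (factor_out (P' t'))).
  have := assembled_part (s := id) t' aD' bD' (fun _ _ => erefl) erefl erefl erefl.
  have -> : [ffun i => id (factor_in (P' t') i)] = factor_in (P' t') by apply/ffunP => i; rewrite ffunE.
  by move=> <-; case: (P' t').
congr part.
(* Inputs are compared by their pivots, since [s] need not preserve their numbering: each factor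
   lists its inputs by increasing pivot, and [s] matches the pivots. *)
- apply: (increasing_image_eq (key := fun i => p' i)) => [i j|i j lt|i|i].
  + exact: p'_mono.
  + by rewrite !ffunE !sp; apply: p_mono.
  + have [a ea] : exists a, factor_in (P t) a = (s^-1)%g (factor_in (P' t') i).
      apply: in_tag; apply/eqP; rewrite labelE /= permKV.
      by rewrite -[inl _]/(label (existT _ t' (inl i))) g'K.
    by exists a; rewrite ffunE ea permKV.
  + rewrite ffunE; apply: in_tag'; apply/eqP; rewrite -[inl (s _)]/(sg (inl _)) -labelE.
    by rewrite -[inl _]/(label (existT _ t (inl i))) gK.
- apply: (increasing_image_eq (key := fun j : 'I_n => nat_of_ord j)) => [i j|i j lt|j|j].
  + exact: (asm_ord aD').
  + exact: (asm_ord aD).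
  + apply: out_tag; apply/eqP; rewrite labelE /=.
    by rewrite -[inr _]/(label (existT _ t' (inr j))) g'K.
  + apply: out_tag'; apply/eqP; rewrite -[inr _]/(sg (inr _)) -labelE.
    by rewrite -[inr _]/(label (existT _ t (inr j))) gK.
Qed.

Theorem theorem5p3 (R : realType) (k n : nat) (K : clifford_code R k n)
  (hK : exists D : er_diagram k n,
      encoder_respecting D /\
      encodes (interp (er_zx R D)) K /\
      row_free (io_adj D)) :
  (exists (r : nat) (P : 'I_r -> factor k n), prime_decomposition K P) /\
  (forall (r r' : nat) (P : 'I_r -> factor k n) (P' : 'I_r' -> factor k n),
     prime_decomposition K P -> prime_decomposition K P' ->
     exists (s : {perm 'I_k}) (tau : 'I_r -> 'I_r'),
       bijective tau /\
       forall t : 'I_r, P' (tau t) = permute_inputs s (P t)).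
Proof.
split; last by move=> r r' P P'; apply: decomposition_unique.
have [D0 [_ [/exists_pivoted[D [p [pD p_mono enc]]] _]]] := hK.
by eexists; eexists; apply: (exists_decomposition pD p_mono enc).
Qed.
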